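(* Fix real parameters $p > 1$, $q > 1$ and $T > 0$. For each positive integer $n$, set $B = n^p$, $\gamma = n^{-q}$ and $d = n^T$. Let the training inputs be the regularly spaced points $x_{\mathsf{train},i} = -1 + 2i/n$ ($i = 1,\dots,n$) with all labels equal to $+1$, let $\boldsymbol{\phi}(x) = \left[\tfrac{1}{\sqrt{2}}, \sin(\pi x), \cos(\pi x), \ldots, \sin(\tfrac{B}{2}\pi x), \cos(\tfrac{B}{2}\pi x)\right] \in \mathbb{R}^B$ be the Fourier feature map, and let $\boldsymbol{\Sigma} = \mathrm{diag}(\lambda_1,\dots,\lambda_B)$ with $\lambda_1 = \gamma B$ and $\lambda_j = \frac{(1-\gamma)B}{B-1}$ for $j \ge 2$. Let $\widehat{f}(x) = \langle\widehat{\boldsymbol{\alpha}}_2, \boldsymbol{\phi}(x)\rangle$ where $\widehat{\boldsymbol{\alpha}}_2 = \arg\min_{\boldsymbol{\alpha}}\|\boldsymbol{\Sigma}^{-1/2}\boldsymbol{\alpha}\|_2$ subject to $\boldsymbol{\phi}(x_{\mathsf{train},i})^\top\boldsymbol{\alpha} = 1$ for all $i$. Draw $\boldsymbol{z}_1,\dots,\boldsymbol{z}_d$ i.i.d. from $\mathcal{N}(\boldsymbol{0},\boldsymbol{\Sigma})$ and define the random-Fourier-sum features $\boldsymbol{\phi}^{\mathsf{RFS}}(x)\in\mathbb{R}^d$ by $\boldsymbol{\phi}^{\mathsf{RFS}}_i(x) = \langle \boldsymbol{z}_i, \boldsymbol{\phi}(x)\rangle$. Let $\widehat{\boldsymbol{\beta}}_2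 = \arg\min_{\boldsymbol{\beta}\in\mathbb{R}^d}\|\boldsymbol{\beta}\|_2$ subject to $\boldsymbol{\phi}^{\mathsf{RFS}}(x_{\mathsf{train},i})^\top\boldsymbol{\beta} = 1$ for all $i$, and $\widehat{g}(x) = \langle\widehat{\boldsymbol{\beta}}_2, \boldsymbol{\phi}^{\mathsf{RFS}}(x)\rangle$. Then: (1) if $T > 6p - 1$, then $\lim_{n\to\infty}\mathcal{C}(\widehat{f}) = \lim_{n\to\infty}\mathcal{C}(\widehat{g})$; (2) if $T > 6p + 1 - 2q$, then $\lim_{n\to\infty}\mathcal{C}_{\mathsf{adv}}(\widehat{f}, 1/n) = \lim_{n\to\infty}\mathcal{C}_{\mathsf{adv}}(\widehat{g}, 1/n)$.
   Context: All risks are computed over a test point $x\sim\mathrm{Unif}[-1,1]$ with ground truth $f^\ast\equiv 1$: the classification risk is $\mathcal{C}(f) = \mathbb{P}[\mathrm{sgn}(f(x))\neq\mathrm{sgn}(f^\ast(x))]$ and the adversarial risk with radius $\epsilon$ is $\mathcal{C}_{\mathsf{adv}}(f,\epsilon) = \mathbb{E}\left[\max_{\tilde{x}:\,|\tilde{x}-x|\le\epsilon}\mathbb{I}[\mathrm{sgn}(f(\tilde{x}))\neq\mathrm{sgn}(f^\ast(x))]\right]$. The function $\widehat{g}$ is random through the draw of $\boldsymbol{z}_1,\dots,\boldsymbol{z}_d$. *)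

(* Defs.v *)
From HB Require Import structures.
From mathcomp Require Import all_boot all_order all_algebra.
From mathcomp Require Import all_classical all_reals all_analysis.
Set Implicit Arguments. Unset Strict Implicit. Unset Printing Implicit Defensive.
Import Order.TTheory GRing.Theory Num.Theory.
Import numFieldNormedType.Exports.
Local Open Scope classical_set_scope.
Local Open Scope ring_scope.

Section Defs.
Variable R : realType.

Definition sizeB (p : R) (n : nat) : nat := Num.truncn ((n%:R : R) `^ p).
Definition sizeD (T : R) (n : nat) : nat := Num.truncn ((n%:R : R) `^ T).
Definition gam (q : R) (n : nat) : R := (n%:R : R) `^ (- q).

(* Fourier features, coordinate j (0-based):
   j = 0 : 1/sqrt 2 ; j = 2k-1 : sin(k pi x) ; j = 2k : cos(k pi x). *)
Definition fourier (j : nat) (x : R) : R :=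
  if j == 0%N then (Num.sqrt 2)^-1
  else if odd j then sin ((j.+1./2)%:R * pi * x)
  else cos ((j./2)%:R * pi * x).

Definition lam (B : nat) (g : R) (j : nat) : R :=
  if j == 0%N then g * B%:R else (1 - g) * B%:R / (B%:R - 1).

Definition xtrain (n : nat) (k : 'I_n) : R := -1 + 2 * (k.+1)%:R / n%:R.

Definition PhiMat (n B : nat) : 'M[R]_(n, B) :=
  \matrix_(k < n, j < B) fourier j (xtrain k).

Definition wnorm (B : nat) (l : nat -> R) (a : 'cV[R]_B) : R :=
  Num.sqrt (\sum_(j < B) (a j 0 / Num.sqrt (l j)) ^+ 2).

Definition enorm (m : nat) (b : 'cV[R]_m) : R :=
  Num.sqrt (\sum_(i < m) (b i 0) ^+ 2).

Definition min_norm_interp (n m : nat) (N : 'cV[R]_m -> R) (A : 'M[R]_(n, m))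
  : 'cV[R]_m :=
  xget 0 [set v | A *m v = const_mx 1 /\
                  forall v', A *m v' = const_mx 1 -> N v <= N v'].

Definition alpha_hat (n B : nat) (g : R) : 'cV[R]_B :=
  min_norm_interp (wnorm (lam B g)) (PhiMat n B).
Definition fhat (n B : nat) (g : R) (x : R) : R :=
  \sum_(j < B) alpha_hat n B g j 0 * fourier j x.

Definition phiRFS (d B : nat) (Z : 'M[R]_(d, B)) (i : 'I_d) (x : R) : R :=
  \sum_(j < B) Z i j * fourier j x.
Definition PsiMat (n d B : nat) (Z : 'M[R]_(d, B)) : 'M[R]_(n, d) :=
  \matrix_(k < n, i < d) phiRFS Z i (xtrain k).
Definition beta_hat (n d B : nat) (Z : 'M[R]_(d, B)) : 'cV[R]_d :=
  min_norm_interp (@enorm d) (PsiMat n Z).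
Definition ghat (n d B : nat) (Z : 'M[R]_(d, B)) (x : R) : R :=
  \sum_(i < d) beta_hat n Z i 0 * phiRFS Z i x.

(* Risks with x ~ Unif[-1,1], f* = 1 (so sgn f*(x) = 1). *)
Definition class_risk (f : R -> R) : R :=
  fine (lebesgue_measure [set x : R | -1 <= x <= 1 /\ Num.sg (f x) != 1]) / 2.
Definition adv_risk (f : R -> R) (eps : R) : R :=
  fine (lebesgue_measure [set x : R | -1 <= x <= 1 /\
          exists xt : R, `|xt - x| <= eps /\ Num.sg (f xt) != 1]) / 2.

(* Convergence in (outer) probability of X n to the constant L. *)
Definition cvg_in_prob dd (Om : measurableType dd) (P : probability Om R)
  (X : nat -> Om -> R) (L : R) : Prop :=
  forall eps : R, 0 < eps ->
    exists E : nat -> set Om,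
      (forall n, measurable (E n)) /\
      (forall n, [set w | eps < `|X n w - L|] `<=` E n) /\
      (fun n => fine (P (E n))) @ \oo --> (0 : R).

End Defs.

(* Main.v *)
Require Import Defs.
From HB Require Import structures.
From mathcomp Require Import all_boot all_order all_algebra.
From mathcomp Require Import all_classical all_reals all_analysis.
From mathcomp Require Import measurable_realfun.
From mathcomp Require Import ring lra zify.
Set Implicit Arguments. Unset Strict Implicit. Unset Printing Implicit Defensive.
Import Order.TTheory GRing.Theory Num.Theory.
Import numFieldNormedType.Exports.
Local Open Scope classical_set_scope.
Local Open Scope ring_scope.

(** Position the test point as y = n (1 + x) / 2, so that training points are integers, and
    write a, b for the kernel weights of the constant and of the other features.  By aliasing
    fhat = (a + b D(y)) / (a + b M), where D is the sum of cos (2 pi t y) for 1 <= t <= M and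
    2 D(y) + 1 = sin (pi (2 M + 1) y) / sin (pi y).

    Classification: fhat errs where 2 D + 1 <= 1 - 2 a / b; the right side tends to 1, 0 or
    -oo according to p < q, p = q or p > q, and the risk to 3/4, 1/2 or 0.  The function ghat
    is the kernel interpolant for the empirical covariance of the Z_i, whose Frobenius deviation
    from Sigma has second moment O(B^2 / d); hence ghat and fhat have, up to O(1/n), the same
    threshold.

    Adversarial risk: both limits are 1.  Just after every training point there
    are L points z_1, ..., z_L with fhat(z_l) <= 0.  Write Z = G Sigma^(1/2) with G standard
    Gaussian.  If the constraints are feasible then ghat(z) = fhat(z) + <beta, G u_z>, where u_z
    is the part of Sigma^(1/2) phi(z) orthogonal to the training features.  The u_{z_l} have
    nonpositive pairwise inner products, so that their Gram-Schmidt vectors are nonnegative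
    combinations of them; the reflections in these vectors preserve the law of G and fix beta,
    hence all <beta, G u_{z_l}> are positive with probability at most 2^-L.  Markov's inequality
    over the training points then shows that only a small fraction of them has no adversarial
    example nearby.  If the constraints are infeasible, ghat = 0 errs everywhere. *)

(** * Inner products, minimum-norm interpolation and its regularisation *)

Section MinNorm.
Variable R : realType.

(** Since [fhat] has no margin, closeness of [ghat] to [fhat] is not enough for classification: the
    error set must also be stable. It is a sublevel set of the ratio sin (pi Q y) / sin (pi y) with
    Q = 2 M + 1. On cells of half a period of the numerator the ratio is, up to the sign of the
    cell, sin (pi v) / sin (pi s), where v is the position in the cell and s the offset of y from an
    integer. Level 0 keeps the odd half of the cells; level 1 adds the part of the even cells with
    sin (pi v) <= sin (pi s), on average half of them. Hence 1/2 and 1/2 + 1/4, and small changes of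
    the level move little mass.

    In the adversarial part, an even number of features leaves one sine without its cosine and
    breaks translation invariance. This rank-one term can add 4 [wb] to an inner product of
    residuals, so the translation-invariant part must lie below - 4 [wb].

    A further obstacle is measurability: [beta_hat] is a choice and the sets of test points need not
    be measurable. Probabilities are therefore only evaluated on measurable events of Gaussian
    matrices that contain the events of interest. *)

Definition ip (n : nat) (u v : 'cV[R]_n) : R := \sum_i u i 0 * v i 0.

Lemma ipC n (u v : 'cV[R]_n) : ip u v = ip v u.
Proof. by apply: eq_bigr => i _; rewrite mulrC. Qed.

Lemma ipDl n (u v w : 'cV[R]_n) : ip (u + v) w = ip u w + ip v w.
Proof. by rewrite /ip -big_split; apply: eq_bigr => i _; rewrite mxE mulrDl. Qed.

Lemma ipDr n (u v w : 'cV[R]_n) : ip w (u + v) = ip w u + ip w v.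
Proof. by rewrite ipC ipDl !(ipC w). Qed.

Lemma ipZl n a (u v : 'cV[R]_n) : ip (a *: u) v = a * ip u v.
Proof. by rewrite /ip mulr_sumr; apply: eq_bigr => i _; rewrite mxE mulrA. Qed.

Lemma ipZr n a (u v : 'cV[R]_n) : ip u (a *: v) = a * ip u v.
Proof. by rewrite ipC ipZl ipC. Qed.

Lemma ipNl n (u v : 'cV[R]_n) : ip (- u) v = - ip u v.
Proof. by rewrite -scaleN1r ipZl mulN1r. Qed.

Lemma ipNr n (u v : 'cV[R]_n) : ip u (- v) = - ip u v.
Proof. by rewrite ipC ipNl ipC. Qed.

Lemma ipBl n (u v w : 'cV[R]_n) : ip (u - v) w = ip u w - ip v w.
Proof. by rewrite ipDl ipNl. Qed.

Lemma ipBr n (u v w : 'cV[R]_n) : ip w (u - v) = ip w u - ip w v.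
Proof. by rewrite ipDr ipNr. Qed.

Lemma ip0l n (v : 'cV[R]_n) : ip 0 v = 0.
Proof. by rewrite -(scale0r 0) ipZl mul0r. Qed.

Lemma ip0r n (v : 'cV[R]_n) : ip v 0 = 0.
Proof. by rewrite ipC ip0l. Qed.

Lemma ip_sumr n (I : finType) (P : pred I) (F : I -> 'cV[R]_n) u :
  ip u (\sum_(i | P i) F i) = \sum_(i | P i) ip u (F i).
Proof.
by apply: (big_morph (ip u)) => [v w|]; rewrite ?ipDr ?ip0r.
Qed.

Lemma ip_ge0 n (u : 'cV[R]_n) : 0 <= ip u u.
Proof. by apply: sumr_ge0 => i _; rewrite -expr2 sqr_ge0. Qed.

Lemma ip_eq0 n (u : 'cV[R]_n) : ip u u = 0 -> u = 0.
Proof.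
move/psumr_eq0P => h; apply/colP => i; rewrite mxE.
have /eqP := h (fun i _ => ltac:(by rewrite -expr2 sqr_ge0)) i isT.
by rewrite mulf_eq0 orbb => /eqP.
Qed.

Lemma ip_mulmx n m (A : 'M[R]_(n, m)) u v : ip (A *m u) v = ip u (A^T *m v).
Proof.
rewrite /ip; transitivity (\sum_i \sum_j A i j * u j 0 * v i 0).
  by apply: eq_bigr => i _; rewrite mxE mulr_suml.
rewrite exchange_big; apply: eq_bigr => j _; rewrite mxE mulr_sumr.
by apply: eq_bigr => i _; rewrite mxE; ring.
Qed.

Lemma ip_mulmxr n m (A : 'M[R]_(n, m)) u v : ip u (A *m v) = ip (A^T *m u) v.
Proof. by rewrite ipC ip_mulmx ipC. Qed.

Lemma CS n (u v : 'cV[R]_n) : ip u v ^+ 2 <= ip u u * ip v v.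
Proof.
have [v0|vn0] := eqVneq (ip v v) 0.
  by rewrite (ip_eq0 v0) !ip0r expr0n mulr0.
have vp : 0 < ip v v by rewrite lt_def vn0 ip_ge0.
have := ip_ge0 (ip v v *: u - ip u v *: v).
rewrite ipBl !ipBr !ipZl !ipZr (ipC v u) => h.
rewrite -subr_ge0 -(pmulr_rge0 _ vp).
by apply: le_trans h _; rewrite le_eqVlt; apply/orP; left; apply/eqP; ring.
Qed.

Lemma ip_sqrt n (u v : 'cV[R]_n) :
  `|ip u v| <= Num.sqrt (ip u u) * Num.sqrt (ip v v).
Proof.
rewrite -sqrtrM ?ip_ge0 // -sqrtr_sqr ler_wsqrtr //; exact: CS.
Qed.

(** Pythagoras: since the weighted vector s v0 lies in the row space of [A], every feasible v has Q
    v = Q v0 + Q (v - v0), so v0 is the only minimiser and the choice operator must return it. The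
    weights [s] cover both [wnorm] and [enorm]. *)
Lemma min_norm_interpE n m (A : 'M[R]_(n, m)) (s : 'I_m -> R)
    (N : 'cV[R]_m -> R) v0
    (w : 'cV[R]_n) :
  (forall j, 0 < s j) ->
  (forall v : 'cV[R]_m, N v = Num.sqrt (\sum_j s j * v j 0 ^+ 2)) ->
  A *m v0 = const_mx 1 -> (forall j, s j * v0 j 0 = (A^T *m w) j 0) ->
  min_norm_interp N A = v0.
Proof.
move=> s0 hN Av0 hw.
pose Q (v : 'cV[R]_m) := \sum_j s j * v j 0 ^+ 2.
have Q0 v : 0 <= Q v by apply: sumr_ge0 => j _; rewrite mulr_ge0 ?sqr_ge0 ?ltW.
have QE v : A *m v = const_mx 1 -> Q v = Q v0 + Q (v - v0).
  move=> Av; have : ip (v - v0) (A^T *m w) = 0.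
    by rewrite -ip_mulmx mulmxBr Av Av0 subrr ip0l.
  rewrite /ip => h0.
  rewrite -[LHS]addr0 -(mulr0 (- 2)) -h0 /Q -big_split /= mulr_sumr -big_split /=.
  by apply: eq_bigr => j _; rewrite -hw !mxE; ring.
have sm : [set v | A *m v = const_mx 1 /\
  forall v', A *m v' = const_mx 1 -> N v <= N v'] v0.
  split=> // v' Av'; rewrite !hN -!/(Q _) ler_sqrt ?Q0 // (QE _ Av').
  by rewrite lerDl.
apply: xget_unique => // v [Av /(_ _ Av0)].
rewrite !hN -!/(Q _) ler_sqrt ?Q0 // (QE _ Av) gerDl => h.
have /psumr_eq0P h0 : Q (v - v0) = 0 by apply/eqP; rewrite eq_le h Q0.
apply/colP => j; have := h0 (fun j _ => ltac:(by rewrite mulr_ge0 ?sqr_ge0 ?ltW)) j isT.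
by move/eqP; rewrite mulf_eq0 (gt_eqF (s0 j)) /= sqrf_eq0 !mxE subr_eq0 => /eqP.
Qed.

Lemma enormE m (b : 'cV[R]_m) :
  enorm b = Num.sqrt (\sum_j (fun=> 1) j * b j 0 ^+ 2).
Proof. by congr Num.sqrt; apply: eq_bigr => j _; rewrite mul1r. Qed.

Lemma min_enormE n m (A : 'M[R]_(n, m)) w :
  A *m A^T *m w = const_mx 1 -> min_norm_interp (@enorm R m) A = A^T *m w.
Proof.
move=> h; apply: (@min_norm_interpE _ _ A (fun=> 1) _ _ w) => //.
- exact: enormE.
- by rewrite mulmxA.
- by move=> j; rewrite mul1r.
Qed.

Lemma min_wnormE n B (A : 'M[R]_(n, B)) (l : nat -> R) (w : 'cV[R]_n) :
  (forall j : 'I_B, 0 < l j) ->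
  A *m (\col_j (l j * (A^T *m w) j 0)) = const_mx 1 ->
  min_norm_interp (wnorm l) A = \col_j (l j * (A^T *m w) j 0).
Proof.
move=> l0 h; apply: (@min_norm_interpE _ _ A (fun j => (l j)^-1) _ _ w) => //.
- by move=> j; rewrite invr_gt0.
- move=> v; congr Num.sqrt; apply: eq_bigr => j _.
  by rewrite expr_div_n sqr_sqrtr ?(ltW (l0 j)) // mulrC.
- by move=> j; rewrite mxE mulKf // gt_eqF.
Qed.

(** The default value of [xget] is 0; the predictor built from it is identically 0 and, since sg 0
    differs from 1, counts as an error everywhere. *)
Lemma min_norm_infeasible n m N (A : 'M[R]_(n, m)) :
  ~ (exists v : 'cV[R]_m, A *m v = const_mx 1) -> min_norm_interp N A = 0.
Proof. by move=> h; apply: xgetPN => v [Av _]; apply: h; exists v. Qed.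

(** The Gram matrix may be singular here. A column c of its cokernel satisfies |A^T c|^2 = 0, hence
    annihilates the range of [A], so the Gram matrix has the same range as [A]. *)
Lemma gram_solve n m (A : 'M[R]_(n, m)) (v : 'cV[R]_m) (b : 'cV[R]_n) :
  A *m v = b -> exists w, A *m A^T *m w = b.
Proof.
move=> Av; pose G := A *m A^T; have Gt : G^T = G by rewrite trmx_mul trmxK.
have : (b^T <= G)%MS.
  rewrite submxE -Av trmx_mul -mulmxA; apply/eqP.
  suff -> : A^T *m cokermx G = 0 by rewrite mulmx0.
  apply/matrixP => i j; rewrite [RHS]mxE.
  have /ip_eq0/colP/(_ i) : ip (A^T *m col j (cokermx G)) (A^T *m col j (cokermx G)) = 0; last by rewrite colE mulmxA -colE !mxE.
  rewrite ip_mulmxr trmxK mulmxA [A *m A^T](_ : _ = G) // colE mulmxA.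
    by rewrite mulmx_coker mul0mx ip0l.
case/submxP => D hD; exists D^T.
by rewrite -/G -[LHS]trmxK trmx_mul trmxK Gt -hD trmxK.
Qed.

Lemma unitmx_inj n (G : 'M[R]_n) :
  (forall w : 'cV[R]_n, G *m w = 0 -> w = 0) -> G \in unitmx.
Proof.
move=> h; rewrite -unitmx_tr -row_free_unit -kermx_eq0; apply/eqP/row_matrixP => i.
rewrite row0; apply/eqP; rewrite -trmx_eq0; apply/eqP; apply: h.
by apply: trmx_inj; rewrite trmx_mul !trmxK trmx0 -row_mul mulmx_ker row0.
Qed.

(** The Tikhonov-regularised interpolant. It is built from matrix operations and the inverse of a
    matrix that is always invertible for e > 0, so it depends measurably on [A]. *)
Definition tikh n m (A : 'M[R]_(n, m)) (e : R) : 'cV[R]_m :=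
  A^T *m (invmx (A *m A^T + e%:M) *m const_mx 1).

Lemma tikh_unit n m (A : 'M[R]_(n, m)) (e : R) : 0 < e -> A *m A^T + e%:M \in unitmx.
Proof.
move=> e0; apply: unitmx_inj => w h; apply: ip_eq0.
have : ip w ((A *m A^T + e%:M) *m w) = 0 by rewrite h ip0r.
rewrite mulmxDl mul_scalar_mx ipDr ipZr -mulmxA ip_mulmxr.
have := ip_ge0 (A^T *m w); have := ip_ge0 w => h1 h2 h3.
by apply/eqP; rewrite eq_le h1 andbT -(pmulr_rle0 _ e0) -h3 lerDr.
Qed.

(** With v = w - t, where A^T t is the regularised solution, (A A^T + e) v = e w; pairing with v
    gives |A^T v|^2 = e (<v, w> - |v|^2) <= e |w|^2. The rate involves the witness w but no spectral
    gap. *)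
Lemma tikh_close n m (A : 'M[R]_(n, m)) (w : 'cV[R]_n) (e : R) :
  0 < e ->
  A *m A^T *m w = const_mx 1 ->
  ip (A^T *m w - tikh A e) (A^T *m w - tikh A e) <= e * ip w w.
Proof.
move=> e0 hw; pose t : 'cV[R]_n := invmx (A *m A^T + e%:M) *m const_mx 1.
have ht : (A *m A^T + e%:M) *m t = const_mx 1 by rewrite mulKVmx // tikh_unit.
have -> : A^T *m w - tikh A e = A^T *m (w - t) by rewrite mulmxBr.
set v := w - t.
have hv : (A *m A^T + e%:M) *m v = e *: w.
  by rewrite mulmxBr ht mulmxDl hw mul_scalar_mx addrC addKr.
clearbody v.
have : ip v ((A *m A^T + e%:M) *m v) = e * ip v w by rewrite hv ipZr.
rewrite mulmxDl mul_scalar_mx ipDr ipZr -mulmxA ip_mulmxr => h.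
have h1 := ip_ge0 (v - w); rewrite !ipBl !ipBr (ipC w v) in h1.
have h2 := ip_ge0 v.
have -> : ip (A^T *m v) (A^T *m v) = e * (ip v w - ip v v) by lra.
by rewrite ler_pM2l //; have := ip_ge0 w; lra.
Qed.

End MinNorm.

(** * Aliasing on the training grid and the closed form of [fhat] *)

Section Trig.
Variable R : realType.
Implicit Types (x y h : R).

Lemma cosDn x (m : nat) : cos (x + 2 * pi * m%:R) = cos x :> R.
Proof.
rewrite -[RHS](periodicn (@cosD2pi R) m); congr cos.
by rewrite -mulrnA -[in RHS]mulr_natr natrM; ring.
Qed.

Lemma cosDz x (z : int) : cos (x + 2 * pi * z%:~R) = cos x :> R.
Proof.
case: z => m; first exact: cosDn.
rewrite NegzE mulrNz mulrN -[LHS](cosDn _ m.+1); congr cos.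
by rewrite subrK.
Qed.

Lemma sinDz x (z : int) : sin (x + 2 * pi * z%:~R) = sin x :> R.
Proof. by rewrite -!cosBpihalf addrAC cosDz. Qed.

Lemma sin_pin (m : nat) : sin (pi * m%:R) = 0 :> R.
Proof.
elim: m => [|m IH]; first by rewrite mulr0 sin0.
by rewrite -natr1 mulrDr mulr1 sinDpi IH oppr0.
Qed.

Lemma sin_piz (z : int) : sin (pi * z%:~R) = 0 :> R.
Proof. by case: z => m; rewrite ?NegzE ?mulrNz ?mulrN ?sinN sin_pin ?oppr0. Qed.

Lemma cos_pin_sqr (m : nat) : cos (pi * m%:R) ^+ 2 = 1 :> R.
Proof. by rewrite cos2sin2 sin_pin expr0n subr0. Qed.

Lemma cos_prod x y : cos x * cos y = (cos (x + y) + cos (x - y)) / 2 :> R.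
Proof. by rewrite cosD cosB; field. Qed.

(** Kept free of division, so that sin (h / 2) = 0 is not excluded. *)
Lemma sum_cos_AP S (t h : R) :
  sin (h / 2) * \sum_(k < S) cos (t + h * k%:R) =
  sin (S%:R * h / 2) * cos (t + (S%:R - 1) * h / 2).
Proof.
elim: S => [|S IH]; first by rewrite big_ord0 !mul0r sin0 mulr0 mul0r.
rewrite big_ord_recr /= mulrDr IH -[S.+1%:R]natr1.
have E (a b c : R) : sin (a + c) * cos (b + c) = sin a * cos b + sin c * cos (a + b + c).
  rewrite sinD !cosD sinD; set C := cos c; set s := sin c.
  rewrite [LHS](_ : _ = (sin a * cos b + s * ((cos a * cos b - sin a * sin b) * C - (sin a * cos b + cos a * sin b) * s)) + sin a * cos b * (C ^+ 2 + s ^+ 2 - 1)); last by ring.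
  by rewrite cos2Dsin2 subrr mulr0 addr0.
have -> : (S%:R + 1) * h / 2 = S%:R * h / 2 + h / 2 by ring.
have -> : t + (S%:R + 1 - 1) * h / 2 = (t + (S%:R - 1) * h / 2) + h / 2 by ring.
by rewrite E; congr (_ + _ * cos _); field.
Qed.

Lemma sin_pi_frac_neq0 (z : int) (n : nat) : (0 < n)%N -> ~~ (n %| z)%Z ->
  sin (pi * z%:~R / n%:R) != 0 :> R.
Proof.
move=> n0 nz.
have n0R : 0 < n%:R :> R by rewrite ltr0n.
have n0z : (n : int) != 0 by rewrite eqz_nat -lt0n.
have := divz_eq z n; set q := (z %/ n)%Z; set r := (z %% n)%Z => zE.
have r0 : (0 < r)%R by rewrite lt_def modz_ge0 // andbT; apply: contra nz => /eqP/dvdz_mod0P.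
have rn : (r < n)%R by apply: ltz_pmod; rewrite ltz_nat.
have -> : pi * z%:~R / n%:R = pi * r%:~R / n%:R + pi * q%:~R :> R.
  by rewrite zE rmorphD rmorphM /= -[(n : int)%:~R]/(n%:R) ; field; rewrite gt_eqF.
rewrite sinD sin_piz mulr0 addr0 mulf_neq0 //.
  rewrite gt_eqF // sin_gt0_pi //; apply/andP; split.
    by rewrite divr_gt0 // mulr_gt0 ?pi_gt0 // ltr0z.
  by rewrite ltr_pdivrMr // ltr_pM2l ?pi_gt0 // -[n%:R]/((n : int)%:~R) ltr_int.
apply/eqP => h0; have := cos2Dsin2 (pi * q%:~R : R).
by rewrite sin_piz h0 !expr0n addr0 => /eqP; rewrite eq_sym oner_eq0.
Qed.

Definition tgrid n (k : nat) : R := k.+1%:R / n%:R.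

(** Aliasing: the sum over the full grid closes up because sin (pi z) = 0, and the prefactor sin (pi
    z / n) vanishes only when n divides z, in which case all terms are equal. *)
Lemma sum_cos_grid n (z : int) (t : R) : (0 < n)%N ->
  \sum_(k < n) cos (2 * pi * z%:~R * tgrid n k + t) =
  if (n %| z)%Z then n%:R * cos t else 0.
Proof.
move=> n0; have n0R : n%:R != 0 :> R by rewrite pnatr_eq0 -lt0n.
case: ifPn => [/dvdzP [q ->]|nz].
  rewrite (eq_bigr (fun=> cos t)) ?sumr_const ?card_ord ?mulr_natl // => k _.
  rewrite -[RHS](cosDz _ (q * k.+1)); congr cos.
  by rewrite /tgrid !rmorphM /= -[(n : int)%:~R]/(n%:R) -[(k.+1 : int)%:~R]/(k.+1%:R); field.
have := @sum_cos_AP n (2 * pi * z%:~R / n%:R + t) (2 * pi * z%:~R / n%:R).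
rewrite [2 * pi * _ / _ / 2](_ : _ = pi * z%:~R / n%:R); last by field.
rewrite [n%:R * _ / 2](_ : _ = pi * z%:~R); last by field.
rewrite sin_piz mul0r => /eqP; rewrite mulf_eq0 (negPf (sin_pi_frac_neq0 n0 nz)) /=.
move=> /eqP {2}<-; apply: eq_bigr => k _; congr cos.
by rewrite /tgrid -natr1; field.
Qed.

Lemma pi_xtrain n (k : 'I_n) : (0 < n)%N ->
  pi * xtrain R k = 2 * pi * tgrid n k - pi.
Proof.
by move=> n0; rewrite /xtrain /tgrid; field; rewrite pnatr_eq0 -lt0n.
Qed.

Lemma sum_cos_train n (m : nat) (t : R) : (0 < n)%N ->
  \sum_(k < n) cos (m%:R * pi * xtrain R k + t) =
  if (n %| m)%N then n%:R * cos (t - m%:R * pi) else 0.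
Proof.
move=> n0; rewrite -[(n %| m)%N]/((n %| (m : int))%Z) -sum_cos_grid //.
apply: eq_bigr => k _; congr cos.
by rewrite -mulrA pi_xtrain // -[(m : int)%:~R]/(m%:R); ring.
Qed.

Lemma sum_sin_train n (m : nat) : (0 < n)%N ->
  \sum_(k < n) sin (m%:R * pi * xtrain R k) = 0.
Proof.
move=> n0; under eq_bigr do rewrite -cosBpihalf.
rewrite sum_cos_train //; case: ifP => // _.
by rewrite -opprD cosN [_ + _ * pi]addrC cosDpihalf [_ * pi]mulrC sin_pin oppr0 mulr0.
Qed.

Lemma feat_split N (F : nat -> R) :
  \sum_(j < N.*2.+1) F j = F 0%N + \sum_(m < N) (F m.*2.+1 + F m.*2.+2).
Proof.
elim: N => [|N IH]; first by rewrite big_ord_recr !big_ord0 /= addr0 add0r.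
by rewrite doubleS 2!big_ord_recr /= IH [in RHS]big_ord_recr /= !addrA.
Qed.

Lemma fourier0 x : fourier 0 x = (Num.sqrt 2)^-1 :> R.
Proof. by []. Qed.

Lemma fourier_sin m x : fourier m.*2.+1 x = sin (m.+1%:R * pi * x) :> R.
Proof. by rewrite /fourier [odd _]/= odd_double -[m.*2.+2]doubleS doubleK. Qed.

Lemma fourier_cos m x : fourier m.*2.+2 x = cos (m.+1%:R * pi * x) :> R.
Proof. by rewrite /fourier /= odd_double /= doubleK. Qed.

Lemma fourier0_sqr x : fourier 0 x * fourier 0 x = 2^-1 :> R.
Proof. by rewrite fourier0 -invfM -expr2 sqr_sqrtr. Qed.

Lemma fourier_norm j x : `|fourier j x| <= 1 :> R.
Proof.
rewrite /fourier; case: ifP => _.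
  rewrite ger0_norm ?invr_ge0 ?sqrtr_ge0 // invf_le1 ?sqrtr_gt0 //.
  by rewrite -[leLHS]sqrtr1 ler_sqrt ?ler1n.
by case: ifP => _; [exact: sin_max|exact: cos_max].
Qed.

Lemma sum_dvd_reindex N n (F : nat -> R) : (0 < n)%N ->
  \sum_(m < N | (n %| m.+1)%N) F m.+1 = \sum_(t < N %/ n) F (t.+1 * n)%N.
Proof.
move=> n0; elim: N => [|N IH]; first by rewrite div0n !big_ord0.
rewrite big_mkcond big_ord_recr /= -big_mkcond /= IH divnS //.
case: ifP => h; last by rewrite add0n addr0.
by rewrite add1n big_ord_recr /=; congr (_ + F _); move: (divnK h); rewrite divnS // h.
Qed.

Definition kern B g x y : R :=
  \sum_(j < B) lam B g j * (fourier j x * fourier j y).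

(* On the training grid the kernel is wa + wb times a sum of cosines: the square
   of the constant feature 1/sqrt 2 halves its eigenvalue gam * B. *)
Definition wa B (g : R) : R := g * B%:R / 2.
Definition wb B (g : R) : R := (1 - g) * B%:R / (B%:R - 1).

(** A sine and a cosine of equal frequency combine to a function of x - y. For even [B] the last
    feature is a sine of frequency B / 2 without its cosine, which leaves the extra product. *)
Lemma kern_split B g x y : (0 < B)%N ->
  kern B g x y = wa B g + wb B g * \sum_(m < B.-1./2) cos (m.+1%:R * pi * (x - y))
   + (~~ odd B)%:R * (wb B g * (sin (B./2%:R * pi * x) * sin (B./2%:R * pi * y))).
Proof.
move=> B0.
have E : B = ((B.-1)./2.*2.+1 + ~~ odd B)%N.
  rewrite -[in LHS](prednK B0) -[in LHS](odd_double_half B.-1) -[in RHS](prednK B0) /= negbK.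
  by rewrite addnC.
set N := B.-1./2 in E *.
have odd_part : \sum_(j < N.*2.+1) lam B g j * (fourier j x * fourier j y) =
   wa B g + wb B g * \sum_(m < N) cos (m.+1%:R * pi * (x - y)).
  rewrite (feat_split N (fun j => lam B g j * (fourier j x * fourier j y))) fourier0_sqr mulr_sumr; congr (_ + _); apply: eq_bigr => m _.
  by rewrite !fourier_sin !fourier_cos mulrBr cosB /lam /= -/(wb B g); ring.
rewrite /kern; set L := lam B g in odd_part *; move: E.
case oB : (odd B) => /=; rewrite ?mul0r ?addr0 ?addn0 ?addn1 => E.
  by rewrite [in LHS]E.
have E2 : B./2 = N.+1 by rewrite E -doubleS doubleK.
rewrite [in LHS]E big_ord_recr /= odd_part mul1r; congr (_ + _).
by rewrite !fourier_sin E2 /L /lam.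
Qed.

Lemma kernC B g x y : kern B g x y = kern B g y x.
Proof. by apply: eq_bigr => j _; rewrite [fourier j x * _]mulrC. Qed.

Definition dirich M y : R := \sum_(t < M) cos (2 * pi * t.+1%:R * y).

Definition ybar n x : R := n%:R * (1 + x) / 2.
(* The number of cosine frequencies that alias to a constant on the training grid. *)
Definition Mof n B := (B.-1./2 %/ n)%N.

(** Only frequencies divisible by n survive the sum over the training points, and the unmatched sine
    sums to 0. The result takes the same value at every training point, so constant weights solve
    the kernel system. *)
Lemma sum_kern_train n B g x : (0 < n)%N -> (0 < B)%N ->
  \sum_(k < n) kern B g (xtrain R k) x =
  n%:R * (wa B g + wb B g * dirich (Mof n B) (ybar n x)).
Proof.
move=> n0 B0; under eq_bigr do rewrite kern_split //.
rewrite !big_split /=.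
rewrite sumr_const card_ord [in RHS]mulrDr [n%:R * wa _ _]mulr_natl -addrA.
congr (_ + _).
rewrite -!mulr_sumr -mulr_suml sum_sin_train // mul0r !mulr0 addr0.
rewrite mulrCA; congr (_ * _); rewrite exchange_big /=.
rewrite (eq_bigr (fun m : 'I_(B.-1./2) => if (n %| m.+1)%N then
   n%:R * cos (m.+1%:R * pi * (1 + x)) else 0)); last first.
  move=> m _; under eq_bigr do rewrite mulrBr.
  rewrite sum_cos_train //; case: ifP => // _; congr (_ * _).
  by rewrite -cosN; congr cos; ring.
rewrite -big_mkcond -mulr_sumr /=; congr (_ * _).
rewrite (@sum_dvd_reindex _ _ (fun m => cos (m%:R * pi * (1 + x)))) //.
by apply: eq_bigr => t _; congr cos; rewrite natrM /ybar; field.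
Qed.

Lemma fhat_kern n B g (w : 'cV[R]_n) : (forall j : 'I_B, 0 < lam B g j) ->
  (forall i : 'I_n, \sum_(k < n) w k 0 * kern B g (xtrain R k) (xtrain R i) = 1) ->
  forall x, fhat n B g x = \sum_(k < n) w k 0 * kern B g (xtrain R k) x.
Proof.
move=> l0 hw x.
have E y : \sum_(k < n) w k 0 * kern B g (xtrain R k) y =
    \sum_j (\col_j (lam B g j * ((PhiMat R n B)^T *m w) j 0)) j 0 * fourier j y.
  rewrite /kern; under eq_bigr do rewrite mulr_sumr.
  rewrite exchange_big; apply: eq_bigr => j _ /=; rewrite !mxE mulr_sumr mulr_suml.
  by apply: eq_bigr => k _; rewrite !mxE; ring.
rewrite E /fhat /alpha_hat (@min_wnormE _ _ _ _ _ w) //.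
apply/colP => i; rewrite !mxE -[RHS](hw i) E.
by apply: eq_bigr => j _; rewrite mulrC; congr (_ * _); rewrite mxE.
Qed.

Lemma dirich_int M (k : nat) : dirich M (k%:R) = M%:R.
Proof.
rewrite /dirich (eq_bigr (fun=> 1)) ?sumr_const ?card_ord // => t _.
by rewrite -mulrA -natrM -[X in cos X]add0r cosDn cos0.
Qed.

Lemma ybar_train n (k : 'I_n) : (0 < n)%N -> ybar n (xtrain R k) = k.+1%:R.
Proof. by move=> n0; rewrite /ybar /xtrain; field; rewrite pnatr_eq0 -lt0n. Qed.

Lemma fhatE n B g x : (0 < n)%N -> (0 < B)%N ->
  (forall j : 'I_B, 0 < lam B g j) ->
  0 < wa B g + wb B g * (Mof n B)%:R ->
  fhat n B g x = (wa B g + wb B g * dirich (Mof n B) (ybar n x)) /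
                 (wa B g + wb B g * (Mof n B)%:R).
Proof.
move=> n0 B0 l0 k0; have n0R : n%:R != 0 :> R by rewrite pnatr_eq0 -lt0n.
have k1 := lt0r_neq0 k0.
set ka := wa B g + _ in k0 k1 *.
rewrite (@fhat_kern n B g (const_mx (n%:R * ka)^-1)) //.
  under eq_bigr do rewrite mxE.
  rewrite -mulr_sumr sum_kern_train //.
  by rewrite invfM mulrACA mulVf // mul1r mulrC.
move=> i; under eq_bigr do rewrite mxE.
rewrite -mulr_sumr sum_kern_train // ybar_train // dirich_int -/ka.
by rewrite mulVf // mulf_neq0.
Qed.

End Trig.

(** * Stability of the kernel interpolant under a perturbed covariance *)

Section Perturb.
Variable R : realType.

Definition nv n (u : 'cV[R]_n) : R := Num.sqrt (ip u u).

Lemma nv_ge0 n (u : 'cV[R]_n) : 0 <= nv u.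
Proof. exact: sqrtr_ge0. Qed.

Lemma nv_sqr n (u : 'cV[R]_n) : nv u ^+ 2 = ip u u.
Proof. by rewrite sqr_sqrtr // ip_ge0. Qed.

Definition frob2 n m (A : 'M[R]_(n, m)) : R := \sum_i \sum_j A i j ^+ 2.

Lemma frob2_ge0 n m (A : 'M[R]_(n, m)) : 0 <= frob2 A.
Proof. by apply: sumr_ge0 => i _; apply: sumr_ge0 => j _; rewrite sqr_ge0. Qed.

Lemma ip_mulmx_frob n m (A : 'M[R]_(n, m)) u v :
  `|ip u (A *m v)| <= Num.sqrt (frob2 A) * nv u * nv v.
Proof.
apply: le_trans (ip_sqrt _ _) _; rewrite -/(nv u) [_ * nv u]mulrC -mulrA.
rewrite ler_wpM2l ?nv_ge0 // -sqrtrM ?frob2_ge0 // ler_wsqrtr //.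
rewrite /frob2 mulr_suml {1}/ip; apply: ler_sum => i _.
have := CS (row i A)^T v; rewrite /ip.
rewrite (_ : \sum_j (row i A)^T j 0 * v j 0 = (A *m v) i 0); last first.
  by rewrite mxE; apply: eq_bigr => j _; rewrite !mxE.
rewrite -expr2 => /le_trans; apply; rewrite le_eqVlt; apply/orP; left; apply/eqP.
by congr (_ * _); apply: eq_bigr => j _; rewrite !mxE expr2.
Qed.

(** Discrete Parseval: the frequencies 1, ..., n form a complete residue system modulo n, so the
    off-diagonal products cancel over the block. *)
Lemma parseval_block n (w : 'cV[R]_n) : (0 < n)%N ->
  \sum_(m < n) ((\sum_(k < n) w k 0 * sin (m.+1%:R * pi * xtrain R k)) ^+ 2 +
                (\sum_(k < n) w k 0 * cos (m.+1%:R * pi * xtrain R k)) ^+ 2)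
  = n%:R * ip w w.
Proof.
move=> n0; have n0R : n%:R != 0 :> R by rewrite pnatr_eq0 -lt0n.
have E (m : 'I_n) : (\sum_(k < n) w k 0 * sin (m.+1%:R * pi * xtrain R k)) ^+ 2 +
                (\sum_(k < n) w k 0 * cos (m.+1%:R * pi * xtrain R k)) ^+ 2 =
   \sum_(k < n) \sum_(l < n) w k 0 * w l 0 *
     cos (2 * pi * ((k : int) - (l : int))%:~R * tgrid R n m + 0).
  rewrite !expr2 !mulr_suml -big_split; apply: eq_bigr => k _ /=.
  rewrite !mulr_sumr -big_split; apply: eq_bigr => l _ /=.
  have -> : 2 * pi * ((k : int) - (l : int))%:~R * tgrid R n m + 0 =
    m.+1%:R * pi * xtrain R k - m.+1%:R * pi * xtrain R l.
    rewrite rmorphB /= -[(k : int)%:~R]/(k%:R) -[(l : int)%:~R]/(l%:R) /xtrain /tgrid.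
    by rewrite -[k.+1%:R]natr1 -[l.+1%:R]natr1; field.
  by rewrite cosB; ring.
rewrite (eq_bigr _ (fun m _ => E m)) exchange_big mulr_sumr; apply: eq_bigr => k _ /=.
rewrite exchange_big (bigD1 k) //= [X in _ + X]big1 ?addr0.
  rewrite -mulr_sumr sum_cos_grid // subrr dvdz0 cos0; ring.
move=> l lk; rewrite -mulr_sumr sum_cos_grid // ifF ?mulr0 //.
apply/negP => /dvdzP [q hq]; move/negP: lk; apply; apply/eqP/val_inj => /=.
have := ltn_ord k; have := ltn_ord l; move: hq.
by case: q => [[|q]|q] h1 h2 h3; nia.
Qed.

Lemma PhiT_mulE n B (w : 'cV[R]_n) (j : 'I_B) :
  ((PhiMat R n B)^T *m w) j 0 = \sum_(k < n) w k 0 * fourier j (xtrain R k).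
Proof. by rewrite mxE; apply: eq_bigr => k _; rewrite !mxE mulrC. Qed.

Definition tail2 B (v : 'cV[R]_B) : R := \sum_(j < B | (j != 0 :> nat)%N) v j 0 ^+ 2.

Lemma le_sum_widen (P : pred nat) m B (F : nat -> R) : (m <= B)%N -> (forall j, 0 <= F j) ->
  \sum_(j < m | P j) F j <= \sum_(j < B | P j) F j.
Proof.
move=> mB F0; rewrite (big_ord_widen_cond _ P F mB) big_mkcondr /=.
by apply: ler_sum => j _; case: ifP.
Qed.

Lemma tail_ge_parseval n B (w : 'cV[R]_n) : (0 < n)%N -> (n.*2.+1 <= B)%N ->
  n%:R * ip w w <= tail2 ((PhiMat R n B)^T *m w).
Proof.
move=> n0 nB; pose F j := (\sum_(k < n) w k 0 * fourier j (xtrain R k)) ^+ 2.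
rewrite /tail2 (eq_bigr (fun j : 'I_B => F j)); last by move=> j _; rewrite PhiT_mulE.
apply: le_trans (@le_sum_widen (fun j => j != 0%N) _ _ F nB _); last by move=> j; rewrite sqr_ge0.
rewrite big_mkcond (feat_split n (fun j => if j != 0%N then F j else 0)) /= add0r.
rewrite -parseval_block // le_eqVlt; apply/orP; left; apply/eqP; apply: eq_bigr => m _.
by congr (_ ^+ 2 + _ ^+ 2); apply: eq_bigr => k _; rewrite ?fourier_sin ?fourier_cos.
Qed.

(** On the training points cos (n pi x) is the constant (-1)^n: the constant feature reappears among
    the others as feature 2 n, written [n.-1.*2.+2]. *)
Lemma tail_ge_sum n B (w : 'cV[R]_n) : (0 < n)%N -> (n.*2.+1 <= B)%N ->
  (\sum_k w k 0) ^+ 2 <= tail2 ((PhiMat R n B)^T *m w).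
Proof.
move=> n0 nB.
have nB' : (n.-1.*2.+2 < B)%N by apply: leq_trans nB; rewrite -doubleS prednK.
rewrite /tail2 (bigD1 (Ordinal nB')) //= PhiT_mulE /= ler_wpDr ?sumr_ge0 //.
  by move=> j _; rewrite sqr_ge0.
under [in leRHS]eq_bigr => k _.
  rewrite fourier_cos prednK // -mulrA pi_xtrain // mulrBr.
  have -> : n%:R * (2 * pi * tgrid R n k) - n%:R * pi = - (n%:R * pi) + 2 * pi * k.+1%:R :> R.
    by rewrite /tgrid; field; rewrite pnatr_eq0 -lt0n.
  rewrite cosDn cosN.
  over.
by rewrite -mulr_suml exprMn [n%:R * _]mulrC cos_pin_sqr mulr1.
Qed.

(** The constant feature carries (sum w)^2 / 2, which its alias of frequency n controls. Coercivity
    on the span of the training features thus rests on the common eigenvalue [wb], however small the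
    first eigenvalue is. *)
Lemma head_tail n B (w : 'cV[R]_n) : (0 < n)%N -> (n.*2.+1 <= B)%N ->
  ip ((PhiMat R n B)^T *m w) ((PhiMat R n B)^T *m w) <=
  3 / 2 * tail2 ((PhiMat R n B)^T *m w).
Proof.
move=> n0 nB; set psi := _ *m w; have B0 : (0 < B)%N by apply: leq_trans nB.
have := tail_ge_sum w n0 nB; rewrite -/psi => h.
rewrite {1}/ip (bigD1 (Ordinal B0)) //=.
rewrite (eq_bigr (fun j : 'I_B => psi j 0 ^+ 2)); last by move=> j _; rewrite expr2.
rewrite (_ : \sum_(i < B | i != Ordinal B0) _ = tail2 psi); last by apply: eq_bigl.
rewrite PhiT_mulE; under eq_bigr do rewrite fourier0.
rewrite -mulr_suml mulrACA (fourier0_sqr 0 : (Num.sqrt 2)^-1 * (Num.sqrt 2)^-1 = _) -expr2.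
by lra.
Qed.

Definition lamD B g : 'M[R]_B := diag_mx (\row_j lam B g j).

Lemma ip_lamD B g (u v : 'cV[R]_B) : ip u (lamD B g *m v) =
  \sum_(j < B) lam B g j * (u j 0 * v j 0).
Proof. by apply: eq_bigr => j _; rewrite /lamD mul_diag_mx !mxE; ring. Qed.

Definition phi B x : 'cV[R]_B := \col_j fourier j x.

Lemma phi_nv B x : nv (phi B x) <= Num.sqrt B%:R.
Proof.
rewrite ler_wsqrtr // /ip; apply: le_trans (_ : \sum_(j < B) 1 <= _); last first.
  by rewrite sumr_const card_ord.
by apply: ler_sum => j _; rewrite mxE -expr2 -real_normK ?num_real // expr_le1 // fourier_norm.
Qed.

Lemma PsiMatE n d B (Z : 'M[R]_(d, B)) : PsiMat n Z = PhiMat R n B *m Z^T.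
Proof. by apply/matrixP => k i; rewrite !mxE; apply: eq_bigr => j _; rewrite !mxE mulrC. Qed.

Lemma ghatE n d B (Z : 'M[R]_(d, B)) x : ghat n Z x = ip (beta_hat n Z) (Z *m phi B x).
Proof.
apply: eq_bigr => i _; rewrite mxE; congr (_ * _).
by apply: eq_bigr => j _; rewrite mxE.
Qed.

Lemma kern_phi B g x y : kern B g x y = ip (phi B x) (lamD B g *m phi B y).
Proof. by rewrite ip_lamD; apply: eq_bigr => j _; rewrite !mxE. Qed.

Lemma sum_kern_phi n B g (w : 'cV[R]_n) y :
  \sum_k w k 0 * kern B g (xtrain R k) y = ip ((PhiMat R n B)^T *m w) (lamD B g *m phi B y).
Proof.
rewrite ip_mulmx trmxK; apply: eq_bigr => k _; congr (_ * _).
by rewrite kern_phi mxE; apply: eq_bigr => j _; rewrite !mxE.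
Qed.

Lemma tail_lamD B g (v : 'cV[R]_B) : 0 <= g -> wb B g * tail2 v <= ip v (lamD B g *m v).
Proof.
move=> g0; rewrite ip_lamD /tail2 mulr_sumr [leRHS](bigID (fun j : 'I_B => (j != 0 :> nat)%N)) /=.
rewrite -[leLHS]addr0 lerD //.
  apply: ler_sum => j j0; rewrite /lam (negPf j0) expr2 //.
apply: sumr_ge0 => j /negPn j0; rewrite /lam j0 -expr2 mulr_ge0 ?sqr_ge0 //.
by rewrite mulr_ge0.
Qed.

Definition devmx d B (s : R) g (Z : 'M[R]_(d, B)) : 'M[R]_B := s *: (Z^T *m Z) - lamD B g.

(* The choice of the scale s is immaterial for ghat; the bound holds for every s. *)
Lemma ghat_fhat_close n d B g (Z : 'M[R]_(d, B)) (s rho La : R) x :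
  (0 < n)%N -> (n.*2.+1 <= B)%N -> 0 <= g -> (forall j : 'I_B, 0 < lam B g j) ->
  2^-1 <= wb B g -> (forall j : 'I_B, lam B g j <= La) -> 0 < s ->
  0 <= rho -> rho <= 8^-1 -> Num.sqrt (frob2 (devmx s g Z)) <= rho ->
  `|ghat n Z x - fhat n B g x| * Num.sqrt (wa B g + wb B g * (Mof n B)%:R) <=
    rho * Num.sqrt (3 * B%:R) * (5 * La + 2).
Proof.
move=> n0 nB g0 l0 b2 lLa s0 r0 r8 hG.
set Gam := devmx s g Z in hG; set D := lamD B g.
have B0 : (0 < B)%N by apply: leq_trans nB.
have La0 : 0 <= La by apply: le_trans (lLa (Ordinal B0)); rewrite ltW.
have SE : s *: (Z^T *m Z) = D + Gam by rewrite /Gam /devmx addrC subrK.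
have bG (u v : 'cV[R]_B) : `|ip u (Gam *m v)| <= rho * nv u * nv v.
  apply: le_trans (ip_mulmx_frob _ _ _) _; rewrite -!mulrA ler_wpM2r //.
  by rewrite mulr_ge0 ?nv_ge0.
have bD (u v : 'cV[R]_B) : `|ip u (D *m v)| <= La * nv u * nv v.
  apply: le_trans (ip_sqrt _ _) _; rewrite -/(nv u) [_ * nv u]mulrC -mulrA ler_wpM2l ?nv_ge0 //.
  rewrite -[X in X * _]ger0_norm // -sqrtr_sqr -sqrtrM ?sqr_ge0 // ler_wsqrtr //.
  rewrite /ip mulr_sumr; apply: ler_sum => j _; rewrite /D /lamD mul_diag_mx !mxE mulrACA.
  rewrite -[v j 0 * _]expr2 ler_wpM2r ?sqr_ge0 // -expr2 lerXn2r ?nnegrE //.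
  by rewrite ltW.
pose Ph := PhiMat R n B; pose ps (w : 'cV[R]_n) := Ph^T *m w.
have ips (w : 'cV[R]_n) u : ip (ps w) u = ip w (Ph *m u) by rewrite ip_mulmx trmxK.
(* The unperturbed form gives 1/2 * 2/3 = 1/3 and the perturbation takes away at most 1/8; 1/3 - 1/8
   >= 1/5. *)
have low w : 5^-1 * ip (ps w) (ps w) <= ip (ps w) ((D + Gam) *m ps w).
  rewrite mulmxDl ipDr; have h1 := tail_lamD (ps w) g0; have h2 := head_tail w n0 nB.
  have := bG (ps w) (ps w); rewrite -mulrA -expr2 nv_sqr ler_norml => /andP[h3 _].
  rewrite -/(ps w) in h2; rewrite -/D in h1.
  have p0 := ip_ge0 (ps w).
  have h4 : 2^-1 * (2 / 3 * ip (ps w) (ps w)) <= wb B g * tail2 (ps w).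
    have t0 : 2 / 3 * ip (ps w) (ps w) <= tail2 (ps w) by lra.
    apply: le_trans (_ : 2^-1 * tail2 (ps w) <= _); first by rewrite ler_pM2l ?invr_gt0.
    by rewrite ler_wpM2r //; lra.
  have h5 : rho * ip (ps w) (ps w) <= 8^-1 * ip (ps w) (ps w) by rewrite ler_wpM2r.
  lra.
pose Ps := PsiMat n Z.
have PsE : Ps *m Ps^T = Ph *m (Z^T *m Z) *m Ph^T.
  by rewrite /Ps PsiMatE trmx_mul trmxK !mulmxA.
have gram w : Ph *m ((D + Gam) *m ps w) = s *: (Ps *m Ps^T *m w).
  by rewrite -SE PsE -scalemxAl -scalemxAr !mulmxA.
have Gunit : Ps *m Ps^T \in unitmx.
  apply: unitmx_inj => w hw; have := low w.
  rewrite [leRHS]ips gram hw scaler0 ip0r.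
  have := tail_ge_parseval w n0 nB => h1 h2.
  have h3 : tail2 (ps w) <= ip (ps w) (ps w).
    rewrite /tail2 /ip big_mkcond; apply: ler_sum => j _.
    by case: ifP => _; rewrite -?expr2 ?sqr_ge0.
  apply: ip_eq0; apply/eqP; rewrite eq_le ip_ge0 andbT.
  by rewrite -(@pmulr_rle0 _ n%:R) ?ltr0n //; rewrite -/(ps w) in h1; lra.
pose w1 : 'cV[R]_n := invmx (Ps *m Ps^T) *m const_mx 1.
have hw1 : Ps *m Ps^T *m w1 = const_mx 1 by rewrite mulKVmx.
pose w2 := s^-1 *: w1.
set ka := wa B g + _.
have b0 : 0 < wb B g by lra.
have ka0 : 0 < ka.
  rewrite ltr_wpDl // ?mulr_ge0 ?invr_ge0 // mulr_gt0 // ltr0n divn_gt0 //.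
  by rewrite -[n]doubleK half_leq // -ltnS prednK.
pose w0 : 'cV[R]_n := const_mx (n%:R * ka)^-1.
have n0R : n%:R != 0 :> R by rewrite pnatr_eq0 -lt0n.
have hw0 (i : 'I_n) : \sum_k w0 k 0 * kern B g (xtrain R k) (xtrain R i) = 1.
  under eq_bigr do rewrite mxE.
  rewrite -mulr_sumr sum_kern_train // ybar_train // dirich_int -/ka.
  by rewrite mulVf // mulf_neq0 // gt_eqF.
have fE : fhat n B g x = ip (ps w0) (D *m phi B x).
  by rewrite (fhat_kern l0 hw0) sum_kern_phi.
have gE : ghat n Z x = ip (ps w2) ((D + Gam) *m phi B x).
  rewrite ghatE /beta_hat (min_enormE hw1) -SE -scalemxAl ipZr.
  rewrite /w2 /ps -scalemxAr ipZl mulrA mulfV ?gt_eqF // mul1r.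
  by rewrite /Ps PsiMatE trmx_mul trmxK -!mulmxA ip_mulmx.
have Pw0 : Ph *m (D *m ps w0) = const_mx 1.
  apply/colP => i; rewrite [RHS]mxE -(hw0 i) sum_kern_phi ipC ip_mulmx /lamD tr_diag_mx.
  rewrite -/D mxE; apply: eq_bigr => j _; rewrite mxE; congr (_ * _); by rewrite mxE.
have Pw2 : Ph *m ((D + Gam) *m ps w2) = const_mx 1.
  by rewrite gram /w2 -scalemxAr scalerA mulfV ?gt_eqF // scale1r.
(* Both weight vectors reproduce the labels, one for D + Gam and one for D. Subtracting the
   equations and testing with [ps v] leaves only the perturbation acting on [ps w0]. *)
pose v := w2 - w0.
have psv : ps v = ps w2 - ps w0 by rewrite /ps mulmxBr.
have hv : ip (ps v) ((D + Gam) *m ps v) = - ip (ps v) (Gam *m ps w0).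
  rewrite !ips -ipNr; congr (ip _ _).
  rewrite psv mulmxBr mulmxBr Pw2 mulmxDl mulmxDr Pw0.
  by rewrite opprD addNKr.
have nvv : nv (ps v) <= 5 * rho * nv (ps w0).
  have := low v; rewrite hv -nv_sqr => h1.
  have := bG (ps v) (ps w0); rewrite ler_norml => /andP[h2 _].
  have [h3|h3] := ltrP 0 (nv (ps v)); last first.
    by apply: le_trans h3 _; rewrite !mulr_ge0 ?nv_ge0.
  rewrite -(ler_pM2l h3); lra.
(* The D-energy of the constant weights is exactly 1 / ka; coercivity turns this into |ps w0|^2 <= 3
   / ka. *)
have nw0 : nv (ps w0) * Num.sqrt ka <= Num.sqrt 3.
  rewrite -sqrtrM ?ip_ge0 // ler_wsqrtr //.
  have h1 := tail_lamD (ps w0) g0; have h2 := head_tail w0 n0 nB.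
  rewrite -/(ps w0) in h2; rewrite -/D in h1.
  have e1 : ip (ps w0) (D *m ps w0) = ka^-1.
    rewrite ips Pw0 /ip.
    rewrite (eq_bigr (fun=> (n%:R * ka)^-1)); last by move=> k _; rewrite !mxE mulr1.
    by rewrite sumr_const card_ord -[LHS]mulr_natl invfM mulrA mulfV // mul1r.
  have t0 : 0 <= tail2 (ps w0) by apply: sumr_ge0 => j _; rewrite sqr_ge0.
  have h3 : 2^-1 * tail2 (ps w0) <= ka^-1.
    by rewrite -e1; apply: le_trans h1; rewrite ler_wpM2r.
  rewrite -ler_pdivlMr //; lra.
have -> : ghat n Z x - fhat n B g x =
   ip (ps v) (D *m phi B x) + ip (ps v) (Gam *m phi B x) + ip (ps w0) (Gam *m phi B x).
  by rewrite gE fE mulmxDl ipDr psv !ipBl; ring.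
have pn := phi_nv B x; have pv0 := nv_ge0 (ps v); have p0 := nv_ge0 (ps w0).
set sB : R := Num.sqrt B%:R in pn *.
have sB0 : 0 <= sB by apply: sqrtr_ge0.
have k1 : `|ip (ps v) (D *m phi B x)| <= La * (5 * rho * nv (ps w0)) * sB.
  by apply: le_trans (bD _ _) _; rewrite ler_pM ?mulr_ge0 ?nv_ge0 // ler_wpM2l.
have k2 : `|ip (ps v) (Gam *m phi B x)| <= rho * (5 * rho * nv (ps w0)) * sB.
  by apply: le_trans (bG _ _) _; rewrite ler_pM ?mulr_ge0 ?nv_ge0 // ler_wpM2l.
have k3 : `|ip (ps w0) (Gam *m phi B x)| <= rho * nv (ps w0) * sB.
  by apply: le_trans (bG _ _) _; rewrite ler_wpM2l // mulr_ge0.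
apply: le_trans (_ : rho * (nv (ps w0) * Num.sqrt ka) * sB * (5 * La + 2) <= _); last first.
  rewrite sqrtrM // -/sB ler_wpM2r ?addr_ge0 ?mulr_ge0 //.
  by rewrite -mulrA ler_wpM2l // ler_wpM2r.
set X := nv (ps w0) in k1 k2 k3 p0 *.
have -> : rho * (X * Num.sqrt ka) * sB * (5 * La + 2) = (rho * X * sB * (5 * La + 2)) * Num.sqrt ka by ring.
rewrite ler_wpM2r ?sqrtr_ge0 //.
apply: le_trans (ler_normD _ _) _; apply: le_trans (lerD (ler_normD _ _) (lexx _)) _.
have y0 : 0 <= rho * X * sB by rewrite !mulr_ge0.
have h8 : rho * (rho * X * sB) <= 8^-1 * (rho * X * sB) by rewrite ler_wpM2r.
have e1 : La * (5 * rho * X) * sB = La * 5 * (rho * X * sB) by ring.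
have e2 : rho * (5 * rho * X) * sB = 5 * (rho * (rho * X * sB)) by ring.
rewrite e1 in k1; rewrite e2 in k2.
set Y := rho * X * sB in y0 h8 k1 k2 k3 *.
have e3 : Y * (5 * La + 2) = La * 5 * Y + 2 * Y by ring.
rewrite e3; lra.
Qed.

End Perturb.

(** * Quantitative sine estimates and measure bounds cell by cell *)

Section Covers.
Variable R : realType.
Local Notation mu := (@lebesgue_measure R).

Lemma cos_ge_half (x : R) : `|x| <= pi / 4 -> 2^-1 <= cos x.
Proof.
rewrite ler_norml => /andP[y0 y1]; have p0 := @pi_gt0 R.
have h1 : 0 <= cos x by apply: cos_ge0_pihalf; apply/andP; split; lra.
have h2 : 0 <= cos (x *+ 2) by apply: cos_ge0_pihalf; apply/andP; split; rewrite [x *+ 2]mulr2n; lra.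
rewrite cos_mulr2n in h2; rewrite leNgt; apply/negP => h3.
have : cos x ^+ 2 < 2^-1 ^+ 2 by rewrite ltrXn2r ?nnegrE // invr_ge0.
by rewrite mulr2n in h2 => h4; lra.
Qed.

Lemma sin_ge_quarter (x : R) : 0 <= x <= pi / 2 -> x / 4 <= sin x.
Proof.
move=> /andP[x0 x1]; have p0 := @pi_gt0 R.
have mvt : x / 4 <= sin (x / 2).
  have [->|xn0] := eqVneq x 0; first by rewrite !mul0r sin0.
  have xp : 0 < x / 2 by rewrite divr_gt0 // lt_def xn0.
  have [z zI] : exists2 z, z \in `]0, (x / 2)[%R & sin (x / 2) - sin 0 = cos z * (x / 2 - 0).
    apply: MVT => //; last by apply: continuous_subspaceT => z; exact: continuous_sin.
  rewrite sin0 !subr0 => ->; have := @cos_ge_half z.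
  rewrite in_itv /= in zI; case/andP: zI => z1 z2 h.
  have {}h : 2^-1 <= cos z by apply: h; rewrite ger0_norm ?ltW //; lra.
  have : 2^-1 * (x / 2) <= cos z * (x / 2) by rewrite ler_pM2r.
  lra.
have h2 : 2^-1 <= cos (x / 2) by apply: cos_ge_half; rewrite ger0_norm; lra.
have -> : sin x = 2 * (cos (x / 2) * sin (x / 2)).
  have {1}-> : x = (x / 2) *+ 2 by rewrite mulr2n; lra.
  by rewrite sin_mulr2n mulr2n; ring.
have : 2^-1 * sin (x / 2) <= cos (x / 2) * sin (x / 2).
  by rewrite ler_wpM2r //; lra.
lra.
Qed.

Lemma sinpi_ge (v : R) : 0 <= v <= 1 -> Num.min v (1 - v) / 2 <= sin (pi * v).
Proof.
move=> /andP[v0 v1]; have p2 := @pi_ge2 R.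
have key (w : R) : 0 <= w <= 2^-1 -> w / 2 <= sin (pi * w).
  move=> /andP[w0 w1]; apply: le_trans (sin_ge_quarter _).
    have : 2 * w <= pi * w by rewrite ler_wpM2r. lra.
  rewrite mulr_ge0 ?pi_ge0 //=.
  have : pi * w <= pi * 2^-1 by rewrite ler_wpM2l ?pi_ge0. lra.
have [h|h] := lerP v 2^-1.
  apply: le_trans (key v _); last by rewrite v0.
  by rewrite ler_pM2r // ge_min lexx.
have <- : sin (pi * (1 - v)) = sin (pi * v).
  by rewrite mulrBr mulr1 sinB sinpi cospi mul0r sub0r mulN1r opprK.
apply: le_trans (key (1 - v) _); last by apply/andP; split; lra.
by rewrite ler_pM2r // ge_min lexx orbT.
Qed.

Lemma sinpi_le_min (v e : R) : 0 <= v <= 1 -> sin (pi * v) <= e ->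
  v <= 2 * e \/ 1 - 2 * e <= v.
Proof.
move=> hv he; have := le_trans (sinpi_ge hv) he; rewrite minElt.
by case: ifP => _ h; [left|right]; lra.
Qed.

(* Sum-to-product: sin a - sin b = 2 cos((a+b)/2) sin((a-b)/2). *)
Lemma sinpi_sub (v s : R) :
  sin (pi * v) - sin (pi * s) = 2 * (cos (pi * ((v + s) / 2)) * sin (pi * ((v - s) / 2))).
Proof.
have -> : pi * v = pi * ((v + s) / 2) + pi * ((v - s) / 2) by field.
have -> : pi * s = pi * ((v + s) / 2) - pi * ((v - s) / 2) by field.
rewrite sinD sinB.
by set a := (X in cos X); set b := (X in sin X * cos _); ring.
Qed.

Lemma trig_gap (e p q : R) : 0 < e -> e <= p <= 1 -> e <= q <= 1 ->
  (e / 4) ^+ 2 <= sin (pi * (p / 2)) * sin (pi * (q / 2)).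
Proof.
move=> e0 /andP[p0 p1] /andP[q0 q1]; have p2 := @pi_ge2 R.
have key (w : R) : e <= w <= 1 -> e / 4 <= sin (pi * (w / 2)).
  move=> /andP[w0 w1]; apply: le_trans (sin_ge_quarter _).
    have : 2 * (w / 2) <= pi * (w / 2) by rewrite ler_wpM2r //; lra. lra.
  rewrite mulr_ge0 ?pi_ge0 //=; last by lra.
  have : pi * (w / 2) <= pi * 2^-1 by rewrite ler_wpM2l ?pi_ge0 //; lra. lra.
by rewrite expr2 ler_pM ?key //; try lra; apply/andP.
Qed.

(** The difference equals 2 sin (pi (v - s) / 2) sin (pi (1 - v - s) / 2). It vanishes only on the
    lines v = s and v + s = 1, and is bounded below where both factors have the same sign and both
    lines are at least [eta] away. *)
Lemma sinpi_gap1 (v s eta : R) : 0 <= v <= 1 -> 0 <= s <= 1 -> 0 < eta ->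
  (s + eta <= v /\ v + s <= 1 - eta) \/ (v <= s - eta /\ 1 + eta <= v + s) ->
  2 * (eta / 4) ^+ 2 <= sin (pi * v) - sin (pi * s).
Proof.
move=> /andP[v0 v1] /andP[s0 s1] e0 h; rewrite sinpi_sub ler_pM2l //.
have cE (w : R) : cos (pi * (w / 2)) = sin (pi * ((1 - w) / 2)).
  by rewrite -[in RHS]cosBpihalf -cosN; congr cos; field.
rewrite cE; case: h => -[h1 h2].
  by apply: trig_gap => //; apply/andP; split; lra.
rewrite -[leRHS]mulrNN -!sinN.
have -> : - (pi * ((1 - (v + s)) / 2)) = pi * ((v + s - 1) / 2) by field.
have -> : - (pi * ((v - s) / 2)) = pi * ((s - v) / 2) by field.
by apply: trig_gap => //; apply/andP; split; lra.
Qed.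

Lemma sinpi_gap2 (v s eta : R) : 0 <= v <= 1 -> 0 <= s <= 1 -> 0 < eta ->
  (v <= s - eta /\ v + s <= 1 - eta) \/ (s + eta <= v /\ 1 + eta <= v + s) ->
  2 * (eta / 4) ^+ 2 <= sin (pi * s) - sin (pi * v).
Proof.
move=> hv hs e0 h; apply: sinpi_gap1 => //.
by case: h => -[h1 h2]; [left|right]; split; lra.
Qed.

(** [l c] bounds the share of cell c, in its local coordinate v, that the set occupies. Two
    intervals per cell are allowed because the sublevel sets of sin (pi v) on [0, 1] consist of two
    end pieces. *)
Lemma measure_cells (S : set R) N (l : nat -> R) : (0 < N)%N -> measurable S ->
  (forall x, S x -> -1 <= x <= 1) ->
  (forall c, (c < N)%N -> exists a b a' b' : R, [/\ a <= b, a' <= b',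
     (b - a) + (b' - a') <= l c & forall v, 0 <= v <= 1 -> S (-1 + 2 * (c%:R + v) / N%:R) ->
       a <= v <= b \/ a' <= v <= b']) ->
  fine (mu S) <= 2 / N%:R * \sum_(c < N) l c.
Proof.
move=> N0 mS S1 cov; have N0R : 0 < N%:R :> R by rewrite ltr0n.
have N0' := lt0r_neq0 N0R.
pose cell c : set R := `[-1 + 2 * c%:R / N%:R, -1 + 2 * (c%:R + 1) / N%:R]%classic.
have mcell c : measurable (S `&` cell c) by apply: measurableI => //; exact: measurable_itv.
have cellP c x : cell c x -> exists2 v, 0 <= v <= 1 & x = -1 + 2 * (c%:R + v) / N%:R.
  rewrite /cell /= in_itv /= => /andP[x1 x2].
  exists (N%:R * (x + 1) / 2 - c%:R); last by field.
  have h1 : 2 * c%:R / N%:R <= x + 1 by lra.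
  have h2 : x + 1 <= 2 * (c%:R + 1) / N%:R by lra.
  rewrite ler_pdivrMr // in h1; rewrite ler_pdivlMr // in h2.
  by apply/andP; split; lra.
have bnd c : (c < N)%N -> (mu (S `&` cell c) <= (2 / N%:R * l c)%:E)%E.
  move=> cN; have [a [b [a' [b' [ab ab' hl hc]]]]] := cov c cN.
  pose I (a b : R) : set R := `[-1 + 2 * (c%:R + a) / N%:R, -1 + 2 * (c%:R + b) / N%:R]%classic.
  have mI (u w : R) : u <= w -> mu (I u w) = (2 / N%:R * (w - u))%:E.
    move=> uw; rewrite /I lebesgue_measure_itv /= lte_fin.
    case: ifPn => [_|]; first by rewrite -EFinD; congr EFin; field.
    rewrite -leNgt => h; have : 2 * (c%:R + w) / N%:R <= 2 * (c%:R + u) / N%:R by lra.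
    rewrite ler_pM2r ?invr_gt0 // => h'.
    have -> : w = u by apply/eqP; rewrite eq_le uw andbT; lra.
    by rewrite subrr mulr0.
  apply: (@le_trans _ _ (mu (I a b `|` I a' b'))).
    apply: le_measure; rewrite ?inE; first exact: mcell.
      by apply: measurableU; exact: measurable_itv.
    move=> x [Sx /cellP [v v01 xE]]; subst x; have := hc v v01 Sx.
    have mono (p q : R) : p <= q -> -1 + 2 * (c%:R + p) / N%:R <= -1 + 2 * (c%:R + q) / N%:R.
      by move=> pq; rewrite lerD2l ler_pM2r ?invr_gt0 // ler_pM2l // lerD2l.
    by case=> /andP[h1 h2]; [left|right]; rewrite /I /= in_itv /= !mono.
  apply: (@le_trans _ _ (mu (I a b) + mu (I a' b'))%E).
    by apply: measureU2; exact: measurable_itv.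
  rewrite !mI // -EFinD lee_fin -mulrDr ler_pM2l // divr_gt0 //.
have subS : S `<=` \big[setU/set0]_(c < N) (S `&` cell c).
  move=> x Sx; have /andP[x1 x2] := S1 x Sx.
  pose t := N%:R * (x + 1) / 2.
  have t0 : 0 <= t by rewrite divr_ge0 // mulr_ge0 ?ler0n //; lra.
  have xt : x = -1 + 2 * t / N%:R by rewrite /t; field.
  have tN : t <= N%:R.
    have : N%:R * (x + 1) <= N%:R * 2 by rewrite ler_pM2l //; lra.
    rewrite /t; lra.
  (* The minimum puts the right endpoint x = 1 into the last cell. *)
  pose c := minn (Num.truncn t) N.-1.
  have cN : (c < N)%N by rewrite /c; have := geq_minr (Num.truncn t) N.-1; lia.
  have hc : c%:R <= t <= c%:R + 1.
    have /andP[h1 h2] := truncn_itv t0.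
    have hT : (Num.truncn t)%:R <= t := h1.
    rewrite /c; case: (leqP (Num.truncn t) N.-1) => h.
      by rewrite hT natr1 ltW.
    rewrite natr1 prednK // tN andbT; apply: le_trans hT.
    by rewrite ler_nat ltnW.
  rewrite -(bigcup_mkord N (fun c => S `&` cell c)); exists c => //; split=> //.
  case/andP: hc => h1 h2; rewrite /cell /= in_itv /=.
  by rewrite xt !lerD2l !ler_pM2r ?invr_gt0 // !ler_pM2l // h1.
have fin : (mu S <= (2 / N%:R * \sum_(c < N) l c)%:E)%E.
  apply: (@le_trans _ _ (mu (\big[setU/set0]_(c < N) (S `&` cell c)))).
    apply: le_measure; rewrite ?inE; [exact: mS| |exact: subS].
    by apply: bigsetU_measurable => c _; exact: mcell.
  have /le_trans := @Boole_inequality _ _ _ mu (fun c => S `&` cell c) N (fun c _ => mcell c).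
  apply.
  rewrite mulr_sumr -sumEFin; apply: lee_sum => c _; exact: bnd.
rewrite -lee_fin fineK //; apply/fin_numPlt.
by rewrite (lt_le_trans _ (measure_ge0 _ _)) ?ltNy0 //= (le_lt_trans fin) // ltry.
Qed.

Lemma sum_mod n Q (F : nat -> R) : (0 < Q)%N ->
  \sum_(c < n * Q) F (c %% Q)%N = n%:R * \sum_(r < Q) F r.
Proof.
move=> Q0; elim: n => [|n IH]; first by rewrite mul0n big_ord0 mul0r.
rewrite mulSn big_split_ord /= -natr1 mulrDl mul1r addrC; congr (_ + _).
  by rewrite -IH; apply: eq_bigr => c _ /=; rewrite modnDl.
by apply: eq_bigr => c _; rewrite modn_small.
Qed.

Lemma sum_parity M (a : R) (G : nat -> R) :
  \sum_(r < M.*2.+1) (if odd r then a else G r) = M%:R * a + \sum_(k < M.+1) G k.*2.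
Proof.
elim: M => [|M IH]; first by rewrite big_ord1 mul0r add0r big_ord1.
rewrite doubleS 2!big_ord_recr IH [\sum_(k < M.+2) _]big_ord_recr /= odd_double /= doubleS -natr1.
by ring.
Qed.

(** The sum for M + 2 is the sum for M with each of its M + 1 terms raised by 2, plus the end terms
    0 and 1; hence the induction on two consecutive values. *)
Lemma sum_min M : \sum_(k < M.+1) Num.min (k.*2%:R) (M.*2.+1%:R - k.*2%:R) = (M * M.+1)%:R / 2 :> R.
Proof.
suff [] : \sum_(k < M.+1) Num.min (k.*2%:R) (M.*2.+1%:R - k.*2%:R) = (M * M.+1)%:R / 2 :> R /\
  \sum_(k < M.+2) Num.min (k.*2%:R) (M.+1.*2.+1%:R - k.*2%:R) = (M.+1 * M.+2)%:R / 2 :> R by [].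
elim: M => [|M [IH1 IH2]].
  split; rewrite ?big_ord_recr ?big_ord0 /= ?big_ord0 ?add0r ?mul0r; last rewrite mul1n.
    by apply/min_idPl; rewrite subr0.
  rewrite -[1.*2]/2%N -[1.*2.+1]/3%N -[0.*2]/0%N subr0 (min_idPl _) // add0r.
  by rewrite (min_idPr _); lra.
split=> //; rewrite big_ord_recl big_ord_recr /=.
have -> : Num.min 0.*2%:R (M.+2.*2.+1%:R - 0.*2%:R) = 0 :> R by apply/min_idPl; rewrite subr0.
have E1 : M.+2.*2.+1%:R = M.*2.+1%:R + 4 :> R by rewrite -natrD; congr _%:R; lia.
have -> : Num.min (bump 0 M.+1).*2%:R (M.+2.*2.+1%:R - (bump 0 M.+1).*2%:R) = 1 :> R.
  rewrite /bump leq0n add1n.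
  have -> : M.+2.*2.+1%:R = M.+2.*2%:R + 1 :> R by rewrite natr1.
  by rewrite addrC addKr; apply/min_idPr; rewrite ler1n.
rewrite (eq_bigr (fun k : 'I_M.+1 => Num.min (k.*2%:R) (M.*2.+1%:R - k.*2%:R) + 2)); last first.
  move=> k _; rewrite /bump leq0n add1n E1.
  have -> : k.+1.*2%:R = k.*2%:R + 2 :> R by rewrite -natrD; congr _%:R; lia.
  by rewrite addr_minl; congr Num.min; ring.
rewrite big_split /= IH1 sumr_const card_ord add0r -mulr_natr.
by rewrite !natrM -!natr1; field.
Qed.

End Covers.

(** * Measure of the sublevel sets of the Dirichlet ratio at levels -oo, 0 and 1 *)

Section Regimes.
Variable R : realType.
Local Notation mu := (@lebesgue_measure R).

Lemma dirich_sin M (y : R) :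
  sin (pi * y) * (2 * dirich M y + 1) = sin (pi * (M.*2.+1%:R * y)).
Proof.
have := @sum_cos_AP R M (2 * pi * y) (2 * pi * y).
rewrite (_ : \sum_(k < M) _ = dirich M y); last first.
  by apply: eq_bigr => k _; congr cos; rewrite -natr1; ring.
rewrite (_ : 2 * pi * y / 2 = pi * y); last by field.
move=> h; have -> : sin (pi * y) * (2 * dirich M y + 1) = 2 * (sin (pi * y) * dirich M y) + sin (pi * y) by ring.
rewrite h.
set A := M%:R * _ / 2; set C := _ + _ * _ / 2.
have -> : pi * (M.*2.+1%:R * y) = C + A by rewrite -addn1 natrD -muln2 natrM /A /C; field.
rewrite [in sin (pi * y)](_ : pi * y = C - A); last by rewrite /A /C; field.
clearbody A C; rewrite sinB sinD.
ring.
Qed.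

Lemma sinpiDn (x : R) (m : nat) : sin (pi * (x + m%:R)) = (-1) ^+ m * sin (pi * x).
Proof.
elim: m => [|m IH]; first by rewrite addr0 expr0 mul1r.
by rewrite -natr1 addrA mulrDr mulr1 sinDpi IH exprS mulN1r mulNr.
Qed.

Lemma ybar_cell n N (c v : R) : (0 < n)%N -> 0 < N ->
  ybar n (-1 + 2 * (c + v) / (n%:R * N)) = (c + v) / N.
Proof.
by move=> n0 N0; rewrite /ybar; field; rewrite !gt_eqF // ltr0n.
Qed.

(** The [n * Q] cells are half periods of the numerator of the Dirichlet ratio: [v] is the position
    in the half period, [s] the offset of y from the integer below up to the end of the gap, and the
    sign is the parity of the residue of c modulo Q. *)
Lemma dirich_cell n M (c : nat) (v : R) : (0 < n)%N -> (c < n * M.*2.+1)%N ->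
  let Q := M.*2.+1 in let s := ((c %% Q)%:R + v) / Q%:R in
  sin (pi * s) * (2 * dirich M (ybar n (-1 + 2 * (c%:R + v) / (n * Q)%:R)) + 1) =
  (if odd (c %% Q) then - sin (pi * v) else sin (pi * v)).
Proof.
move=> n0 cN Q s.
have Q0 : 0 < Q%:R :> R by rewrite ltr0n.
have Q0' := lt0r_neq0 Q0.
have -> : (n * Q)%:R = n%:R * Q%:R :> R by rewrite natrM.
rewrite ybar_cell //; set y := (c%:R + v) / Q%:R.
have cE : c%:R = (c %/ Q)%:R * Q%:R + (c %% Q)%:R :> R.
  by rewrite -natrM -natrD -divn_eq.
have yE : y = s + (c %/ Q)%:R.
  by rewrite /y /s cE; field.
have h := dirich_sin M y.
rewrite {1}yE sinpiDn -/Q in h.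
have E2 : Q%:R * y = v + c%:R by rewrite /y; field.
rewrite E2 sinpiDn in h.
(* As Q is odd, c has the parity of its quotient plus its residue modulo Q; the sign from the
   quotient cancels against the integer shift in the denominator. *)
have par : (-1) ^+ c = (-1) ^+ (c %/ Q) * (-1) ^+ (c %% Q) :> R.
  rewrite -exprD -signr_odd -[RHS]signr_odd; congr (_ ^+ nat_of_bool _).
  by rewrite {1}(divn_eq c Q) !oddD oddM /Q /= odd_double andbT.
rewrite par -!mulrA in h.
have {}h := mulfI (negbT (signr_eq0 R (c %/ Q))) h.
by rewrite h -signr_odd; case: ifP => _; rewrite ?expr1 ?expr0 ?mul1r ?mulN1r.
Qed.

Section Fixed.
Variables (n M : nat) (S : set R).
Hypotheses (n0 : (0 < n)%N) (mS : measurable S) (S1 : forall x, S x -> -1 <= x <= 1).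
Let Q := M.*2.+1.

Let Q0 : 0 < Q%:R :> R. Proof. by rewrite ltr0n. Qed.

Let QE : Q%:R = 2 * M%:R + 1 :> R.
Proof. by rewrite /Q -addn1 natrD -muln2 natrM mulrC. Qed.

Let DE (x : R) := 2 * dirich M (ybar n x) + 1.

(** The inequalities see a cell only through its residue r modulo Q, so one run of Q cells
    determines the bound and n drops out. *)
Lemma cover_cells (F : nat -> R) :
  (forall r, (r < Q)%N -> exists a b a' b' : R, [/\ a <= b, a' <= b',
     (b - a) + (b' - a') <= F r & forall x v : R, S x -> 0 <= v <= 1 ->
       0 <= (r%:R + v) / Q%:R <= 1 ->
       0 <= sin (pi * ((r%:R + v) / Q%:R)) ->
       0 <= sin (pi * v) ->
       sin (pi * ((r%:R + v) / Q%:R)) * DE x = (if odd r then - sin (pi * v) else sin (pi * v)) ->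
       a <= v <= b \/ a' <= v <= b']) ->
  fine (mu S) <= 2 / Q%:R * \sum_(r < Q) F r.
Proof.
move=> h; have Q0' := lt0r_neq0 Q0.
have n0R : n%:R != 0 :> R by rewrite pnatr_eq0 -lt0n.
have -> : 2 / Q%:R * \sum_(r < Q) F r = 2 / (n * Q)%:R * \sum_(c < n * Q) F (c %% Q)%N.
  by rewrite sum_mod // natrM; field; rewrite ?n0R ?Q0'.
apply: (@measure_cells R S _ (fun c => F (c %% Q)%N)) => //; first by rewrite muln_gt0 n0.
move=> c cN; have rQ : (c %% Q < Q)%N by rewrite ltn_mod.
have [a [b [a' [b' [ab ab' hl hc]]]]] := h _ rQ.
exists a, b, a', b'; split=> // v v01 Sx.
have /andP[v0 v1] := v01.
have s01 : 0 <= ((c %% Q)%:R + v) / Q%:R <= 1.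
  rewrite divr_ge0 ?addr_ge0 ?ler0n //= ler_pdivrMr // mul1r.
  apply: (@le_trans _ _ ((c %% Q)%:R + 1)); first by rewrite lerD2l.
  by rewrite natr1 ler_nat.
have sge (w : R) : 0 <= w <= 1 -> 0 <= sin (pi * w).
  move=> /andP[w0 w1]; apply: sin_ge0_pi; rewrite mulr_ge0 ?pi_ge0 //=.
  by rewrite -[leRHS]mulr1 ler_wpM2l ?pi_ge0.
apply: hc Sx v01 s01 (sge _ s01) (sge _ v01) _; exact: dirich_cell.
Qed.

(** Since sin (pi y) (2 D + 1) is bounded by 1 in absolute value, a ratio <= - t forces |sin (pi y)|
    <= 1 / t, hence y within 2 / t of an integer: two end pieces of total length 4 / t in each of
    the n gaps. *)
Lemma neg_upper (t : R) : 0 < t -> (forall x, S x -> DE x <= - t) -> fine (mu S) <= 2 * (4 / t).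
Proof.
move=> t0 hS.
have n0R : 0 < n%:R :> R by rewrite ltr0n.
have -> : 2 * (4 / t) = 2 / n%:R * \sum_(c < n) (fun=> 4 / t) (c : nat).
  by rewrite sumr_const card_ord -[_ *+ n]mulr_natl; field; rewrite !gt_eqF.
apply: (@measure_cells R S n (fun=> 4 / t)) => // c cN.
exists 0, (2 / t), (1 - 2 / t), 1.
have t2 : 0 <= 2 / t by rewrite divr_ge0 // ltW.
split=> //; [by lra|by lra|].
move=> v /andP[v0 v1] Sx; have := hS _ Sx; rewrite /DE.
rewrite -[n%:R]mulr1 ybar_cell // divr1 => h.
have := dirich_sin M (c%:R + v); rewrite {1}[c%:R + v]addrC sinpiDn.
set D := 2 * _ + 1 in h * => h2.
have h3 : `|sin (pi * v) * D| <= 1.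
  have := sin_max (pi * (M.*2.+1%:R * (c%:R + v))); rewrite -h2 !normrM normr_sign mul1r.
  by rewrite -normrM.
have s0 : 0 <= sin (pi * v).
  apply: sin_ge0_pi; rewrite mulr_ge0 ?pi_ge0 //=.
  by rewrite -[leRHS]mulr1 ler_wpM2l ?pi_ge0.
have h4 : sin (pi * v) <= t^-1.
  move: h3; rewrite ler_norml => /andP[h3 _].
  have : sin (pi * v) * D <= sin (pi * v) * (- t) by rewrite ler_wpM2l.
  by move=> h5; rewrite -[leRHS]mul1r ler_pdivlMr //; lra.
have hv : 0 <= v <= 1 by rewrite v0.
case: (sinpi_le_min hv h4).
  by left; rewrite v0.
by right; apply/andP; split; lra.
Qed.

Let ratio2 : M%:R / Q%:R <= 2^-1 :> R.
Proof. by rewrite ler_pdivrMr // QE; lra. Qed.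

Let ratio1 : M.+1%:R / Q%:R <= 1 :> R.
Proof. by rewrite ler_pdivrMr // mul1r ler_nat /Q -addnn; lia. Qed.

Let ratio3 : M.+1%:R / Q%:R <= 2^-1 + Q%:R^-1 :> R.
Proof. by rewrite ler_pdivrMr // mulrDl mulVf ?gt_eqF // QE -[M.+1%:R]natr1; lra. Qed.

(** Odd cells are counted in full; in an even cell a ratio <= e forces sin (pi v) <= e, which leaves
    end pieces of total length 4 e. *)
Lemma half_upper (e : R) : 0 <= e -> (forall x, S x -> DE x <= e) ->
  fine (mu S) <= 2 * (2^-1 + 4 * e).
Proof.
move=> e0 hS.
apply: le_trans (cover_cells (F := fun r => if odd r then 1 else 4 * e) _) _.
  move=> r rQ; case: ifP => ro.
    by exists 0, 1, 0, 0; split; [lra|lra|lra|move=> x v _ hv *; left].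
  exists 0, (2 * e), (1 - 2 * e), 1; split; [by lra|by lra|by lra|].
  move=> x v Sx /andP[v0 v1] _ s0 _ h.
  have : sin (pi * v) <= e.
    rewrite -h; apply: (@le_trans _ _ (sin (pi * ((r%:R + v) / Q%:R)) * e)).
      by rewrite ler_wpM2l // hS.
    by rewrite -[leRHS]mul1r ler_wpM2r // sin_le1.
  case/sinpi_le_min; [by rewrite v0|left|right]; apply/andP; split; lra.
rewrite (sum_parity M 1 (fun=> 4 * e)) sumr_const card_ord -[_ *+ M.+1]mulr_natl mulr1.
have -> : 2 / Q%:R * (M%:R + M.+1%:R * (4 * e)) = 2 * (M%:R / Q%:R + M.+1%:R / Q%:R * (4 * e)) by ring.
have e4 : 0 <= 4 * e by lra.
by rewrite ler_pM2l // lerD // -[leRHS]mul1r ler_wpM2r.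
Qed.

(** The mirror image, meant for the correctly classified points: now the even cells are full. There
    are M + 1 of them among Q = 2 M + 1, which accounts for the extra 1 / Q. *)
Lemma half_lower (e : R) : 0 <= e -> (forall x, S x -> - e <= DE x) ->
  fine (mu S) <= 2 * (2^-1 + Q%:R^-1 + 4 * e).
Proof.
move=> e0 hS.
apply: le_trans (cover_cells (F := fun r => if odd r then 4 * e else 1) _) _.
  move=> r rQ; case: ifP => ro; last first.
    by exists 0, 1, 0, 0; split; [lra|lra|lra|move=> x v _ hv *; left].
  exists 0, (2 * e), (1 - 2 * e), 1; split; [by lra|by lra|by lra|].
  move=> x v Sx /andP[v0 v1] _ s0 _ h.
  have : sin (pi * v) <= e.
    rewrite -[leLHS]opprK -h lerNl; apply: (@le_trans _ _ (sin (pi * ((r%:R + v) / Q%:R)) * (- e))).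
      by rewrite mulrN lerN2 -[leRHS]mul1r ler_wpM2r // sin_le1.
    by rewrite ler_wpM2l // hS.
  case/sinpi_le_min; [by rewrite v0|left|right]; apply/andP; split; lra.
rewrite (sum_parity M _ (fun=> 1)) sumr_const card_ord -[1 *+ _]mulr_natl mulr1.
have -> : 2 / Q%:R * (M%:R * (4 * e) + M.+1%:R) = 2 * (M.+1%:R / Q%:R + M%:R / Q%:R * (4 * e)) by ring.
have e4 : 0 <= 4 * e by lra.
by rewrite ler_pM2l // lerD // -[leRHS]mul1r ler_wpM2r // (le_trans ratio2) //; lra.
Qed.

Let min_even (k : nat) : Num.min (k.*2%:R / Q%:R) (1 - k.*2%:R / Q%:R) =
  Num.min (k.*2%:R) (M.*2.+1%:R - k.*2%:R) / Q%:R :> R.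
Proof.
rewrite -[RHS]mulrC minr_pMr ?invr_ge0 ?(ltW Q0) //; congr Num.min; first by rewrite mulrC.
by rewrite mulrBr mulVf ?gt_eqF // [_^-1 * _]mulrC.
Qed.

Let sum_min_even : \sum_(k < M.+1) Num.min (k.*2%:R / Q%:R) (1 - k.*2%:R / Q%:R)
  = M%:R * M.+1%:R / 2 / Q%:R :> R.
Proof.
under eq_bigr do rewrite min_even.
by rewrite -mulr_suml sum_min natrM.
Qed.

Let sq_ratio : M%:R * M.+1%:R / Q%:R ^+ 2 = 4^-1 - 4^-1 / Q%:R ^+ 2 :> R.
Proof.
have q0 := lt0r_neq0 Q0; rewrite -[M.+1%:R]natr1; rewrite QE in q0 *.
by field.
Qed.

(** In an even cell the condition reads sin (pi v) <= sin (pi s) up to e, with s within 1 / Q of w =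
    r / Q: up to [m], v lies below min (w, 1 - w) or above its mirror image. The shares 2 min (w, 1
    - w) average about 1/2 over the even cells, so the total is 1/2 + 1/4. The bound on e is the gap
    2 (eta / 4)^2 of [sinpi_gap1]. *)
Lemma zero_upper (eta e : R) : 0 < eta -> e < eta ^+ 2 / 8 -> (forall x, S x -> DE x <= 1 + e) ->
  0 <= e -> fine (mu S) <= 2 * (3 / 4 + 2 * (eta + Q%:R^-1)).
Proof.
move=> eta0 he hS e0.
have Qi : 0 <= Q%:R^-1 :> R by rewrite invr_ge0 ltW.
set m := eta + Q%:R^-1.
apply: le_trans (cover_cells (F := fun r => if odd r then 1 else
   2 * Num.min (r%:R / Q%:R) (1 - r%:R / Q%:R) + 2 * m) _) _.
  move=> r rQ; case: ifP => ro.
    by exists 0, 1, 0, 0; split; [lra|lra|lra|move=> x v _ hv *; left].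
  have r0 : 0 <= r%:R / Q%:R :> R by rewrite divr_ge0 // ler0n.
  have r1 : r%:R / Q%:R <= 1 :> R by rewrite ler_pdivrMr // mul1r ler_nat ltnW.
  set w := r%:R / Q%:R in r0 r1 *.
  have key (x v : R) : S x -> 0 <= v <= 1 -> 0 <= (r%:R + v) / Q%:R <= 1 ->
     0 <= sin (pi * ((r%:R + v) / Q%:R)) ->
     sin (pi * ((r%:R + v) / Q%:R)) * DE x = sin (pi * v) ->
     exists s : R, [/\ w <= s <= w + Q%:R^-1, ~ (s + eta <= v /\ v + s <= 1 - eta) &
        ~ (v <= s - eta /\ 1 + eta <= v + s)].
    move=> Sx v01 s01 s0 h; set s := (r%:R + v) / Q%:R in s01 s0 h.
    have hs : sin (pi * v) <= sin (pi * s) + e.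
      rewrite -h; apply: (@le_trans _ _ (sin (pi * s) * (1 + e))); first by rewrite ler_wpM2l // hS.
      by rewrite mulrDr mulr1 lerD2l -[leRHS]mul1r ler_wpM2r // sin_le1.
    have ng : ~ (2 * (eta / 4) ^+ 2 <= sin (pi * v) - sin (pi * s)).
      by move=> h1; rewrite expr_div_n in h1; lra.
    exists s; split; last 2 first.
    - by move=> h1; apply: ng; apply: sinpi_gap1 => //; left.
    - by move=> h1; apply: ng; apply: sinpi_gap1 => //; right.
    have -> : s = w + v / Q%:R by rewrite /s /w mulrDl.
    case/andP: v01 => v0 v1; rewrite lerDl divr_ge0 ?(ltW Q0) //= lerD2l.
    by rewrite -[leRHS]mul1r ler_wpM2r.
  have [w2|w2] := lerP w 2^-1.
    have -> : Num.min w (1 - w) = w by apply/min_idPl; lra.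
    exists 0, (w + m), (1 - w - m), 1; split; rewrite /m; [by lra|by lra|by lra|].
    move=> x v Sx v01 s01 s0 _ h.
    have [s [/andP[ws1 ws2] n1 n2]] := key x v Sx v01 s01 s0 h.
    case/andP: v01 => v0 v1.
    have [h1|h1] := lerP (s + eta) v.
      by right; apply/andP; split=> //; rewrite leNgt; apply/negP => h2; apply: n1; split; lra.
    by left; apply/andP; split; lra.
  have -> : Num.min w (1 - w) = 1 - w by apply/min_idPr; lra.
  exists 0, (1 - w + m), (w - m), 1; split; rewrite /m; [by lra|by lra|by lra|].
  move=> x v Sx v01 s01 s0 _ h.
  have [s [/andP[ws1 ws2] n1 n2]] := key x v Sx v01 s01 s0 h.
  case/andP: v01 => v0 v1.
  have [h1|h1] := lerP v (s - eta).
    by left; apply/andP; split=> //; rewrite leNgt; apply/negP => h2; apply: n2; split; lra.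
  by right; apply/andP; split; lra.
rewrite (sum_parity M 1 (fun r => 2 * Num.min (r%:R / Q%:R) (1 - r%:R / Q%:R) + 2 * m)).
rewrite big_split /= -mulr_sumr sum_min_even sumr_const card_ord -[_ *+ M.+1]mulr_natl mulr1.
have Q0' := lt0r_neq0 Q0.
rewrite [leLHS](_ : _ = 2 * (M%:R / Q%:R + M%:R * M.+1%:R / Q%:R ^+ 2 + M.+1%:R / Q%:R * (2 * m))); last by field.
rewrite ler_pM2l // sq_ratio.
have q4 : 0 <= 4^-1 / Q%:R ^+ 2 :> R by rewrite mulr_ge0 // invr_ge0 sqr_ge0.
have m0 : 0 <= 2 * m by rewrite mulr_ge0 // addr_ge0 // ltW.
have : M.+1%:R / Q%:R * (2 * m) <= 1 * (2 * m) by rewrite ler_wpM2r.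
by move: ratio2 => /= r2; rewrite /m; lra.
Qed.

(** The complementary estimate, meant for the correctly classified points: a positive ratio leaves
    only the endpoints of odd cells, and even cells contribute 1 - 2 min (w, 1 - w) up to [m]. *)
Lemma zero_lower (eta e : R) : 0 < eta -> e < eta ^+ 2 / 8 -> (forall x, S x -> 1 - e <= DE x) ->
  0 <= e < 1 -> fine (mu S) <= 2 * (4^-1 + Q%:R^-1 + 2 * (eta + Q%:R^-1)).
Proof.
move=> eta0 he hS /andP[e0 e1].
have Qi : 0 <= Q%:R^-1 :> R by rewrite invr_ge0 ltW.
set m := eta + Q%:R^-1.
apply: le_trans (cover_cells (F := fun r => if odd r then 0 else
   (1 - 2 * Num.min (r%:R / Q%:R) (1 - r%:R / Q%:R)) + 2 * m) _) _.
  move=> r rQ; case: ifP => ro.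
    exists 0, 0, 1, 1; split; [by lra|by lra|by lra|].
    move=> x v Sx /andP[v0 v1] _ s0 _ h.
    have : sin (pi * v) <= 0.
      rewrite -oppr_ge0 -h mulr_ge0 //; apply: le_trans (hS x Sx); lra.
    case/sinpi_le_min; [by rewrite v0|left|right]; apply/andP; split; lra.
  have r0 : 0 <= r%:R / Q%:R :> R by rewrite divr_ge0 // ler0n.
  have r1 : r%:R / Q%:R + Q%:R^-1 <= 1 :> R.
    by rewrite -[X in _ + X]mul1r -mulrDl ler_pdivrMr // mul1r natr1 ler_nat.
  set w := r%:R / Q%:R in r0 r1 *.
  have key (x v : R) : S x -> 0 <= v <= 1 -> 0 <= (r%:R + v) / Q%:R <= 1 ->
     0 <= sin (pi * ((r%:R + v) / Q%:R)) ->
     sin (pi * ((r%:R + v) / Q%:R)) * DE x = sin (pi * v) ->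
     exists s : R, [/\ w <= s <= w + Q%:R^-1, ~ (v <= s - eta /\ v + s <= 1 - eta) &
        ~ (s + eta <= v /\ 1 + eta <= v + s)].
    move=> Sx v01 s01 s0 h; set s := (r%:R + v) / Q%:R in s01 s0 h.
    have hs : sin (pi * s) - e <= sin (pi * v).
      rewrite -h; apply: (@le_trans _ _ (sin (pi * s) * (1 - e))); last by rewrite ler_wpM2l // hS.
      by rewrite mulrBr mulr1 lerD2l lerN2 -[leRHS]mul1r ler_wpM2r // sin_le1.
    have ng : ~ (2 * (eta / 4) ^+ 2 <= sin (pi * s) - sin (pi * v)).
      by move=> h1; rewrite expr_div_n in h1; lra.
    exists s; split; last 2 first.
    - by move=> h1; apply: ng; apply: sinpi_gap2 => //; left.
    - by move=> h1; apply: ng; apply: sinpi_gap2 => //; right.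
    have -> : s = w + v / Q%:R by rewrite /s /w mulrDl.
    case/andP: v01 => v0 v1; rewrite lerDl divr_ge0 ?(ltW Q0) //= lerD2l.
    by rewrite -[leRHS]mul1r ler_wpM2r.
  have [w2|w2] := lerP w 2^-1.
    have -> : Num.min w (1 - w) = w by apply/min_idPl; lra.
    exists (w - m), (1 - w + m), 0, 0; split; rewrite /m; [by lra|by lra|by lra|].
    move=> x v Sx v01 s01 s0 _ h; left.
    have [s [/andP[ws1 ws2] n1 n2]] := key x v Sx v01 s01 s0 h.
    case/andP: v01 => v0 v1.
    apply/andP; split; rewrite leNgt; apply/negP => h1; [apply: n1|apply: n2]; split; lra.
  have -> : Num.min w (1 - w) = 1 - w by apply/min_idPr; lra.
  exists (1 - w - m), (w + m), 0, 0; split; rewrite /m; [by lra|by lra|by lra|].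
  move=> x v Sx v01 s01 s0 _ h; left.
  have [s [/andP[ws1 ws2] n1 n2]] := key x v Sx v01 s01 s0 h.
  case/andP: v01 => v0 v1.
  apply/andP; split; rewrite leNgt; apply/negP => h1; [apply: n1|apply: n2]; split; lra.
rewrite (sum_parity M 0 (fun r => (1 - 2 * Num.min (r%:R / Q%:R) (1 - r%:R / Q%:R)) + 2 * m)).
rewrite big_split /= sumrB -mulr_sumr sum_min_even !sumr_const card_ord -[(2 * m) *+ M.+1]mulr_natl mulr0 add0r.
have Q0' := lt0r_neq0 Q0.
rewrite [leLHS](_ : _ = 2 * (M.+1%:R / Q%:R - M%:R * M.+1%:R / Q%:R ^+ 2 + M.+1%:R / Q%:R * (2 * m))); last by field.
rewrite ler_pM2l // sq_ratio.
have q4 : 4^-1 / Q%:R ^+ 2 <= 4^-1 / Q%:R :> R.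
  rewrite ler_pM2l // expr2 invfM -[leRHS]mulr1 ler_wpM2l //.
  by rewrite invf_le1 // ler1n.
have m0 : 0 <= 2 * m by rewrite mulr_ge0 // addr_ge0 // ltW.
have : M.+1%:R / Q%:R * (2 * m) <= 1 * (2 * m) by rewrite ler_wpM2r.
have r3 : M.+1%:R / Q%:R = 2^-1 + 2^-1 / Q%:R :> R.
  have q0 := lt0r_neq0 Q0; rewrite -[M.+1%:R]natr1; rewrite QE in q0 *.
  by field.
by rewrite r3 /m; lra.
Qed.

End Fixed.
End Regimes.

(** * Rotation invariance of the planar Gaussian measure *)

Section Gauss.
Variable R : realType.
Local Notation leb := (@lebesgue_measure R).
Local Notation T := (measurableTypeR R).

Definition push d1 d2 (X : measurableType d1) (Y : measurableType d2)
    (m : {measure set X -> \bar R}) (f : X -> Y) (mf : measurable_fun setT f) :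
    {measure set Y -> \bar R} :=
  measure_function_pushforward__canonical__measure_function_Measure m mf.

Lemma measurable_affine (c t : R) : measurable_fun setT (fun x : T => c * x + t : T).
Proof. by apply: measurable_funD => //; exact: measurable_funM. Qed.

Lemma leb_affine (c t : R) (A : set T) : 0 < c -> measurable A ->
  leb ((fun x : T => c * x + t : T) @^-1` A) = ((c^-1)%:E * leb A)%E.
Proof.
move=> c0 mA; have c1 := lt0r_neq0 c0.
pose cn : {nonneg R} := NngNum (ltW c0).
have mf := measurable_affine c t.
pose m := mscale cn (push leb mf).
have E X : ocitv X -> leb X = m X.
  move=> [[a b] _ <-] /=; rewrite /m /mscale /= /mscale /= /pushforward.
  have -> : (fun x : T => c * x + t) @^-1` `]a, b] = `](a - t) / c, (b - t) / c]%classic.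
    apply/seteqP; split=> x /=; rewrite !in_itv /= ltr_pdivrMr // ler_pdivlMr // [x * c]mulrC;
      by move=> /andP[h1 h2]; apply/andP; split; lra.
  rewrite !lebesgue_measure_itv /= !lte_fin ltr_pM2r ?invr_gt0 // ltrD2r.
  by case: ifP => _; rewrite ?mule0 // -!EFinD -EFinM; congr EFin; field.
rewrite (lebesgue_measure_unique E mA) /m /mscale /= muleA -EFinM mulVf // mul1e.
by [].
Qed.

Local Open Scope ereal_scope.

Definition L2 := leb \x leb.

Definition sh1 (t : R) (z : T * T) : T * T := ((z.1 + t * z.2)%R, z.2).
Definition sh2 (t : R) (z : T * T) : T * T := (z.1, (z.2 + t * z.1)%R).

Lemma measurable_sh1 t : measurable_fun setT (sh1 t).
Proof.
apply/measurable_fun_pairP; split => /=; last exact: measurable_snd.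
by apply: measurable_funD => //; exact: measurable_funM.
Qed.

Lemma measurable_sh2 t : measurable_fun setT (sh2 t).
Proof.
apply/measurable_fun_pairP; split => /=; first exact: measurable_fst.
by apply: measurable_funD => //; exact: measurable_funM.
Qed.

Lemma mpre d1 d2 (X : measurableType d1) (Y : measurableType d2) (f : X -> Y) A :
  measurable_fun setT f -> measurable A -> measurable (f @^-1` A).
Proof. by move=> mf mA; rewrite -[X in measurable X]setTI; exact: mf. Qed.

Lemma L2_sh2 t A : measurable A -> L2 (sh2 t @^-1` A) = L2 A.
Proof.
move=> mA; apply/esym; rewrite -[RHS]/(push L2 (measurable_sh2 t) A) {1}/L2.
apply: product_measure_unique => // {mA}A B mA mB.
rewrite -[LHS]/(L2 (sh2 t @^-1` (A `*` B))) /L2 /product_measure1.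
rewrite (eq_integral (fun x => (\1_A x)%:E * leb B)).
  rewrite ge0_integralZr ?integral_indic ?setIT //=.
  by apply/measurable_EFinP; exact: measurable_indic.
move=> x _ /=; rewrite indicE; case: (boolP (x \in A)) => xA.
  rewrite mul1e.
  have -> : xsection (sh2 t @^-1` (A `*` B)) x = (fun y : T => 1 * y + t * x : T)%R @^-1` B.
    apply/seteqP; split => y; rewrite /xsection /= inE /sh2 /= mul1r; first by case.
    by move=> h; split => //; apply/set_mem.
  by rewrite leb_affine // invr1 mul1e.
rewrite mul0e; have -> : xsection (sh2 t @^-1` (A `*` B)) x = set0; last by rewrite measure0.
by apply/seteqP; split => y //; rewrite /xsection /= inE /sh2 /= => -[/mem_set]; rewrite (negPf xA).
Qed.

Lemma L2_rev A : measurable A -> L2 A = (leb \x^ leb) A.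
Proof.
move=> mA; rewrite /L2; apply: product_measure_unique => // B C mB mC.
by rewrite /= product_measure2E.
Qed.

Lemma L2_sh1 t A : measurable A -> L2 (sh1 t @^-1` A) = L2 A.
Proof.
move=> mA; apply/esym; rewrite -[RHS]/(push L2 (measurable_sh1 t) A) {1}/L2.
apply: product_measure_unique => // {mA}A B mA mB.
rewrite -[LHS]/(L2 (sh1 t @^-1` (A `*` B))) L2_rev; last by apply: mpre (measurable_sh1 t) _; exact: measurableX.
rewrite /product_measure2.
rewrite (eq_integral (fun y => leb A * (\1_B y)%:E)).
  rewrite ge0_integralZl ?integral_indic ?setIT //=.
  by apply/measurable_EFinP; exact: measurable_indic.
move=> y _ /=; rewrite indicE; case: (boolP (y \in B)) => yB.
  rewrite mule1.
  have -> : ysection (sh1 t @^-1` (A `*` B)) y = (fun x : T => 1 * x + t * y : T)%R @^-1` A.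
    apply/seteqP; split => x; rewrite /ysection /= inE /sh1 /= mul1r; first by case.
    by move=> h; split => //; apply/set_mem.
  by rewrite leb_affine // invr1 mul1e.
rewrite mule0; have -> : ysection (sh1 t @^-1` (A `*` B)) y = set0; last by rewrite measure0.
by apply/seteqP; split => x //; rewrite /ysection /= inE /sh1 /= => -[_ /mem_set]; rewrite (negPf yB).
Qed.

Definition rot (c s : R) (z : T * T) : T * T :=
  ((c * z.1 - s * z.2)%R, (s * z.1 + c * z.2)%R).

Lemma measurable_rot c s : measurable_fun setT (rot c s).
Proof.
apply/measurable_fun_pairP; split => /=; first apply: measurable_funB; last apply: measurable_funD;
  exact: measurable_funM.
Qed.

(* A rotation by an angle other than pi is a product of three shears. *)
Lemma rot_shears c s : (c ^+ 2 + s ^+ 2 = 1)%R -> (1 + c != 0)%R ->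
  rot c s = sh1 (- (s / (1 + c))) \o sh2 s \o sh1 (- (s / (1 + c))).
Proof.
move=> cs c1; apply/funext => -[x y]; rewrite /rot /sh1 /sh2 /=.
have e1 : (s * (s / (1 + c)) = 1 - c)%R.
  have : (s ^+ 2 = (1 - c) * (1 + c))%R by rewrite -[(s ^+ 2)%R](addKr (c ^+ 2)%R) cs; ring.
  by rewrite expr2 => h; rewrite mulrA h mulfK.
have e2 : (s / (1 + c) * (1 + c) = s)%R by rewrite divfK.
set u := (s / (1 + c))%R in e1 e2 *.
congr pair.
  have -> : (x + - u * y + - u * (y + s * (x + - u * y)) = x - (s * u) * x - u * y - u * y + (s * u) * (u * y))%R by ring.
  by rewrite e1 -[in LHS]e2; ring.
have -> : (y + s * (x + - u * y) = s * x + y - (s * u) * y)%R by ring.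
by rewrite e1; ring.
Qed.

Lemma L2_rot c s A : (c ^+ 2 + s ^+ 2 = 1)%R -> (1 + c != 0)%R -> measurable A ->
  L2 (rot c s @^-1` A) = L2 A.
Proof.
move=> cs c1 mA; rewrite rot_shears // !comp_preimage.
have m1 := mpre (measurable_sh1 (- (s / (1 + c)))) mA.
have m2 := mpre (measurable_sh2 s) m1.
by rewrite L2_sh1 // L2_sh2 // L2_sh1.
Qed.

Definition N1 : probability T R := normal_prob 0%R 1%R.
Definition g1 (x : R) : R := normal_pdf 0 1 x.
Definition h2 (z : T * T) : \bar R := (g1 z.1 * g1 z.2)%:E.

Lemma g1E x : g1 x = (normal_peak 1 * expR (- x ^+ 2 / 2))%R.
Proof.
by rewrite /g1 /normal_pdf (negPf (oner_neq0 _)) /normal_fun subr0 expr1n.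
Qed.

Lemma g1_ge0 x : (0 <= g1 x)%R. Proof. exact: normal_pdf_ge0. Qed.

Lemma measurable_g1 : measurable_fun setT g1.
Proof. exact: measurable_normal_pdf. Qed.

Lemma h2_rot c s z : (c ^+ 2 + s ^+ 2 = 1)%R -> h2 (rot c s z) = h2 z.
Proof.
move=> cs; rewrite /h2 /rot /= !g1E; congr EFin.
rewrite mulrACA -expRD [RHS]mulrACA -expRD; congr (_ * expR _)%R.
rewrite (_ : - (c * z.1 - s * z.2) ^+ 2 / 2 + - (s * z.1 + c * z.2) ^+ 2 / 2 =
  - (c ^+ 2 + s ^+ 2) * (z.1 ^+ 2 + z.2 ^+ 2) / 2)%R; last by field.
by rewrite cs; field.
Qed.

Lemma measurable_h2 : measurable_fun setT h2.
Proof.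
apply/measurable_EFinP; apply: measurable_funM => /=.
  by apply: measurableT_comp => //; exact: measurable_g1.
by apply: measurableT_comp => //; exact: measurable_g1.
Qed.

Lemma h2_ge0 z : 0 <= h2 z.
Proof. by rewrite lee_fin mulr_ge0 // g1_ge0. Qed.

Definition gam2 (A : set (T * T)) := \int[L2]_(z in A) h2 z.

Let gam20 : gam2 set0 = 0. Proof. exact: integral_set0. Qed.
Let gam2_ge0 A : 0 <= gam2 A. Proof. by apply: integral_ge0 => z _; exact: h2_ge0. Qed.
Let gam2_sa : semi_sigma_additive gam2.
Proof.
by apply: semi_sigma_additive_nng_induced => //; [exact: measurable_h2|exact: h2_ge0].
Qed.
HB.instance Definition _ := isMeasure.Build _ _ _ gam2 gam20 gam2_ge0 gam2_sa.

(** Rotation invariance is visible on the density [h2], independence on the product measure; Tonelli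
    on rectangles identifies the two. *)
Lemma gam2E A : measurable A -> (N1 \x N1) A = gam2 A.
Proof.
apply: product_measure_unique => {}A B mA mB.
rewrite /= /gam2 integral_mkcond /L2 fubini_tonelli1; last 2 first.
- apply: (measurable_restrictT h2 (measurableX mA mB)).1.
  exact: measurable_funTS measurable_h2.
- by move=> z; apply: erestrict_ge0 => ? _; exact: h2_ge0.
rewrite /fubini_F.
rewrite (eq_integral (fun x => (\1_A x * g1 x)%:E * normal_prob 0%R 1%R B)); last first.
  move=> x _; rewrite /normal_prob [in RHS]integral_mkcond -ge0_integralZl //; first last.
  - by rewrite lee_fin mulr_ge0 // ?g1_ge0 // indicE ler0n.
  - by move=> y _; apply: erestrict_ge0 => ? _; rewrite lee_fin normal_pdf_ge0.
  - apply: (measurable_restrictT _ mB).1.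
    by apply/measurable_EFinP; exact: measurable_funTS (measurable_normal_pdf _ _).
  apply: eq_integral => y _; rewrite !patchE /= indicE.
  case: (boolP (x \in A)) => xA; case: (boolP (y \in B)) => yB; rewrite ?mul0r ?mul0e ?mule0.
  - rewrite mem_set /= ; last by split; apply/set_mem.
    by rewrite /h2 mul1r -EFinM.
  - by rewrite ifF //; apply/negP => /set_mem [_ /= /mem_set]; rewrite (negPf yB).
  - by rewrite ifF //; apply/negP => /set_mem [/= /mem_set]; rewrite (negPf xA).
  - by rewrite ifF //; apply/negP => /set_mem [/= /mem_set]; rewrite (negPf xA).
rewrite ge0_integralZr //; first last.
- by move=> x _; rewrite lee_fin mulr_ge0 // ?g1_ge0 // indicE ler0n.
- by apply/measurable_EFinP; apply: measurable_funM => //; exact: measurable_g1.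
congr (_ * _); rewrite /= /normal_prob [in RHS]integral_mkcond; apply: eq_integral => x _.
by rewrite patchE indicE; case: ifP => _; rewrite ?mul1r ?mul0r.
Qed.

Lemma N2_rot c s A : (c ^+ 2 + s ^+ 2 = 1)%R -> (1 + c != 0)%R -> measurable A ->
  (N1 \x N1) (rot c s @^-1` A) = (N1 \x N1) A.
Proof.
move=> cs c1 mA; have mr := measurable_rot c s; rewrite !gam2E //; last exact: mpre.
rewrite /gam2 (eq_integral (h2 \o rot c s)); last by move=> z _; rewrite /= h2_rot.
have H := @ge0_integral_pushforward _ _ _ _ R (rot c s) mr L2 A h2 mA.
rewrite [LHS](esym (H _ _)).
- by apply: eq_measure_integral => B mB _; exact: L2_rot.
- exact: measurable_funTS measurable_h2.
- by move=> z _; exact: h2_ge0.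
Qed.

Lemma normal_scale (s : R) (A : set T) : (0 < s)%R -> measurable A ->
  normal_prob 0%R s ((fun x => x / s)%R @^-1` A) = normal_prob 0%R 1%R A.
Proof.
move=> s0 mA; have s1 := lt0r_neq0 s0; have i0 : (0 < s^-1)%R by rewrite invr_gt0.
pose f (x : T) : T := (s^-1 * x + 0)%R.
have mf : measurable_fun setT f := measurable_affine s^-1 0%R.
have -> : (fun x => x / s)%R = f.
  by apply/funext => x; rewrite /f addr0 mulrC.
pose F (y : T) : \bar R := (s^-1 * normal_pdf 0 1 y)%:E.
have F0 y : 0 <= F y by rewrite lee_fin mulr_ge0 ?(ltW i0) // normal_pdf_ge0.
have mF : measurable_fun A F.
  apply/measurable_EFinP; apply: measurable_funM => //.
  exact: measurable_funTS (measurable_normal_pdf _ _).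
pose m2 : {measure set T -> \bar R} := mscale (NngNum (ltW s0)) leb.
have E1 : \int[leb]_(x in f @^-1` A) (F \o f) x = \int[push leb mf]_(y in A) F y.
  by rewrite (ge0_integral_pushforward mf leb mA mF).
have E2 : \int[push leb mf]_(y in A) F y = \int[m2]_(y in A) F y.
  apply: eq_measure_integral => B mB _.
  by rewrite -[LHS]/(leb (f @^-1` B)) leb_affine // invrK.
have E3 : \int[m2]_(y in A) F y = normal_prob 0 1 A.
  rewrite ge0_integral_mscale //= /F.
  under eq_integral do rewrite EFinM.
  rewrite ge0_integralZl //.
  - by rewrite muleA -EFinM mulfV // mul1e.
  - by apply/measurable_EFinP; exact: measurable_funTS (measurable_normal_pdf _ _).
  - by move=> y _; rewrite lee_fin normal_pdf_ge0.
  - by rewrite lee_fin ltW.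
rewrite -E3 -E2 -E1; apply: eq_integral => x _.
rewrite /F /f /= /normal_pdf (negPf (oner_neq0 _)) (negPf s1) /normal_fun !subr0 expr1n addr0 mulrA.
congr (_ * expR _)%:E; last by field.
rewrite /normal_peak expr1n mul1r -mulrnAr sqrtrM ?sqr_ge0 // invfM sqrtr_sqr.
by rewrite ger0_norm ?ltW.
Qed.

End Gauss.

(** * The law of a standard Gaussian matrix and its elementary symmetries *)

Section MatrixLaw.
Variable R : realType.
Local Notation leb := (@lebesgue_measure R).
Local Notation T := (measurableTypeR R).
Local Open Scope ereal_scope.

Lemma N1_opp (A : set T) : measurable A -> N1 R ((fun x : T => - x : T)%R @^-1` A) = N1 R A.
Proof.
move=> mA; pose f (x : T) : T := (- x)%R.
have mf : measurable_fun setT f by exact: measurableT_comp.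
have F0 (y : T) : 0 <= (g1 y)%:E by rewrite lee_fin g1_ge0.
have mF : measurable_fun A (fun y : T => (g1 y)%:E).
  by apply/measurable_EFinP; rewrite /g1; exact: measurable_funTS (measurable_normal_pdf _ _).
have lebN B : measurable B -> leb B = push leb mf B.
  apply: lebesgue_measure_unique => _ [[a b] _ <-].
  rewrite -[RHS]/(leb (f @^-1` `]a, b])).
  have -> : f @^-1` `]a, b] = `[(- b)%R, (- a)%R[%classic.
    by apply/seteqP; split => x; rewrite /f /= !in_itv /= => /andP[h1 h2]; apply/andP; split; lra.
  rewrite /= !lebesgue_measure_itv /= !lte_fin ltrN2; case: ifP => // _.
  by rewrite -!EFinD; congr EFin; ring.
transitivity (\int[leb]_(x in f @^-1` A) ((fun y : T => (g1 y)%:E) \o f) x).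
  by apply: eq_integral => x _; rewrite /= -/(g1 x) !g1E sqrrN.
rewrite -(ge0_integral_pushforward mf leb mA mF) //.
have -> // : \int[push leb mf]_(y in A) (g1 y)%:E = N1 R A.
by apply: eq_measure_integral => B mB _; rewrite -lebN.
Qed.

(** Uniqueness of the product measure up to a factor. It serves for the law of two entries
    restricted to an event on the remaining ones, c being the probability of that event; c = 0
    cannot be normalised and is treated apart. *)
Lemma pair_cyl (nu : {measure set (T * T) -> \bar R}) (c : R) : (0 <= c)%R ->
  (forall A B, measurable A -> measurable B -> nu (A `*` B) = c%:E * (N1 R A * N1 R B)) ->
  forall X, measurable X -> nu X = c%:E * (N1 R \x N1 R) X.
Proof.
move=> c0 h X mX; have [c00|cn0] := eqVneq c 0%R.
  rewrite c00 mul0e; apply/eqP; rewrite eq_le measure_ge0 andbT.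
  apply: le_trans (_ : nu setT <= _); first by apply: le_measure; rewrite ?inE.
  by rewrite -setXTT h // c00 mul0e.
have ci : (0 <= c^-1)%R by rewrite invr_ge0.
have E : (N1 R \x N1 R) X = mscale (NngNum ci) nu X.
  apply: product_measure_unique mX => A B mA mB.
  by rewrite -[LHS]/((c^-1)%:E * nu (A `*` B)) h // muleA -EFinM mulVf // mul1e.
by rewrite E -[mscale _ _ _]/((c^-1)%:E * nu X) muleA -EFinM mulfV // mul1e.
Qed.

Section Law.
Variables d B : nat.
Implicit Types (e f : 'I_d * 'I_B) (A : 'I_d * 'I_B -> set R).

Definition rect A : set 'M[R]_(d, B) := [set M | forall e, A e (M e.1 e.2)].
Definition rects : set (set 'M[R]_(d, B)) :=
  [set X | exists A, (forall e, measurable (A e)) /\ X = rect A].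

(** Rectangles form a pi-system on which independence prescribes the law, so they are taken as
    generators of the sigma-algebra. *)
Definition MT := g_sigma_algebraType rects.

Lemma measurable_rect A : (forall e, measurable (A e)) -> measurable (rect A : set MT).
Proof. by move=> mA; apply: sub_sigma_algebra; exists A. Qed.

Lemma measurable_entry i j : measurable_fun setT (fun M : MT => M i j : T).
Proof.
move=> _ A mA; rewrite setTI.
rewrite (_ : _ @^-1` A = rect (fun e => if e == (i, j) then A else setT)).
  by apply: measurable_rect => e; case: ifP.
apply/seteqP; split => M /= h; first by move=> e; case: eqP => // ->.
by have := h (i, j); rewrite eqxx.
Qed.

Lemma measurable_toMT dd (X : measurableType dd) (h : X -> MT) :
  (forall i j, measurable_fun setT (fun x => h x i j : T)) -> measurable_fun setT h.
Proof.
move=> mh; apply: (@measurability _ _ X MT _ h rects) => // _ [_ [A [mA ->]] <-].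
rewrite setTI (_ : h @^-1` rect A = \bigcap_(e in setT) ((fun x => h x e.1 e.2 : T) @^-1` A e)); last first.
  by apply/seteqP; split => x /= H; [move=> e _; exact: H|move=> e; exact: H].
apply: fin_bigcap_measurable; first exact: finite_finset.
by move=> e _; apply: mpre; [exact: mh|exact: mA].
Qed.

Lemma rects_unique (m1 m2 : {measure set MT -> \bar R}) :
  (forall A, (forall e, measurable (A e)) -> m1 (rect A) = m2 (rect A)) ->
  m1 setT < +oo -> forall X : set MT, measurable X -> m1 X = m2 X.
Proof.
have rT : rect (fun=> setT) = setT by apply/seteqP; split.
move=> h m1oo X mX; apply: (@measure_unique _ R MT rects (fun=> setT)) => //.
- move=> _ _ [A [mA ->]] [C [mC ->]]; exists (fun e => A e `&` C e); split.
    by move=> e; exact: measurableI.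
  apply/seteqP; split => M /=; first by case=> h1 h2 e; split; [exact: h1|exact: h2].
  by move=> H; split => e; have [] := H e.
- by move=> _; exists (fun=> setT).
- by rewrite bigcup_const.
- by move=> _ [A [mA ->]]; exact: h.
Qed.

Definition stdmx (nu : set MT -> \bar R) :=
  forall A, (forall e, measurable (A e)) ->
    nu (rect A) = (\prod_e fine (N1 R (A e)))%:E.

Variable nu : probability MT R.
Hypothesis stdnu : stdmx nu.

Let fN (A : set T) : (0 <= fine (N1 R A))%R.
Proof. by rewrite fine_ge0. Qed.

(** Independence on rectangles is upgraded, for two chosen entries, to an arbitrary planar set C;
    the preimage of a rectangle under a plane rotation is of this kind. *)
Lemma law_cyl e e' A (C : set (T * T)) : e != e' -> measurable C -> (forall f, measurable (A f)) ->
  nu [set M : MT | C (M e.1 e.2, M e'.1 e'.2) /\ forall f, f != e -> f != e' -> A f (M f.1 f.2)] =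
  (\prod_(f | (f != e) && (f != e')) fine (N1 R (A f)))%:E * (N1 R \x N1 R) C.
Proof.
move=> ee mC mA; set c := (\prod_(f | _) _)%R.
pose D : set MT := rect (fun f => if (f != e) && (f != e') then A f else setT).
have mD : measurable D by apply: measurable_rect => f; case: ifP.
pose p (M : MT) : T * T := (M e.1 e.2, M e'.1 e'.2).
have mp : measurable_fun setT p.
  by apply/measurable_fun_pairP; split; exact: measurable_entry.
have -> : [set M : MT | C (M e.1 e.2, M e'.1 e'.2) /\ forall f, f != e -> f != e' -> A f (M f.1 f.2)] =
   p @^-1` C `&` D.
  apply/seteqP; split => M [h1 h2]; split => //.
    by move=> f; case: ifP => // /andP[]; exact: h2.
  by move=> f f1 f2; have := h2 f; rewrite f1 f2.
rewrite -[LHS]/(push (mrestr nu mD) mp C); apply: pair_cyl => //.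
  by apply: prodr_ge0.
move=> A1 A2 m1 m2; rewrite -[LHS]/(nu (p @^-1` (A1 `*` A2) `&` D)).
pose A' f := if f == e then A1 else if f == e' then A2 else A f.
have -> : p @^-1` (A1 `*` A2) `&` D = rect A'.
  apply/seteqP; split => M.
    move=> [[h1 h2] h3] f; rewrite /A'; case: eqP => [->//|/eqP fe]; case: eqP => [->//|/eqP fe'].
    by have := h3 f; rewrite fe fe'.
  move=> h; split.
    split; first by have := h e; rewrite /A' eqxx.
    by have := h e'; rewrite /A' eq_sym (negPf ee) eqxx.
  by move=> f; case: ifP => // /andP[f1 f2]; have := h f; rewrite /A' (negPf f1) (negPf f2).
rewrite stdnu; last by move=> f; rewrite /A'; case: ifP => // _; case: ifP.
rewrite (bigD1 e) //= (bigD1 e') 1?eq_sym //= {1 2}/A' eqxx eq_sym (negPf ee) eqxx.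
rewrite (eq_bigr (fun f => fine (N1 R (A f)))); last first.
  by move=> f /andP[f1 f2]; rewrite /A' (negPf f1) (negPf f2).
rewrite -/c mulrA EFinM muleC EFinM !fineK ?fin_num_measure //.
Qed.

Definition preserves (h : MT -> MT) :=
  measurable_fun setT h /\ forall X : set MT, measurable X -> nu (h @^-1` X) = nu X.

Lemma preserves_id : preserves id.
Proof. by split; first exact: measurable_id. Qed.

Lemma preserves_comp h1 h2 : preserves h1 -> preserves h2 -> preserves (h1 \o h2).
Proof.
move=> [m1 p1] [m2 p2]; split; first exact: measurableT_comp.
by move=> X mX; rewrite comp_preimage p2 ?p1 //; exact: mpre.
Qed.

Lemma preserves_ext h1 h2 : h1 =1 h2 -> preserves h1 -> preserves h2.
Proof. by move=> /funext ->. Qed.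

Lemma preserves_rect h : measurable_fun setT h ->
  (forall A, (forall e, measurable (A e)) -> nu (h @^-1` (rect A : set MT)) = nu (rect A)) -> preserves h.
Proof.
move=> mh hr; split => // X mX.
rewrite -[LHS]/(push nu mh X); apply: rects_unique => //.
by rewrite -[X in X < _]/(nu (h @^-1` setT)) preimage_setT probability_setT ltry.
Qed.

Definition rotm e e' (c s : R) (M : MT) : MT := \matrix_(i, j)
  (if (i, j) == e then c * M e.1 e.2 - s * M e'.1 e'.2
   else if (i, j) == e' then s * M e.1 e.2 + c * M e'.1 e'.2 else M i j)%R.

Lemma rotm_preserves e e' c s : e != e' -> (c ^+ 2 + s ^+ 2 = 1)%R -> (1 + c != 0)%R ->
  preserves (rotm e e' c s).
Proof.
move=> ee cs c1; have me := measurable_entry e.1 e.2; have me' := measurable_entry e'.1 e'.2.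
apply: preserves_rect.
  apply: measurable_toMT => i j; under eq_fun do rewrite mxE.
  case: ((i, j) == e); first by apply: measurable_funB; exact: measurable_funM.
  by case: ((i, j) == e'); [apply: measurable_funD; exact: measurable_funM|exact: measurable_entry].
move=> A mA; have mAA : measurable (A e `*` A e' : set (T * T)) by exact: (@measurableX _ _ T T _ _ (mA e) (mA e')).
have E1 : rotm e e' c s @^-1` (rect A : set MT) = [set M : MT | (rot c s @^-1` (A e `*` A e')) (M e.1 e.2, M e'.1 e'.2)
    /\ forall f, f != e -> f != e' -> A f (M f.1 f.2)].
  apply/seteqP; split => M.
    move=> h; split.
      split; first by have := h e; rewrite mxE -surjective_pairing eqxx.
      by have := h e'; rewrite mxE -surjective_pairing eqxx eq_sym (negPf ee).
    by move=> f f1 f2; have := h f; rewrite mxE -surjective_pairing (negPf f1) (negPf f2).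
  move=> [[h1 h2] h3] f; rewrite mxE -surjective_pairing.
  by case: eqP => [->//|/eqP f1]; case: eqP => [->//|/eqP f2]; exact: h3.
have E2 : rect A = [set M : MT | (A e `*` A e') (M e.1 e.2, M e'.1 e'.2)
    /\ forall f, f != e -> f != e' -> A f (M f.1 f.2)].
  apply/seteqP; split => M; first by move=> h; split; [split; exact: h|move=> f _ _; exact: h].
  move=> [[h1 h2] h3] f.
  by have [->//|f1] := eqVneq f e; have [->//|f2] := eqVneq f e'; exact: h3.
have mrA := mpre (measurable_rot c s) mAA.
rewrite E1 (law_cyl ee mrA mA) N2_rot // E2.
by apply/esym; exact: law_cyl ee mAA mA.
Qed.

Definition flipm e (M : MT) : MT := \matrix_(i, j) (if (i, j) == e then - M i j else M i j)%R.

Lemma flipm_preserves e : preserves (flipm e).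
Proof.
apply: preserves_rect.
  apply: measurable_toMT => i j; under eq_fun do rewrite mxE.
  by case: ((i, j) == e); [apply: measurableT_comp => //|]; exact: measurable_entry.
move=> A mA; pose A' f := if f == e then (fun x : T => - x : T)%R @^-1` A f else A f.
pose o (x : T) : T := (- x)%R.
have mo : measurable_fun setT o by exact: measurableT_comp.
have mA' f : measurable (A' f).
  rewrite /A'; case: (f == e); last exact: mA.
  have h := @mpre _ _ T T o (A f) mo (mA f).
  exact: h.
have -> : flipm e @^-1` rect A = rect A'.
  apply/seteqP; split => M h f; have := h f; rewrite /A' /= mxE -surjective_pairing;
    by case: ifP.
rewrite !stdnu //; congr EFin; apply: eq_bigr => f _; rewrite /A'.
case: (f == e) => //.
by have -> := N1_opp (mA f).
Qed.

Lemma pair_law e e' (C : set (T * T)) : e != e' -> measurable C ->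
  nu ((fun M : MT => (M e.1 e.2, M e'.1 e'.2)) @^-1` C) = (N1 R \x N1 R) C.
Proof.
move=> ee mC; have := @law_cyl e e' (fun=> setT) C ee mC (fun=> measurableT).
rewrite big1 ?mul1e; last by move=> f _; rewrite probability_setT.
by move=> <-; congr (nu _); apply/seteqP; split => M; [|case].
Qed.

Lemma entry_law e (C : set T) : measurable C ->
  nu ((fun M : MT => M e.1 e.2) @^-1` C) = N1 R C.
Proof.
move=> mC; pose A f := if f == e then C else setT.
have -> : (fun M : MT => M e.1 e.2) @^-1` C = rect A.
  apply/seteqP; split => M h; first by move=> f; rewrite /A; case: eqP => [->|].
  by have := h e; rewrite /A eqxx.
rewrite stdnu; last by move=> f; rewrite /A; case: ifP.
rewrite (bigD1 e) //= big1 => [|f /negPf fe]; last by rewrite /A fe probability_setT.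
by rewrite /A eqxx mulr1 fineK // fin_num_measure.
Qed.

End Law.
End MatrixLaw.

(** * Law-preserving reflections acting on the columns of a Gaussian matrix *)

Section Reflection.
Variable R : realType.
Variables d B' : nat.
Let B := B'.+1.
Variable nu : probability (MT R d B) R.
Hypothesis stdnu : stdmx nu.

Definition rpres (H : 'M[R]_B) := preserves nu (fun M : MT R d B => (M : 'M[R]_(d, B)) *m H).

Lemma rpres1 : rpres 1%:M.
Proof. by apply: preserves_ext (preserves_id nu) => M /=; rewrite mulmx1. Qed.

Lemma rpresM H1 H2 : rpres H1 -> rpres H2 -> rpres (H1 *m H2).
Proof.
move=> p1 p2; apply: preserves_ext (preserves_comp p2 p1) => M /=.
by rewrite mulmxA.
Qed.

(* A column operation that preserves the law row by row does so on the whole matrix. *)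
Lemma rpres_rows (H : 'M[R]_B) (h : 'I_d -> MT R d B -> MT R d B) :
  (forall i, preserves nu (h i)) ->
  (forall i M i' j, h i M i' j = if i' == i then ((M : 'M[R]_(d, B)) *m H) i' j else M i' j) ->
  rpres H.
Proof.
move=> ph hE.
pose F m (M : MT R d B) : MT R d B :=
  \matrix_(i, j) if (i < m)%N then ((M : 'M[R]_(d, B)) *m H) i j else M i j.
have pF m : (m <= d)%N -> preserves nu (F m).
  elim: m => [|m IH] md.
    by apply: preserves_ext (preserves_id nu) => M; apply/matrixP => i j; rewrite mxE.
  apply: preserves_ext (preserves_comp (ph (Ordinal md)) (IH (ltnW md))) => M /=.
  apply/matrixP => i j; rewrite hE !mxE -val_eqE /= ltnS.
  case: (ltngtP (i : nat) m) => im //=.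
  by apply: eq_bigr => l _; rewrite mxE im ltnn.
apply: preserves_ext (pF d (leqnn d)) => M.
by apply/matrixP => i j; rewrite mxE ltn_ord.
Qed.

Definition givens (k l : 'I_B) (c s : R) : 'M[R]_B := \matrix_(a, b)
  (if b == k then c *+ (a == k) - s *+ (a == l)
   else if b == l then s *+ (a == k) + c *+ (a == l) else (a == b)%:R).

Lemma mulmx_givens n (M : 'M[R]_(n, B)) k l c s i j : k != l ->
  (M *m givens k l c s) i j =
  if j == k then c * M i k - s * M i l
  else if j == l then s * M i k + c * M i l else M i j.
Proof.
move=> kl; rewrite mxE.
have dl (a : 'I_B) (x : R) : \sum_b M i b * (x *+ (b == a)) = x * M i a.
  rewrite (bigD1 a) //= eqxx big1 ?addr0 ?mulr1n 1?mulrC // => b /negPf ba.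
  by rewrite ba mulr0n mulr0.
under eq_bigr do rewrite mxE.
case: (j == k).
  by under eq_bigr do rewrite mulrBr; rewrite sumrB !dl.
case: (j == l).
  by under eq_bigr do rewrite mulrDr; rewrite big_split /= !dl.
by rewrite dl mul1r.
Qed.

Lemma trmx_givens k l c s : k != l -> (givens k l c s)^T = givens k l c (- s).
Proof.
move=> kl; apply/matrixP => a b; rewrite !mxE.
have lk : l != k by rewrite eq_sym.
have [->|ak] := eqVneq a k; have [->|bk] := eqVneq b k;
have [al|al] := eqVneq a l; have [bl|bl] := eqVneq b l;
  rewrite ?al ?bl ?(negPf kl) ?(negPf lk) ?eqxx ?(negPf ak) ?(negPf bk) ?(negPf al) ?(negPf bl)
   ?mulr0n ?mulr1n ?subr0 ?sub0r ?add0r ?addr0 ?opprK //; try by rewrite ?al ?bl eqxx in kl lk ak bk al bl.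
all: try by apply/eqP; rewrite pnatr_eq0 eqb0 eq_sym.
all: try by apply/esym/eqP; rewrite pnatr_eq0 eqb0 eq_sym.
by rewrite eq_sym.
Qed.

Lemma givens_rpres k l c s : k != l -> c ^+ 2 + s ^+ 2 = 1 -> 1 + c != 0 ->
  rpres (givens k l c s).
Proof.
move=> kl cs c1; apply: (@rpres_rows _ (fun i => rotm (i, k) (i, l) c s)).
  by move=> i; apply: rotm_preserves => //; rewrite xpair_eqE negb_and kl orbT.
move=> i M i' j; rewrite mxE !xpair_eqE mulmx_givens //=.
by case: eqP => [->|_] //=.
Qed.

Lemma givens_orth k l c s : k != l -> c ^+ 2 + s ^+ 2 = 1 ->
  givens k l c s *m (givens k l c s)^T = 1%:M.
Proof.
move=> kl cs; rewrite trmx_givens //; apply/matrixP => a b.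
have lk : l != k by rewrite eq_sym.
rewrite mulmx_givens // !mxE !eqxx ?(negPf kl) ?(negPf lk).
have [->|bk] := eqVneq b k.
  have [->|ak] := eqVneq a k; first by rewrite (negPf kl) !mulr1n !mulr0n -cs; ring.
  by have [_|al] := eqVneq a l; rewrite ?mulr0n ?mulr1n; ring.
have [->|bl] := eqVneq b l; last by [].
have [->|ak] := eqVneq a k; first by rewrite (negPf kl) !mulr1n !mulr0n; ring.
by have [_|al] := eqVneq a l; rewrite ?mulr0n ?mulr1n -?cs; ring.
Qed.

Definition flip0 : 'M[R]_B := diag_mx (\row_j (-1) ^+ (j == 0)).

Lemma flip0_rpres : rpres flip0.
Proof.
apply: (@rpres_rows _ (fun i => flipm (i, 0))); first by move=> i; exact: flipm_preserves.
move=> i M i' j; rewrite mxE xpair_eqE mul_mx_diag !mxE.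
case: eqP => [->|_] //=.
by case: eqP => _; rewrite ?expr1 ?expr0 ?mulr1 ?mulrN1.
Qed.

(** Givens rotations annihilate the coordinates 1, 2, ... of u one after the other against
    coordinate 0. Each preserves the law, and so does its transpose, the inverse rotation. *)
Lemma triangularize (u : 'cV[R]_B) : exists G, [/\ rpres G, rpres G^T, G *m G^T = 1%:M &
  forall k : 'I_B, k != 0 -> (u^T *m G) 0 k = 0].
Proof.
suff H m : (m <= B)%N -> exists G, [/\ rpres G, rpres G^T, G *m G^T = 1%:M &
  forall k : 'I_B, k != 0 -> (k < m)%N -> (u^T *m G) 0 k = 0].
  have [G [h1 h2 h3 h4]] := H B (leqnn _).
  by exists G; split => // k k0; apply: h4 => //; exact: ltn_ord.
elim: m => [|m IH] mB.
  by exists 1%:M; split; rewrite ?trmx1 ?mul1mx //; exact: rpres1.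
have [G [h1 h2 h3 h4]] := IH (ltnW mB).
have [m0|m0] := eqVneq m 0%N.
  exists G; split => // k k0; rewrite m0 ltnS leqn0 => /eqP h.
  by case/eqP: k0; apply: val_inj.
pose k0 : 'I_B := 0; pose l0 : 'I_B := Ordinal mB.
have kl : k0 != l0 by rewrite -val_eqE /= eq_sym.
set x := (u^T *m G) 0 k0; set y := (u^T *m G) 0 l0.
(* The sign of the new coordinate 0 is chosen so that c >= 0; this avoids the rotation by pi, which
   the three shears do not produce. *)
have [c [s [cs c1 cxy]]] : exists c s, [/\ c ^+ 2 + s ^+ 2 = 1, 1 + c != 0 & s * x + c * y = 0 :> R].
  pose r := Num.sqrt (x ^+ 2 + y ^+ 2).
  have sq : 0 <= x ^+ 2 + y ^+ 2 by rewrite addr_ge0 // sqr_ge0.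
  have r2 : r ^+ 2 = x ^+ 2 + y ^+ 2 by rewrite sqr_sqrtr.
  have [r0|rn0] := eqVneq r 0.
    exists 1, 0; split; first by rewrite expr1n expr0n addr0.
      by rewrite gt_eqF //; lra.
    rewrite r0 expr0n /= in r2; have y2 := sqr_ge0 y; have x2 := sqr_ge0 x.
    have : y ^+ 2 == 0 by apply/eqP; lra.
    by rewrite sqrf_eq0 => /eqP ->; rewrite mul0r mulr0 addr0.
  have rp : 0 < r by rewrite lt_def rn0 sqrtr_ge0.
  have [x0|x0] := lerP 0 x.
    exists (x / r), (- y / r); split.
    - by rewrite !expr_div_n -mulrDl sqrrN -r2 mulfV // sqrf_eq0.
    - by rewrite gt_eqF // ltr_wpDr // divr_ge0 // ltW.
    - by field.
  exists (- x / r), (y / r); split.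
  - by rewrite !expr_div_n -mulrDl sqrrN -r2 mulfV // sqrf_eq0.
  - by rewrite gt_eqF // ltr_wpDr // divr_ge0 ?(ltW rp) // oppr_ge0 ltW.
  - by field.
have cs' : c ^+ 2 + (- s) ^+ 2 = 1 by rewrite sqrrN.
exists (G *m givens k0 l0 c s); split.
- by apply: rpresM => //; exact: givens_rpres.
- rewrite trmx_mul; apply: rpresM => //; rewrite trmx_givens //; exact: givens_rpres.
- by rewrite trmx_mul mulmxA -(mulmxA G) givens_orth // mulmx1.
move=> k kn0 km; rewrite mulmxA mulmx_givens // (negPf kn0).
case: eqP => [//|/eqP kl0]; apply: h4 => //.
by move: km; rewrite ltnS leq_eqVlt => /orP[/eqP h|//]; case/eqP: kl0; apply: val_inj.
Qed.

(** A Householder reflection, obtained as G D G^T where G turns u into a multiple of the first basis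
    vector and D changes the sign of the first column; each factor preserves the law. For u = 0 the
    identity serves. *)
Lemma reflection (u : 'cV[R]_B) : exists H, [/\ rpres H, H^T = H, H *m u = - u &
  forall x : 'cV[R]_B, ip x u = 0 -> x^T *m H = x^T].
Proof.
have [->|un0] := eqVneq u 0.
  by exists 1%:M; split; [exact: rpres1|exact: trmx1|rewrite mulmx0 oppr0|move=> x _; rewrite mulmx1].
have [G [h1 h2 h3 h4]] := triangularize u.
pose D := flip0; exists (G *m D *m G^T).
have DT : D^T = D by rewrite /D /flip0 tr_diag_mx.
pose r := (u^T *m G) 0 0.
have ur : u^T *m G *m D = - (u^T *m G).
  apply/rowP => j; rewrite /D /flip0 mul_mx_diag !mxE.
  have [->|j0] := eqVneq j 0; first by rewrite expr1 mulrN1.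
  by have := h4 j j0; rewrite mxE => ->; rewrite mul0r oppr0.
have uH : u^T *m (G *m D *m G^T) = - u^T.
  by rewrite !mulmxA ur mulNmx -mulmxA h3 mulmx1.
have HT : (G *m D *m G^T)^T = G *m D *m G^T by rewrite !trmx_mul DT trmxK mulmxA.
split.
- by apply: rpresM => //; apply: rpresM => //; exact: flip0_rpres.
- exact: HT.
- apply: trmx_inj; rewrite trmx_mul HT uH.
  by apply/matrixP => i j; rewrite !mxE.
move=> x xu; have E : (x^T *m G) 0 0 * r = 0.
  have : (x^T *m G *m (u^T *m G)^T) 0 0 = 0.
    rewrite trmx_mul mulmxA -(mulmxA x^T) h3 mulmx1 trmxK mxE -[RHS]xu.
    by apply: eq_bigr => j _; rewrite mxE.
  rewrite mxE (bigD1 0) //= big1 ?addr0; first by rewrite [X in _ * X]mxE.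
  by move=> j j0; rewrite [X in _ * X]mxE h4 // mulr0.
have rn0 : r != 0.
  apply: contra un0 => /eqP r0; apply/eqP.
  have uG : u^T *m G = 0.
    apply/rowP => j; rewrite [RHS]mxE; have [->|j0] := eqVneq j 0; first exact: r0.
    exact: h4.
  by apply: trmx_inj; rewrite trmx0 -[u^T]mulmx1 -h3 mulmxA uG mul0mx.
have x0 : (x^T *m G) 0 0 = 0.
  by move/eqP: E; rewrite mulf_eq0 (negPf rn0) orbF => /eqP.
have xD : x^T *m G *m D = x^T *m G.
  apply/rowP => j; rewrite /D /flip0 mul_mx_diag [LHS]mxE [X in _ * X]mxE.
  have [->|j0] := eqVneq j 0; first by rewrite x0 mul0r.
  by rewrite expr0 mulr1.
by rewrite !mulmxA xD -mulmxA h3 mulmx1.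
Qed.

End Reflection.

(** * Gram-Schmidt inside the cone of vectors at obtuse angles *)

Section Cone.
Variable R : realType.

Definition cone n (u : nat -> 'cV[R]_n) m (v : 'cV[R]_n) :=
  exists c : nat -> R, (forall i, 0 <= c i) /\ v = \sum_(i < m) c i *: u i.

Lemma cone0 n (u : nat -> 'cV[R]_n) m : cone u m 0.
Proof. by exists (fun=> 0); split => //; rewrite big1 // => i _; rewrite scale0r. Qed.

Lemma coneD n (u : nat -> 'cV[R]_n) m v w : cone u m v -> cone u m w -> cone u m (v + w).
Proof.
move=> [c [c0 ->]] [d [d0 ->]]; exists (fun i => c i + d i); split.
  by move=> i; rewrite addr_ge0.
by rewrite -big_split; apply: eq_bigr => i _; rewrite scalerDl.
Qed.

Lemma coneZ n (u : nat -> 'cV[R]_n) m a v : 0 <= a -> cone u m v -> cone u m (a *: v).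
Proof.
move=> a0 [c [c0 ->]]; exists (fun i => a * c i); split; first by move=> i; rewrite mulr_ge0.
by rewrite scaler_sumr; apply: eq_bigr => i _; rewrite scalerA.
Qed.

Lemma cone_gen n (u : nat -> 'cV[R]_n) m l : (l < m)%N -> cone u m (u l).
Proof.
move=> lm; exists (fun i => (i == l)%:R); split; first by move=> i; rewrite ler0n.
rewrite (bigD1 (Ordinal lm)) //= eqxx scale1r big1 ?addr0 // => i.
by rewrite -val_eqE /= => /negPf ->; rewrite scale0r.
Qed.

Lemma coneS n (u : nat -> 'cV[R]_n) m m' v : (m <= m')%N -> cone u m v -> cone u m' v.
Proof.
move=> mm [c [c0 ->]]; elim/big_ind: _ => //; [exact: cone0|exact: coneD|].
by move=> i _; apply: coneZ => //; apply: cone_gen; exact: leq_trans (ltn_ord i) mm.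
Qed.

(* With pairwise nonpositive inner products every Gram-Schmidt coefficient is nonnegative. *)
Lemma gram_schmidt_cone n (u : nat -> 'cV[R]_n) L :
  (forall l m, (l < L)%N -> (m < L)%N -> l != m -> ip (u l) (u m) <= 0) ->
  exists v : nat -> 'cV[R]_n,
    (forall l, (l < L)%N -> exists2 r, cone u l r & v l = u l + r) /\
    (forall l m, (l < L)%N -> (m < L)%N -> l != m -> ip (v l) (v m) = 0).
Proof.
elim: L => [|L IH] h; first by exists u; split.
have [v [hv ov]] : exists v : nat -> 'cV[R]_n,
    (forall l, (l < L)%N -> exists2 r, cone u l r & v l = u l + r) /\
    (forall l m, (l < L)%N -> (m < L)%N -> l != m -> ip (v l) (v m) = 0).
  by apply: IH => l m lL mL; apply: h; exact: ltnW.
(* If v m = 0 this coefficient is 0 by the convention x / 0 = 0, so linearly dependent families are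
   allowed. *)
pose t m := - (ip (u L) (v m) / ip (v m) (v m)).
pose r := \sum_(m < L) t m *: v m.
have vc m : (m < L)%N -> cone u m.+1 (v m).
  move=> mL; have [s sc ->] := hv m mL; apply: coneD; first exact: cone_gen.
  exact: coneS sc.
have cneg m w : (m <= L)%N -> cone u m w -> ip (u L) w <= 0.
  move=> mL [c [c0 ->]]; rewrite ip_sumr; apply: sumr_le0 => i _.
  have iL : (i < L)%N by exact: leq_trans (ltn_ord i) mL.
  rewrite ipZr mulr_ge0_le0 // h //; first exact: ltnW.
  by rewrite neq_ltn iL orbT.
exists (fun l => if l == L then u L + r else v l); split.
  move=> l; rewrite ltnS leq_eqVlt => /orP[/eqP ->|lL].
    rewrite eqxx; exists r => //; rewrite /r; elim/big_ind: _; [exact: cone0|exact: coneD|].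
    move=> i _; apply: coneZ; last by apply: coneS (vc i _) => //; exact: ltn_ord.
    rewrite /t oppr_ge0 mulr_le0_ge0 ?invr_ge0 ?ip_ge0 //.
    by apply: (cneg i.+1) => //; apply: vc.
  by rewrite ltn_eqF //; exact: hv.
have key m : (m < L)%N -> ip (u L + r) (v m) = 0.
  move=> mL; rewrite ipDl (ipC r) /r ip_sumr (bigD1 (Ordinal mL)) //= big1 ?addr0.
    rewrite ipZr /t; have [v0|vn0] := eqVneq (ip (v m) (v m)) 0.
      by rewrite (ip_eq0 v0) !ip0r mulr0 addr0.
    by rewrite mulNr divfK // subrr.
  move=> i im; rewrite ipZr ov ?mulr0 //; last by rewrite eq_sym.
have cs l : (l < L.+1)%N -> l = L \/ (l < L)%N.
  by rewrite ltnS leq_eqVlt => /orP[/eqP|]; [left|right].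
move=> l m /cs[->|lL] /cs[->|mL]; rewrite ?eqxx //.
- by rewrite (ltn_eqF mL) => _; exact: key.
- by rewrite (ltn_eqF lL) => _; rewrite ipC; exact: key.
- by rewrite (ltn_eqF mL) (ltn_eqF lL); exact: ov.
Qed.

End Cone.

(** * Measurability of matrix operations, inversion included *)

Section Measurability.
Variable R : realType.
Context dd (X : measurableType dd).
Local Notation T := (measurableTypeR R).

Lemma measurable_bigsum (I : Type) (s : seq I) (P : pred I) (F : I -> X -> T) :
  (forall i, P i -> measurable_fun setT (F i)) ->
  measurable_fun setT (fun x => \sum_(i <- s | P i) F i x : T).
Proof.
move=> mF; elim: s => [|i s IH]; first by under eq_fun do rewrite big_nil; exact: measurable_cst.
under eq_fun do rewrite big_cons; case: (boolP (P i)) => // Pi.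
by apply: measurable_funD => //; exact: mF.
Qed.

Lemma measurable_bigprod (I : Type) (s : seq I) (P : pred I) (F : I -> X -> T) :
  (forall i, P i -> measurable_fun setT (F i)) ->
  measurable_fun setT (fun x => \prod_(i <- s | P i) F i x : T).
Proof.
move=> mF; elim: s => [|i s IH]; first by under eq_fun do rewrite big_nil; exact: measurable_cst.
under eq_fun do rewrite big_cons; case: (boolP (P i)) => // Pi.
by apply: measurable_funM => //; exact: mF.
Qed.

Definition mxmeas n m (F : X -> 'M[R]_(n, m)) :=
  forall i j, measurable_fun setT (fun x => F x i j : T).

Lemma mxmeas_mul n m p (F : X -> 'M[R]_(n, m)) (G : X -> 'M[R]_(m, p)) :
  mxmeas F -> mxmeas G -> mxmeas (fun x => F x *m G x).
Proof.
move=> mF mG i j; under eq_fun do rewrite mxE.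
by apply: measurable_bigsum => k _; apply: measurable_funM; [exact: mF|exact: mG].
Qed.

Lemma mxmeas_tr n m (F : X -> 'M[R]_(n, m)) : mxmeas F -> mxmeas (fun x => (F x)^T).
Proof. by move=> mF i j; under eq_fun do rewrite mxE; exact: mF. Qed.

Lemma mxmeas_cst n m (A : 'M[R]_(n, m)) : mxmeas (fun=> A).
Proof. by move=> i j; exact: measurable_cst. Qed.

Lemma mxmeas_add n m (F G : X -> 'M[R]_(n, m)) :
  mxmeas F -> mxmeas G -> mxmeas (fun x => F x + G x).
Proof. by move=> mF mG i j; under eq_fun do rewrite mxE; apply: measurable_funD; [exact: mF|exact: mG]. Qed.

Lemma measurable_det n (F : X -> 'M[R]_n) : mxmeas F ->
  measurable_fun setT (fun x => \det (F x) : T).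
Proof.
move=> mF; apply: measurable_bigsum => s _; apply: measurable_funM => //.
by apply: measurable_bigprod => i _; exact: mF.
Qed.

Lemma mxmeas_inv n (F : X -> 'M[R]_n) : (forall x, F x \in unitmx) -> mxmeas F ->
  mxmeas (fun x => invmx (F x)).
Proof.
move=> uF mF i j; rewrite /invmx; under eq_fun do rewrite uF mxE mxE /cofactor.
apply: measurable_funM.
  (* Writing x^-1 as x times the power -1 of x^2 reduces inversion to a real power of a nonnegative
     number. *)
  have E x : (\det (F x))^-1 = \det (F x) * (\det (F x) * \det (F x)) `^ (-1).
    have dn : \det (F x) != 0 by have := uF x; rewrite unitmxE unitfE.
    by rewrite powR_inv1 ?invfM ?mulrA ?mulfV ?mul1r // -expr2 sqr_ge0.
  under eq_fun do rewrite E.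
  have md := measurable_det mF.
  apply: measurable_funM => //.
  apply: (measurableT_comp (f := fun y : T => y `^ (-1) : T)); first exact: measurable_powR.
  exact: measurable_funM.
apply: measurable_funM => //; apply: measurable_det => a b.
by under eq_fun do rewrite !mxE; exact: mF.
Qed.

End Measurability.

(** * Probability that the noise is positive at all points of one gap *)

Section Orthant.
Variable R : realType.
Variables d B' n : nat.
Let B := B'.+1.
Variable nu : probability (MT R d B) R.
Hypothesis stdnu : stdmx nu.
Variable A : 'M[R]_(n, B).
Local Notation T := (measurableTypeR R).

Let pg (g : MT R d B) : 'M[R]_(n, d) := A *m (g : 'M[R]_(d, B))^T.
Let X (v : 'cV[R]_B) k (g : MT R d B) : R :=
  ip (tikh (pg g) (k.+1%:R)^-1) ((g : 'M[R]_(d, B)) *m v).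

Let ik (k : nat) : 0 < (k.+1%:R)^-1 :> R. Proof. by rewrite invr_gt0 ltr0n. Qed.

Let mX v k : measurable_fun setT (X v k : _ -> T).
Proof.
have mg : mxmeas (fun g : MT R d B => (g : 'M[R]_(d, B))) by move=> i j; exact: measurable_entry.
have mp : mxmeas pg by apply: mxmeas_mul; [exact: mxmeas_cst|exact: mxmeas_tr].
apply: measurable_bigsum => i _; apply: measurable_funM; last first.
  by apply: (mxmeas_mul mg (mxmeas_cst _)).
apply: (mxmeas_mul (mxmeas_tr mp)); apply: mxmeas_mul; last exact: mxmeas_cst.
apply: mxmeas_inv; first by move=> g; exact: tikh_unit.
by apply: mxmeas_add; [apply: mxmeas_mul => //; exact: mxmeas_tr|exact: mxmeas_cst].
Qed.

(* beta_hat is defined by a choice operator; eventual positivity of the Tikhonov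
   approximations is a measurable substitute for positivity of its pairing with g v. *)
Let P v : set (MT R d B) := \bigcup_m \bigcup_K \bigcap_(k in [set k | (K <= k)%N])
  [set g | (m.+1%:R)^-1 <= X v k g].

Let mP v : measurable (P v).
Proof.
apply: bigcup_measurable => m _; apply: bigcup_measurable => K _.
apply: bigcap_measurableType => k _.
have -> : [set g | (m.+1%:R)^-1 <= X v k g] = X v k @^-1` `[(m.+1%:R)^-1, +oo[%classic.
  by apply/seteqP; split => g; rewrite /= in_itv /= andbT.
by apply: (mpre (mX v k)); exact: measurable_itv.
Qed.

(** Each further vector halves the probability: the reflection in v L fixes [A], hence the
    approximations of beta, and also the other v l, but it reverses v L. The event for L + 1 and its
    preimage are disjoint, equally likely and both contained in the event for L. *)
Lemma orthant_prob L (v : nat -> 'cV[R]_B) :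
  (forall l, (l < L)%N -> A *m v l = 0) ->
  (forall l m, (l < L)%N -> (m < L)%N -> l != m -> ip (v l) (v m) = 0) ->
  (nu (\bigcap_(l in [set l | (l < L)%N]) P (v l)) <= ((2 ^+ L)^-1)%:E)%E.
Proof.
elim: L => [|L IH] Av ov.
  by rewrite expr0 invr1; apply: probability_le1; apply: bigcap_measurableType => l _; exact: mP.
pose E L : set (MT R d B) := \bigcap_(l in [set l | (l < L)%N]) P (v l).
have mE M : measurable (E M) by apply: bigcap_measurableType => l _; exact: mP.
have {}IH : (nu (E L) <= ((2 ^+ L)^-1)%:E)%E.
  by apply: IH => l; [move=> lL; apply: Av|move=> m lL mL; apply: ov]; exact: ltnW.
have [H [pH HT Hv Hx]] := reflection stdnu (v L).
pose h (g : MT R d B) : MT R d B := (g : 'M[R]_(d, B)) *m H.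
have AH : A *m H = A.
  apply/row_matrixP => i; rewrite row_mul -[row i A]trmxK Hx // ipC.
  have /matrixP/(_ i 0) := Av L (ltnSn L); rewrite !mxE => <-.
  by apply: eq_bigr => j _; rewrite !mxE mulrC.
have ph g : pg (h g) = pg g by rewrite /pg /h trmx_mul HT mulmxA AH.
have Xfix l k g : (l < L)%N -> X (v l) k (h g) = X (v l) k g.
  move=> lL; rewrite /X ph; congr ip; rewrite /h -mulmxA; congr (_ *m _).
  apply: trmx_inj; rewrite trmx_mul HT Hx // ov //; [exact: ltnW|by rewrite ltn_eqF].
have Xneg k g : X (v L) k (h g) = - X (v L) k g.
  by rewrite /X ph /h -mulmxA Hv mulmxN ipNr.
have Pfix l : (l < L)%N -> h @^-1` P (v l) = P (v l).
  move=> lL; apply/seteqP; split => g [m _ [K _ hk]]; exists m => //; exists K => // k Kk;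
  by have := hk k Kk; rewrite /= Xfix.
have [mh nh] := pH.
have sub1 : E L.+1 `<=` E L by move=> g hg l /= lL; apply: hg => /=; exact: ltnW.
have sub2 : h @^-1` E L.+1 `<=` E L.
  move=> g hg l /= lL; rewrite -[P _]Pfix //; apply: hg => /=; exact: ltnW.
have dis : E L.+1 `&` h @^-1` E L.+1 = set0.
  apply/seteqP; split => g // [/(_ L (ltnSn L)) [m _ [K _ h1]] /(_ L (ltnSn L)) [m' _ [K' _ h2]]].
  have := h1 (maxn K K') (leq_maxl _ _); have := h2 (maxn K K') (leq_maxr _ _).
  move=> a b; suff : False by [].
  have a' : (m'.+1%:R)^-1 <= X (v L) (maxn K K') (h g) := a.
  have b' : (m.+1%:R)^-1 <= X (v L) (maxn K K') g := b.
  rewrite Xneg in a'; have := ik m; have := ik m'; clear -a' b' => h1 h2.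
  have := lt_le_trans h1 a'; have := lt_le_trans h2 b'; rewrite oppr_gt0 => h3 h4.
  by have := lt_trans h3 h4; rewrite ltxx.
have mh1 : measurable (h @^-1` E L.+1) by exact: mpre.
have E2 : (nu (E L.+1) + nu (E L.+1) <= nu (E L))%E.
  rewrite -{2}nh // -measureU //; apply: le_measure; rewrite ?inE //; first exact: measurableU.
  by move=> g [] ?; [exact: sub1|exact: sub2].
have fE M : nu (E M) \is a fin_num by exact: fin_num_measure.
rewrite -/(E L.+1); have := le_trans E2 IH.
rewrite -(fineK (fE L.+1)) -EFinD !lee_fin exprS invfM; lra.
Qed.

(** Positivity passes from the u l to their Gram-Schmidt vectors, which are u l plus nonnegative
    combinations of the family, and these are orthogonal as [orthant_prob] demands. *)
Lemma gap_event L (u : nat -> 'cV[R]_B) :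
  (forall l, (l < L)%N -> A *m u l = 0) ->
  (forall l m, (l < L)%N -> (m < L)%N -> l != m -> ip (u l) (u m) <= 0) ->
  exists E : set (MT R d B), [/\ measurable E, (nu E <= ((2 ^+ L)^-1)%:E)%E &
    forall (g : MT R d B) (w : 'cV[R]_n), pg g *m (pg g)^T *m w = const_mx 1 ->
      (forall l, (l < L)%N -> 0 < ip ((pg g)^T *m w) ((g : 'M[R]_(d, B)) *m u l)) -> E g].
Proof.
move=> Au ou; have [v [hv ov]] := gram_schmidt_cone ou.
exists (\bigcap_(l in [set l | (l < L)%N]) P (v l)); split.
- by apply: bigcap_measurableType => l _; exact: mP.
- apply: orthant_prob => // l lL; have [r [c [_ ->]] ->] := hv l lL.
  rewrite mulmxDr Au // add0r mulmx_sumr big1 // => i _.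
  by rewrite -scalemxAr Au ?scaler0 //; exact: ltn_trans (ltn_ord i) lL.
move=> g w hw pos l /= lL; set be := (pg g)^T *m w in pos.
have vpos : 0 < ip be ((g : 'M[R]_(d, B)) *m v l).
  have [r [c [c0 ->]] ->] := hv l lL; rewrite mulmxDr ipDr ltr_wpDr ?pos //.
  rewrite mulmx_sumr ip_sumr sumr_ge0 // => i _; rewrite -scalemxAr ipZr mulr_ge0 //.
  by apply: ltW; apply: pos; exact: ltn_trans (ltn_ord i) lL.
set y := ip be _ in vpos; set gv := _ *m v l in y vpos.
pose C := ip w w * ip gv gv.
have C0 : 0 <= C by rewrite mulr_ge0 // ip_ge0.
have cl k : (y - X (v l) k g) ^+ 2 <= (k.+1%:R)^-1 * C.
  rewrite /y /X -/gv -ipBl; apply: le_trans (CS _ _) _; rewrite mulrA.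
  by rewrite ler_wpM2r ?ip_ge0 // tikh_close.
(* Here y is the limit of the approximations: m is taken so that 1 / (m + 1) <= y / 2, and K below
   so that the error is at most y / 2 from index K on. *)
pose m := Num.truncn (2 / y).
have hm : (m.+1%:R)^-1 <= y / 2.
  rewrite -[leRHS]invrK lef_pV2 ?posrE ?ltr0n ?invr_gt0 ?divr_gt0 // invf_div.
  by apply: ltW; have /andP[] := truncn_itv (ltW (divr_gt0 (ltr0Sn R 1) vpos)).
pose K := Num.truncn (4 * C / y ^+ 2).
have y2 : 0 < y ^+ 2 by rewrite exprn_gt0.
exists m => //; exists K => // k /= Kk; apply: le_trans hm _.
have Ck : (k.+1%:R)^-1 * C <= (y / 2) ^+ 2.
  rewrite mulrC ler_pdivrMr ?ltr0n // expr_div_n.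
  have h1 : 4 * C / y ^+ 2 <= k.+1%:R.
    have /andP[_ /ltW h] := truncn_itv (divr_ge0 (mulr_ge0 (ler0n R 4) C0) (ltW y2)).
    by apply: le_trans h _; rewrite ler_nat ltnS.
  rewrite ler_pdivrMr // in h1.
  have -> : (2 : R) ^+ 2 = 4 by rewrite expr2; ring.
  lra.
have h3 := le_trans (cl k) Ck.
have : `|y - X (v l) k g| <= y / 2.
  rewrite -(@ler_pXn2r _ 2) ?nnegrE ?divr_ge0 ?(ltW vpos) //.
  by rewrite real_normK ?num_real.
by rewrite ler_norml => /andP[_ h4]; lra.
Qed.

End Orthant.

(** * Explicit kriging weights for a translation-invariant kernel on the grid *)

Section Kriging.
Variable R : realType.

Lemma dvdz_eqmod (n j k : nat) : (n %| (j : int) - (k : int))%Z = (j == k %[mod n])%N.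
Proof. by rewrite -eqz_mod_dvd !modz_nat eqz_nat. Qed.

Lemma dvdz_oppr (n : nat) (z : int) : (n %| - z)%Z = (n %| z)%Z.
Proof. by rewrite !dvdzE abszN. Qed.

Lemma double_natr (N : nat) : N.*2%:R = N%:R + N%:R :> R.
Proof. by rewrite -addnn natrD. Qed.

Variables (n N : nat) (a b : R).
Hypotheses (n0 : (0 < n)%N) (nJ : (n <= N.*2.+1)%N) (a0 : 0 <= a) (b0 : 0 < b).
Local Notation J := N.*2.+1.

(** The index j stands for the frequency j - N, so that the symmetric spectrum -N, ..., N is indexed
    by naturals and congruence of frequencies is congruence of indices. *)
Definition fr (j : nat) : R := j%:R - N%:R.
(** A term b cos is shared by two opposite frequencies, each of weight b / 2. *)
Definition wt (j : nat) : R := if j == N then a else b / 2.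
Definition Wc (r : nat) : R := \sum_(j < J | j == r %[mod n]) wt j.
(* Frequencies congruent mod n agree on the training grid, so the kernel system
   decouples over residue classes; each class enters through its total weight Wc. *)
Definition cw (X : R) (k : nat) : R :=
  n%:R^-1 * \sum_(j < J) wt j / Wc j * cos (2 * pi * fr j * (tgrid R n k - X)).

Lemma wt_ge0 j : 0 <= wt j.
Proof. by rewrite /wt; case: ifP => // _; rewrite divr_ge0 // ltW. Qed.

Lemma sum_rev (F : nat -> R) : \sum_(j < J) F j = \sum_(j < J) F (N.*2 - j)%N.
Proof. by rewrite (reindex_inj rev_ord_inj) /=; apply: eq_bigr => j _; rewrite subSS. Qed.

Lemma wt_rev (j : 'I_J) : wt (N.*2 - j) = wt j.
Proof.
have jN : (j <= N.*2)%N by have := ltn_ord j; rewrite ltnS.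
by rewrite /wt; congr (if _ then _ else _); apply/eqP/eqP; lia.
Qed.

Lemma fr_rev (j : 'I_J) : fr (N.*2 - j) = - fr j.
Proof.
have jN : (j <= N.*2)%N by have := ltn_ord j; rewrite ltnS.
by rewrite /fr natrB // double_natr; ring.
Qed.

Lemma Wc_mod r r' : (r == r' %[mod n])%N -> Wc r = Wc r'.
Proof. by move=> /eqP h; apply: eq_bigl => j; rewrite h. Qed.

Lemma Wc_rev (j : 'I_J) : Wc (N.*2 - j) = Wc j.
Proof.
have jN : (j <= N.*2)%N by have := ltn_ord j; rewrite ltnS.
rewrite /Wc !(big_mkcond (fun i : 'I_J => _ == _ %[mod n])) /=.
rewrite (sum_rev (fun i => if (i == N.*2 - j %[mod n])%N then wt i else 0)).
apply: eq_bigr => i _; have iN : (i <= N.*2)%N by have := ltn_ord i; rewrite ltnS.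
rewrite wt_rev -!dvdz_eqmod; congr (if _ then _ else _).
rewrite -[RHS]dvdz_oppr; congr (_ %| _)%Z; rewrite -!subzn //; ring.
Qed.

Hypothesis W0 : forall r, Wc r != 0.

(** The product formula for cosines yields a sum part [G1] and a difference part [G2]. The reversal
    j -> 2 N - j, under which weights and class totals are symmetric, maps one onto the other, so
    real cosines alias as exponentials do. *)
Lemma cw_core (j' : nat) (th X : R) :
  \sum_(k < n) cw X k * cos (2 * pi * fr j' * tgrid R n k - th) =
  \sum_(j < J | j == j' %[mod n]) wt j / Wc j * cos (2 * pi * fr j * X - th).
Proof.
have n0R : n%:R != 0 :> R by rewrite pnatr_eq0 -lt0n.
pose G1 (j : nat) : R := if (n %| (j : int) + (j' : int) - (N.*2 : int))%Z then
   wt j / Wc j * cos (2 * pi * fr j * X + th) else 0.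
pose G2 (j : nat) : R := if (j == j' %[mod n])%N then wt j / Wc j * cos (2 * pi * fr j * X - th) else 0.
have E : \sum_(k < n) cw X k * cos (2 * pi * fr j' * tgrid R n k - th) =
   \sum_(j < J) (G1 j + G2 j) / 2.
  under eq_bigr do rewrite /cw -[_ * _ * cos (_ - th)]mulrA mulr_suml.
  rewrite -mulr_sumr exchange_big mulr_sumr; apply: eq_bigr => j _ /=.
  under eq_bigr => k _.
    rewrite -[_ * _ * cos (_ - th)]mulrA cos_prod.
    rewrite [X in cos X + _](_ : _ = 2 * pi * ((j : int) + (j' : int) - (N.*2 : int))%:~R * tgrid R n k + (- (2 * pi * fr j * X) - th)); last first.
      rewrite rmorphB rmorphD /= -[(j : int)%:~R]/(j%:R) -[(j' : int)%:~R]/(j'%:R) -[(N.*2 : int)%:~R]/(N.*2%:R).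
      by rewrite /fr double_natr; ring.
    rewrite [X in _ + cos X](_ : _ = 2 * pi * ((j : int) - (j' : int))%:~R * tgrid R n k + (- (2 * pi * fr j * X) + th)); last first.
      rewrite rmorphB /= -[(j : int)%:~R]/(j%:R) -[(j' : int)%:~R]/(j'%:R).
      by rewrite /fr; ring.
    over.
  rewrite -mulr_sumr -mulr_suml big_split /= !sum_cos_grid // /G1 /G2 -dvdz_eqmod.
  have -> : cos (- (2 * pi * fr j * X) - th) = cos (2 * pi * fr j * X + th).
    by rewrite -cosN; congr cos; ring.
  have -> : cos (- (2 * pi * fr j * X) + th) = cos (2 * pi * fr j * X - th).
    by rewrite -cosN; congr cos; ring.
  by case: ifP => _; case: ifP => _; field; rewrite ?n0R ?W0.
have E12 : \sum_(j < J) G1 j = \sum_(j < J) G2 j.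
  rewrite (sum_rev G1); apply: eq_bigr => j _; rewrite /G1 /G2 wt_rev Wc_rev fr_rev.
  have jN : (j <= N.*2)%N by have := ltn_ord j; rewrite ltnS.
  rewrite -dvdz_eqmod.
  rewrite -subzn //.
  have -> : ((N.*2 : int) - (j : int) + (j' : int) - (N.*2 : int) = - ((j : int) - (j' : int)))%R by ring.
  rewrite dvdz_oppr; case: ifP => // _; congr (_ * _); rewrite -cosN; congr cos; ring.
rewrite E -mulr_suml big_split /= E12 -mulr2n -[X in X / 2]mulr_natr mulfK //.
by rewrite [RHS]big_mkcond.
Qed.

Lemma cos_class (j j' k : nat) (th : R) : (j == j' %[mod n])%N ->
  cos (2 * pi * fr j * tgrid R n k + th) = cos (2 * pi * fr j' * tgrid R n k + th).
Proof.
move=> jj; have n0R : n%:R != 0 :> R by rewrite pnatr_eq0 -lt0n.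
rewrite -dvdz_eqmod in jj; case/dvdzP: jj => q hq.
have hR : j%:R = j'%:R + q%:~R * n%:R :> R.
  have : ((j : int) - (j' : int))%:~R = (q * n)%:~R :> R by rewrite hq.
  rewrite rmorphB rmorphM /= -[(j : int)%:~R]/(j%:R) -[(j' : int)%:~R]/(j'%:R) -[(n : int)%:~R]/(n%:R).
  by move=> h; lra.
rewrite -[RHS](cosDz _ (q * k.+1)); congr cos.
rewrite rmorphM /= -[(k.+1 : int)%:~R]/(k.+1%:R) /fr hR /tgrid; field.
exact: n0R.
Qed.

Definition ker (X Y : R) : R := \sum_(j < J) wt j * cos (2 * pi * fr j * (X - Y)).

(** By [cw_ker], the covariance between the kriging predictor at X and the value at Y; [ker - cross]
    is the covariance of the residuals. *)
Definition cross (X Y : R) : R :=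
  \sum_(j' < J) wt j' * \sum_(j < J | j == j' %[mod n]) wt j / Wc j *
     cos (2 * pi * fr j * X - 2 * pi * fr j' * Y).

Lemma cw_ker X Y : \sum_(k < n) cw X k * ker (tgrid R n k) Y = cross X Y.
Proof.
under eq_bigr do rewrite /ker mulr_sumr.
rewrite exchange_big; apply: eq_bigr => j' _ /=.
under eq_bigr do rewrite mulrCA mulrBr.
by rewrite -mulr_sumr cw_core.
Qed.

(** At a grid point all frequencies of a class give the same cosine, so the inner sum of weights
    over the class cancels the divisor [Wc]. *)
Lemma cw_solves X (i : nat) :
  \sum_(k < n) cw X k * ker (tgrid R n k) (tgrid R n i) = ker X (tgrid R n i).
Proof.
rewrite cw_ker /cross.
under eq_bigr => j' _.
  under eq_bigr => j jj.
    rewrite -[_ - _]opprB cosN -cosN opprB.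
    rewrite -cosN opprB -[2 * pi * fr j' * _ - _]/(2 * pi * fr j' * tgrid R n i + _).
    rewrite -(cos_class _ _ jj).
    over.
  rewrite mulr_sumr big_mkcond /=; over.
rewrite exchange_big /= /ker; apply: eq_bigr => j _.
rewrite -big_mkcond /=.
rewrite (eq_bigr (fun j' : 'I_J => wt j' * (wt j / Wc j * cos (2 * pi * fr j * (X - tgrid R n i))))); last first.
  by move=> j' _; congr (_ * (_ * _)); rewrite -cosN; congr cos; ring.
rewrite -mulr_suml (eq_bigl (fun j' : 'I_J => (j' == j %[mod n])%N)); last by move=> j'; rewrite eq_sym.
by rewrite -/(Wc j) mulrA mulrCA mulfV // mulr1.
Qed.

End Kriging.

(** * Sign of the residual covariance, one residue class at a time *)

Section GramSign.
Variable R : realType.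

Lemma sin_le (x : R) : 0 <= x -> sin x <= x.
Proof.
move=> x0; have [->|xn0] := eqVneq x 0; first by rewrite sin0.
have xp : 0 < x by rewrite lt_def xn0.
have [z zI] : exists2 z, z \in `]0, x[%R & sin x - sin 0 = cos z * (x - 0).
  apply: MVT => //; by apply: continuous_subspaceT => z; exact: continuous_sin.
rewrite sin0 !subr0 => ->; rewrite -[leRHS]mul1r ler_pM2r //; exact: cos_le1.
Qed.

Lemma sum_class n J r (F : nat -> R) : (r < n)%N ->
  \sum_(j < J | j == r %[mod n]) F j = \sum_(t < (J + n.-1 - r) %/ n) F (r + n * t)%N.
Proof.
move=> rn; have n0 : (0 < n)%N by apply: leq_ltn_trans rn.
elim: J => [|J IH].
  by rewrite big_ord0 add0n divn_small ?big_ord0 //; lia.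
rewrite big_mkcond big_ord_recr /= -big_mkcond /= IH.
have -> : (J.+1 + n.-1 - r = (J + n.-1 - r).+1)%N by lia.
rewrite divnS //.
have E : (n %| (J + n.-1 - r).+1)%N = (J == r %[mod n])%N.
  have -> : ((J + n.-1 - r).+1 = J + n - r)%N by lia.
  by rewrite -eqn_mod_dvd ?modnDr //; lia.
rewrite E; case: eqP => [h|_]; last by rewrite add0n addr0.
rewrite add1n big_ord_recr /=; congr (_ + F _).
have rJ : (r <= J)%N by rewrite -(modn_small rn) -h leq_mod.
have : (J = r + n * (J %/ n))%N.
  by rewrite {1}(divn_eq J n) h modn_small // mulnC addnC.
set q := (J %/ n)%N => Jq; rewrite {1}Jq; congr (_ + _ * _)%N.
have -> : (J + n.-1 - r = q * n + n.-1)%N by rewrite Jq; lia.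
by rewrite divnMDl // [(n.-1 %/ n)%N]divn_small ?addn0 // ltn_predL.
Qed.

Lemma sum_classes n J (F : nat -> R) : (0 < n)%N ->
  \sum_(j < J) F j = \sum_(r < n) \sum_(j < J | j == r %[mod n]) F j.
Proof.
move=> n0; rewrite (exchange_big_dep predT) //=; apply: eq_bigr => j _.
have jn : (j %% n < n)%N by rewrite ltn_mod.
rewrite (bigD1 (Ordinal jn)) /=; last by rewrite modn_mod.
rewrite big1 ?addr0 // => r /andP[/eqP h /eqP h2]; case: h2; apply: val_inj => /=.
by rewrite h modn_small.
Qed.

(* The centered sum of the S exponentials with consecutive frequencies. *)
Definition AS S (y : R) : R := sin (pi * (S%:R * y)) / sin (pi * y).

Lemma ASN S y : AS S (- y) = AS S y.
Proof. by rewrite /AS !mulrN !sinN invrN mulrNN. Qed.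

Variables (n N : nat) (a b : R).
Hypotheses (n0 : (0 < n)%N) (nJ : (n <= N.*2.+1)%N) (a0 : 0 < a) (b0 : 0 < b).
Local Notation J := N.*2.+1.
Local Notation wt := (wt N a b).
Local Notation Wc := (Wc n N a b).
Local Notation fr := (@fr R N).

Definition Sc r : nat := ((J + n.-1 - r) %/ n)%N.
(** The phase of the mean frequency of class r at the point (i + y) / n, reduced modulo 2 pi:
    summing the class factors into [AS (Sc r) y] times the cosine of this phase. *)
Definition om r (i : nat) (y : R) : R :=
  2 * pi * fr r * ((i%:R + y) / n%:R) + (Sc r)%:R * (pi * y) - pi * y.
Definition Dc r (i : nat) (y ph : R) : R :=
  \sum_(j < J | j == r %[mod n]) wt j * cos (2 * pi * fr j * ((i%:R + y) / n%:R) - ph).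

Let n0R : n%:R != 0 :> R. Proof. by rewrite pnatr_eq0 -lt0n. Qed.
Let r0 := (N %% n)%N.

(** Only the class [r0] of N modulo n contains the frequency 0, which has weight a in place of the
    common b / 2. *)
Lemma sum_wt_class r (G : nat -> R) : (r < n)%N ->
  \sum_(j < J | j == r %[mod n]) wt j * G j =
  b / 2 * \sum_(j < J | j == r %[mod n]) G j + (if r == r0 then (a - b / 2) * G N else 0).
Proof.
move=> rn; have NJ : (N < J)%N by rewrite ltnS -addnn leq_addr.
rewrite mulr_sumr; case: eqP => [rr|rr].
  have hN : (N == r %[mod n])%N by rewrite rr modn_mod.
  rewrite (bigD1 (Ordinal NJ)) //= [in RHS](bigD1 (Ordinal NJ)) //= {1}/wt eqxx.
  rewrite (eq_bigr (fun j : 'I_J => b / 2 * G j)); first by ring.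
  by move=> j /andP[_]; rewrite -val_eqE /= /wt => /negPf ->.
rewrite addr0; apply: eq_bigr => j /eqP hj; rewrite /wt; case: eqP => // jN.
by case: rr; rewrite /r0 -jN hj modn_small.
Qed.

Lemma DcE r i y ph : (r < n)%N -> sin (pi * y) != 0 ->
  Dc r i y ph = b / 2 * (AS (Sc r) y * cos (om r i y - ph)) +
    (if r == r0 then (a - b / 2) * cos ph else 0).
Proof.
move=> rn sy; rewrite /Dc (sum_wt_class (fun j => cos (2 * pi * fr j * ((i%:R + y) / n%:R) - ph))) //.
have -> : fr N = 0 by rewrite /fr subrr.
rewrite mulr0 mul0r sub0r cosN; congr (_ * _ + _).
rewrite (sum_class _ (fun j => cos (2 * pi * fr j * ((i%:R + y) / n%:R) - ph))) // -/(Sc r).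
have := sum_cos_AP (Sc r) (2 * pi * fr r * ((i%:R + y) / n%:R) - ph) (2 * pi * y).
rewrite (_ : 2 * pi * y / 2 = pi * y); last by field.
rewrite (_ : (Sc r)%:R * (2 * pi * y) / 2 = pi * ((Sc r)%:R * y)); last by field.
rewrite (_ : _ + _ * (2 * pi * y) / 2 = om r i y - ph); last by rewrite /om; field.
move=> h; rewrite /AS mulrAC -h mulrAC mulfV // mul1r.
apply: eq_bigr => t _; rewrite -[RHS](cosDz _ (t * i)%N); congr cos.
rewrite /fr !natrD !natrM -[((t * i)%N : int)%:~R]/((t * i)%N%:R) natrM; field.
exact: n0R.
Qed.

Lemma WcE r : (r < n)%N ->
  Wc r = b / 2 * (Sc r)%:R + (if r == r0 then a - b / 2 else 0).
Proof.
move=> rn; rewrite /Wc.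
transitivity (\sum_(j < J | j == r %[mod n]) wt j * (fun=> 1) j).
  by apply: eq_bigr => j _; rewrite mulr1.
rewrite (sum_wt_class (fun=> 1)) // (sum_class _ (fun=> 1)) // sumr_const card_ord.
by rewrite mulr1.
Qed.

Lemma Sc_gt0 r : (r < n)%N -> (0 < Sc r)%N.
Proof. by move=> rn; rewrite /Sc divn_gt0 //; lia. Qed.

Lemma Wc_gt0 r : 0 < Wc r.
Proof.
have rn : (r %% n < n)%N by rewrite ltn_mod.
have -> : Wc r = Wc (r %% n) by apply: eq_bigl => j; rewrite modn_mod.
rewrite WcE //; have S1 : 1 <= (Sc (r %% n))%:R :> R by rewrite ler1n Sc_gt0.
have b2 : 0 < b / 2 by rewrite divr_gt0.
case: eqP => [rr|_]; last first.
  by rewrite addr0 mulr_gt0 // (lt_le_trans _ S1).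
by rewrite addrCA ltr_pwDl // subr_ge0 -[leLHS]mulr1 ler_pM2l.
Qed.

Let r0n : (r0 < n)%N. Proof. by rewrite ltn_mod. Qed.

Lemma Sc_r0 : (Sc r0)%:R = 2 * (N %/ n)%:R + 1 :> R.
Proof.
have -> : (Sc r0 = (N %/ n).*2.+1)%N.
  rewrite /Sc /r0; have hN := divn_eq N n; have hm := ltn_pmod N n0.
  set q := (N %/ n)%N in hN *; set r := (N %% n)%N in hN hm *.
  have -> : (J + n.-1 - r = q.*2.+1 * n + r)%N by rewrite hN; lia.
  by rewrite divnMDl // divn_small ?addn0.
by rewrite -addn1 natrD -muln2 natrM mulrC.
Qed.

Lemma cos_om_r0 i y : cos (om r0 i y) = 1.
Proof.
have hN : N%:R = (N %/ n)%:R * n%:R + r0%:R :> R by rewrite -natrM -natrD -divn_eq.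
have -> : om r0 i y = 0 + 2 * pi * (- ((N %/ n * i)%N : int))%:~R.
  rewrite /om Sc_r0 /fr hN rmorphN /= -[((_ * _)%N : int)%:~R]/((_ * _)%N%:R) natrM; field.
  exact: n0R.
by rewrite cosDz cos0.
Qed.

Lemma omB r i y y' : om r i y - om r i y' = om r 0 (y - y').
Proof. by rewrite /om; field. Qed.

Lemma cos_om_r0B i y y' : cos (om r0 i y - om r0 i y') = 1.
Proof. by rewrite omB cos_om_r0. Qed.

Local Notation "'X' i y" := ((i%:R + y) / n%:R) (at level 10, i at level 9, y at level 9).

Lemma ker_classes i y y' :
  ker N a b (X i y) (X i y') = \sum_(r < n) Dc r 0 (y - y') 0.
Proof.
rewrite /ker (sum_classes _ (fun j => wt j * cos (2 * pi * fr j * (X i y - X i y'))) n0).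
apply: eq_bigr => r _; apply: eq_bigr => j _; congr (_ * cos _).
by field; exact: n0R.
Qed.

Lemma cross_classes i y y' :
  cross n N a b (X i y) (X i y') = \sum_(r < n) (Wc r)^-1 *
    \sum_(j' < J | j' == r %[mod n]) wt j' * Dc r i y (2 * pi * fr j' * X i y').
Proof.
rewrite /cross (sum_classes _ (fun j' => wt j' * \sum_(j < J | j == j' %[mod n]) wt j / Wc j *
   cos (2 * pi * fr j * X i y - 2 * pi * fr j' * X i y')) n0).
apply: eq_bigr => r _; rewrite mulr_sumr; apply: eq_bigr => j' /eqP hj'.
rewrite [RHS]mulrCA; congr (_ * _); rewrite /Dc mulr_sumr.
rewrite (eq_bigl (fun j : 'I_J => (j == r %[mod n])%N)); last by move=> j; rewrite hj'.
apply: eq_bigr => j hj; rewrite -(@Wc_mod R n N a b j r) //.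
by ring.
Qed.

Lemma cross_class r i y y' : (r < n)%N -> sin (pi * y) != 0 -> sin (pi * y') != 0 ->
  \sum_(j' < J | j' == r %[mod n]) wt j' * Dc r i y (2 * pi * fr j' * X i y') =
  if r == r0 then (b / 2 * AS (Sc r) y + (a - b / 2)) * (b / 2 * AS (Sc r) y' + (a - b / 2))
  else (b / 2) ^+ 2 * AS (Sc r) y * AS (Sc r) y' * cos (om r 0 (y - y')).
Proof.
move=> rn sy sy'.
set al := b / 2 * AS (Sc r) y; set e := if r == r0 then a - b / 2 else 0.
have -> : \sum_(j' < J | j' == r %[mod n]) wt j' * Dc r i y (2 * pi * fr j' * X i y') =
   al * Dc r i y' (om r i y) + e * Dc r i y' 0.
  rewrite /Dc !mulr_sumr -big_split /=; apply: eq_bigr => j _.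
  rewrite -/(Dc r i y (2 * pi * fr j * X i y')) DcE // subr0 -/al.
  rewrite -[in RHS]cosN opprB /e; case: eqP => _; rewrite /al; ring.
rewrite !DcE // subr0 cos0 /e; case: eqP => [rr|_]; last first.
  rewrite mul0r !addr0 -[in LHS]cosN opprB omB /al; ring.
have c1 : cos (om r i y') = 1 by rewrite rr cos_om_r0.
have c2 : cos (om r i y) = 1 by rewrite rr cos_om_r0.
have c3 : cos (om r i y' - om r i y) = 1 by rewrite rr cos_om_r0B.
by rewrite c1 c2 c3 /al; ring.
Qed.

(** The class is nearly centred: its mean frequency is at most n / 2 in absolute value, so a
    displacement s of at most 1/4 changes the phase by at most pi / 4. *)
Lemma cos_om_ge_half r (s : R) : (r < n)%N -> `|s| <= 4^-1 -> 2^-1 <= cos (om r 0 s).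
Proof.
move=> rn hs; apply: cos_ge_half.
have n0p : 0 < n%:R :> R by rewrite ltr0n.
have -> : om r 0 s = pi * s * ((2 * (r%:R - N%:R) + n%:R * (Sc r)%:R - n%:R) / n%:R).
  by rewrite /om /fr; field.
rewrite normrM normrM ger0_norm ?pi_ge0 //.
have h : `|(2 * (r%:R - N%:R) + n%:R * (Sc r)%:R - n%:R) / n%:R| <= 1 :> R.
  rewrite normrM normfV (ger0_norm (ltW n0p)) ler_pdivrMr // mul1r.
  have h1 := divn_eq (J + n.-1 - r) n; have h2 := ltn_pmod (J + n.-1 - r) n0.
  rewrite -/(Sc r) in h1; set S := Sc r in h1 *; set m := (_ %% n)%N in h1 h2.
  have h3 : (N.*2 + n = S * n + m + r)%N by lia.
  have h4 : 2 * N%:R + n%:R = S%:R * n%:R + m%:R + r%:R :> R.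
    by rewrite -[S%:R * _]natrM -[_ + m%:R]natrD -[_ + r%:R]natrD -h3 natrD -muln2 natrM mulrC.
  have -> : 2 * (r%:R - N%:R) + n%:R * S%:R - n%:R = r%:R - m%:R :> R by lra.
  have m1 := ler0n R m; have r1 := ler0n R r.
  have m2 : m%:R < n%:R :> R by rewrite ltr_nat.
  have r2 : r%:R < n%:R :> R by rewrite ltr_nat.
  by rewrite ler_norml; apply/andP; split; lra.
apply: (@le_trans _ _ (pi * `|s| * 1)).
  by rewrite ler_wpM2l // mulr_ge0 ?pi_ge0.
by rewrite mulr1 ler_wpM2l ?pi_ge0.
Qed.

(** Each class contributes b / 2 * AS (y - y') * cos minus a nonnegative multiple of AS y * AS y' *
    cos. With all three ratios negative and the cosine at least 1/2 this is nonpositive. The class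
    [r0], shifted by a - b / 2, keeps its sign because a <= b / 2 * La; each of the other n - 1
    classes contributes at most - (b / 4 * La). This surplus later absorbs the 4 b of the unmatched
    sine. *)
Lemma gram_le i y y' (La : R) : 0 <= La ->
  sin (pi * y) != 0 -> sin (pi * y') != 0 -> sin (pi * (y - y')) != 0 ->
  (forall r, (r < n)%N -> AS (Sc r) y <= - La) ->
  (forall r, (r < n)%N -> AS (Sc r) y' <= - La) ->
  (forall r, (r < n)%N -> AS (Sc r) (y - y') <= - La) ->
  `|y - y'| <= 4^-1 -> a <= b / 2 * La ->
  ker N a b (X i y) (X i y') - cross n N a b (X i y) (X i y') <= - (n.-1%:R * (b / 4 * La)).
Proof.
move=> La0 sy sy' ss Ay Ay' As hs aL.
rewrite ker_classes cross_classes -sumrB (bigD1 (Ordinal r0n)) //=.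
have b2 : 0 < b / 2 by rewrite divr_gt0.
have bL r z : AS (Sc r) z <= - La -> b / 2 * AS (Sc r) z <= - (b / 2 * La).
  by move=> h; rewrite -mulrN ler_pM2l.
have t0 : Dc r0 0 (y - y') 0 - (Wc r0)^-1 * \sum_(j' < J | j' == r0 %[mod n]) wt j' * Dc r0 i y (2 * pi * fr j' * X i y') <= 0.
  rewrite cross_class // DcE // eqxx subr0 cos_om_r0 cos0 !mulr1.
  have h1 := bL _ _ (Ay _ r0n); have h2 := bL _ _ (Ay' _ r0n); have h3 := bL _ _ (As _ r0n).
  set p := b / 2 * AS _ y in h1 *; set p' := b / 2 * AS _ y' in h2 *.
  set p'' := b / 2 * AS _ (y - y') in h3 *.
  have pp : 0 <= (p + (a - b / 2)) * (p' + (a - b / 2)).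
    by rewrite -mulrNN mulr_ge0 // oppr_ge0; lra.
  have : 0 <= (Wc r0)^-1 * ((p + (a - b / 2)) * (p' + (a - b / 2))).
    by rewrite mulr_ge0 // invr_ge0 ltW // Wc_gt0.
  lra.
have tr : \sum_(r < n | r != Ordinal r0n) (Dc r 0 (y - y') 0 - (Wc r)^-1 *
    \sum_(j' < J | j' == r %[mod n]) wt j' * Dc r i y (2 * pi * fr j' * X i y')) <=
    \sum_(r < n | r != Ordinal r0n) - (b / 4 * La).
  apply: ler_sum => r rr; have rn := ltn_ord r.
  have rr0 : (r == r0 :> nat) = false by apply/negP => h; case/negP: rr; rewrite -val_eqE.
  rewrite cross_class // DcE // rr0 subr0 addr0.
  have c2 := cos_om_ge_half rn hs; set c := cos _ in c2 *.
  have h1 := Ay _ rn; have h2 := Ay' _ rn; have h3 := As _ rn.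
  have pp : 0 <= AS (Sc r) y * AS (Sc r) y'.
    by rewrite -mulrNN mulr_ge0 // oppr_ge0; lra.
  have : 0 <= (Wc r)^-1 * ((b / 2) ^+ 2 * AS (Sc r) y * AS (Sc r) y' * c).
    rewrite mulr_ge0 ?invr_ge0 ?(ltW (Wc_gt0 r)) // mulr_ge0 //; last by lra.
    by rewrite -mulrA mulr_ge0 // sqr_ge0.
  have h4 := bL _ _ h3.
  have : b / 2 * (AS (Sc r) (y - y') * c) <= - (b / 2 * La) / 2.
    rewrite mulrA; apply: (@le_trans _ _ (- (b / 2 * La) * c)).
      by rewrite ler_wpM2r //; lra.
    rewrite !mulNr lerN2 ler_wpM2l // mulr_ge0 // ltW //.
  lra.
apply: le_trans (lerD t0 tr) _; rewrite add0r sumr_const.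
have -> : #|(fun r : 'I_n => r != Ordinal r0n)| = n.-1.
  by have := cardC1 (Ordinal r0n); rewrite card_ord => <-; apply: eq_card.
by rewrite -[leLHS]mulr_natl mulrN.
Qed.

End GramSign.

(** * Equally spaced points where all class ratios are very negative *)

Section GoodPoints.
Variable R : realType.

(* All multiples l * hstep, l <= L, stay slightly below the zero 2 l / S0 of
   sin (pi S0 y), where sin (pi S y) < 0 for both S = S0 and S = S0.+1. *)
Definition hstep (L S0 : nat) : R := (2 - (2 * L%:R)^-1) / S0%:R.
Definition Lam (L S0 : nat) : R := S0%:R / (64 * L%:R).

Lemma hstep_bounds L S0 : (0 < L)%N -> (8 * L <= S0)%N ->
  0 < hstep L S0 /\ L%:R * hstep L S0 <= 4^-1.
Proof.
move=> L0 LS; have S0p : 0 < S0%:R :> R by rewrite ltr0n; lia.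
have L1 : 1 <= L%:R :> R by rewrite ler1n.
have i1 : (2 * L%:R)^-1 <= 2^-1 :> R by rewrite lef_pV2 ?posrE ?mulr_gt0 //; lra.
have i0 : 0 <= (2 * L%:R)^-1 :> R by rewrite invr_ge0; lra.
have LS' : 8 * L%:R <= S0%:R :> R by rewrite -[8 * _]natrM ler_nat.
split; first by rewrite divr_gt0 //; lra.
rewrite /hstep mulrA ler_pdivrMr //.
have : L%:R * (2 - (2 * L%:R)^-1) <= L%:R * 2 :> R by rewrite ler_wpM2l //; lra.
lra.
Qed.

(** With de = 1 / (2 L) one has S0 h = 2 - de, so sin (pi S0 l h) = - sin (pi l de). For S0 + 1 the
    angle l de shrinks by l h, but 8 L <= S0 gives h <= de / 2 and at least half remains. The
    denominator is at most 8 l / S0, from pi <= 4 and h <= 2 / S0, so l cancels and [Lam] is uniform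
    in l. *)
Lemma AS_good L S0 l S : (0 < L)%N -> (8 * L <= S0)%N -> (0 < l <= L)%N ->
  S = S0 \/ S = S0.+1 ->
  0 < sin (pi * (l%:R * hstep L S0)) /\ AS S (l%:R * hstep L S0) <= - Lam L S0.
Proof.
move=> L0 LS /andP[l0 lL] hS; have [h0 hL] := hstep_bounds L0 LS.
have S0p : 0 < S0%:R :> R by rewrite ltr0n; lia.
have L1 : 1 <= L%:R :> R by rewrite ler1n.
have Lp : 0 < L%:R :> R by lra.
have l1 : 1 <= l%:R :> R by rewrite ler1n.
have lLR : l%:R <= L%:R :> R by rewrite ler_nat.
have LS' : 8 * L%:R <= S0%:R :> R by rewrite -[8 * _]natrM ler_nat.
set h := hstep L S0 in h0 hL *.
set de := (2 * L%:R)^-1 : R.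
have hE : S0%:R * h = 2 - de by rewrite /h /hstep mulrC divfK // gt_eqF.
have Lde : L%:R * de = 2^-1 by rewrite /de; field; rewrite gt_eqF.
have de0 : 0 < de by rewrite invr_gt0; lra.
have hde : h <= de / 2.
  rewrite /h /hstep ler_pdivrMr // -/de.
  have : de / 2 * (8 * L%:R) <= de / 2 * S0%:R by rewrite ler_wpM2l //; lra.
  lra.
have lh : l%:R * h <= L%:R * h by rewrite ler_wpM2r // ltW.
have lh0 : 0 < l%:R * h by rewrite mulr_gt0 //; lra.
have sp : 0 < sin (pi * (l%:R * h)).
  have p0 := @pi_gt0 R.
  apply: sin_gt0_pi; rewrite mulr_gt0 //= -[ltRHS]mulr1 ltr_pM2l //; lra.
split=> //.
have su : sin (pi * (l%:R * h)) <= 8 * l%:R / S0%:R.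
  apply: le_trans (sin_le _) _; first by rewrite mulr_ge0 ?pi_ge0 // ltW.
  have p4 : pi <= 4 :> R by have := @pihalf_lt2 R; lra.
  apply: (@le_trans _ _ (4 * (l%:R * h))); first by rewrite ler_wpM2r // ltW.
  have h2 : h <= 2 / S0%:R by rewrite /h /hstep ler_pM2r ?invr_gt0 // -/de; lra.
  have : l%:R * h <= l%:R * (2 / S0%:R) by rewrite ler_wpM2l.
  have -> : 8 * l%:R / S0%:R = 4 * (l%:R * (2 / S0%:R)) :> R by ring.
  lra.
have key t : l%:R * de / 2 <= t <= 2^-1 -> sin (pi * (S%:R * (l%:R * h))) = - sin (pi * t) ->
    AS S (l%:R * h) <= - Lam L S0.
  move=> /andP[t1 t2] E; rewrite /AS E mulNr lerN2 ler_pdivlMr //.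
  have t0 : 0 <= t by apply: le_trans t1; rewrite divr_ge0 // mulr_ge0 //; lra.
  have : t / 2 <= sin (pi * t).
    have := @sinpi_ge R t; rewrite (_ : Num.min t (1 - t) = t); last by apply/min_idPl; lra.
    by apply; rewrite t0; lra.
  apply: le_trans; apply: (@le_trans _ _ (Lam L S0 * (8 * l%:R / S0%:R))).
    by rewrite ler_wpM2l // /Lam divr_ge0 ?(ltW S0p) //; lra.
  have -> : Lam L S0 * (8 * l%:R / S0%:R) = l%:R * de / 2 / 2.
    by rewrite /Lam /de; field; rewrite !gt_eqF.
  lra.
have lde : l%:R * de <= 2^-1 by rewrite -Lde ler_wpM2r // ltW.
have lde0 : 0 < l%:R * de by rewrite mulr_gt0 //; lra.
case: hS => hS; rewrite hS in key *.
  apply: (key (l%:R * de)); first by apply/andP; split; lra.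
  rewrite [S0%:R * _]mulrCA hE.
  have -> : pi * (l%:R * (2 - de)) = - (pi * (l%:R * de)) + 2 * pi * l%:R by ring.
  by rewrite -sinN; exact: (sinDz _ (Posz l)).
have lhd : l%:R * h <= l%:R * (de / 2) by rewrite ler_wpM2l //; lra.
apply: (key (l%:R * de - l%:R * h)); first by apply/andP; split; lra.
rewrite -[S0.+1%:R]natr1 [(S0%:R + 1) * _]mulrDl mul1r [S0%:R * _]mulrCA hE.
have -> : pi * (l%:R * (2 - de) + l%:R * h) = - (pi * (l%:R * de - l%:R * h)) + 2 * pi * l%:R by ring.
by rewrite -sinN; exact: (sinDz _ (Posz l)).
Qed.

Lemma Sc_S0 n N r : (0 < n)%N -> (r < n)%N ->
  Sc n N r = (N.*2.+1 %/ n)%N \/ Sc n N r = (N.*2.+1 %/ n).+1.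
Proof.
move=> n0 rn; rewrite /Sc; set J := N.*2.+1.
have h1 : (J %/ n <= (J + n.-1 - r) %/ n)%N by apply: leq_div2r; lia.
have h2 : ((J + n.-1 - r) %/ n <= (J %/ n).+1)%N.
  have -> : (J %/ n).+1 = ((J + n) %/ n)%N by rewrite divnDr // divnn n0 addn1.
  by apply: leq_div2r; lia.
lia.
Qed.

End GoodPoints.

(** * Kriging weights for the full kernel, including the unmatched sine *)

Section FullKriging.
Variable R : realType.

Lemma ker_sumcos N (a b X Y : R) :
  ker N a b X Y = a + b * \sum_(m < N) cos (m.+1%:R * (2 * pi * (X - Y))).
Proof.
pose F j := wt N a b j * cos (2 * pi * fr R N j * (X - Y)).
have JE : N.*2.+1 = (N + N.+1)%N by rewrite addnS addnn.
rewrite /ker -/F -[LHS](big_mkord predT F) JE (big_mkord predT F) big_split_ord /=.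
rewrite [X in _ + X]big_ord_recl /= addn0.
have -> : F N = a by rewrite /F /wt eqxx /fr subrr mulr0 mul0r cos0 mulr1.
rewrite (reindex_inj rev_ord_inj) /= addrCA -big_split mulr_sumr; congr (_ + _).
apply: eq_bigr => m _; have mN := ltn_ord m; rewrite /F /wt /bump leq0n add1n.
have -> : (N - m.+1 == N)%N = false by lia.
have -> : (N + m.+1 == N)%N = false by lia.
have -> : cos (2 * pi * fr R N (N - m.+1) * (X - Y)) = cos (m.+1%:R * (2 * pi * (X - Y))).
  by rewrite -cosN; congr cos; rewrite /fr natrB //; ring.
have -> : cos (2 * pi * fr R N (N + m.+1) * (X - Y)) = cos (m.+1%:R * (2 * pi * (X - Y))).
  by congr cos; rewrite /fr natrD; ring.
by rewrite /=; field.
Qed.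

Variables (n B' : nat) (g : R).
Let B := B'.+1.
Let N := (B.-1./2)%N.
Let a := wa B g.
Let b := wb B g.
Hypotheses (n0 : (0 < n)%N) (nB : (n.*2.+1 <= B)%N) (g0 : 0 < g)
  (l0 : forall j : 'I_B, 0 < lam B g j).

Let a0 : 0 < a.
Proof. by rewrite /a /wa divr_gt0 // mulr_gt0 // ltr0n. Qed.

Let b0 : 0 < b.
Proof.
have B1 : (1 < B)%N by apply: leq_trans nB; lia.
by have := l0 (Ordinal B1); rewrite /lam.
Qed.

Let nN : (n <= N)%N.
Proof. by rewrite /N -[n]doubleK half_leq // -ltnS prednK. Qed.
Let nJ : (n <= N.*2.+1)%N. Proof. lia. Qed.

Let W0 r : Wc n N a b r != 0.
Proof. by rewrite gt_eqF // Wc_gt0. Qed.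

Definition pt (X : R) : R := -1 + 2 * X.
Let ee : R := (~~ odd B)%:R.
Let sx (x : R) := sin (B./2%:R * pi * x).
Let sg (k : 'I_n) := sx (xtrain R k).

Lemma xtrain_pt (k : 'I_n) : xtrain R k = pt (tgrid R n k).
Proof. by rewrite /xtrain /pt /tgrid mulrA. Qed.

Let kernE X Y : kern B g (pt X) (pt Y) = ker N a b X Y + ee * (b * (sx (pt X) * sx (pt Y))).
Proof.
rewrite kern_split // ker_sumcos; congr (_ + _ * _ + _); apply: eq_bigr => m _; congr cos.
by rewrite /pt; ring.
Qed.

Definition Kmx : 'M[R]_n := \matrix_(i, k) kern B g (xtrain R k) (xtrain R i).

Lemma Kmx_mul (w : 'cV[R]_n) i : (Kmx *m w) i 0 = \sum_k w k 0 * kern B g (xtrain R k) (xtrain R i).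
Proof. by rewrite mxE; apply: eq_bigr => k _; rewrite mxE mulrC. Qed.

Lemma Kmx_ip (w : 'cV[R]_n) :
  ip w (Kmx *m w) = ip ((PhiMat R n B)^T *m w) (lamD B g *m ((PhiMat R n B)^T *m w)).
Proof.
rewrite [RHS]ip_mulmx trmxK; congr ip; apply/colP => i; rewrite Kmx_mul sum_kern_phi.
rewrite ipC ip_mulmx /lamD tr_diag_mx -/(lamD B g) [RHS]mxE.
by apply: eq_bigr => j _; rewrite mxE; congr (_ * _); rewrite mxE.
Qed.

Lemma Kmx_unit : Kmx \in unitmx.
Proof.
apply: unitmx_inj => w hw; have := Kmx_ip w; rewrite hw ip0r => h.
have h1 := tail_lamD ((PhiMat R n B)^T *m w) (ltW g0); rewrite -h in h1.
have h2 := tail_ge_parseval w n0 nB.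
apply: ip_eq0; apply/eqP; rewrite eq_le ip_ge0 andbT -(@pmulr_rle0 _ n%:R) ?ltr0n //.
by apply: le_trans h2 _; rewrite -(pmulr_rle0 _ b0).
Qed.

Let sw : 'cV[R]_n := invmx Kmx *m (\col_k (b * sg k)).
Let swE : Kmx *m sw = \col_k (b * sg k). Proof. by rewrite mulKVmx // Kmx_unit. Qed.
Let q := \sum_k sg k * sw k 0.

(** q is the coefficient of [sw] on the last feature. The energy of [sw] equals b q and contains the
    nonnegative contribution b q^2 of that feature, whence q^2 <= q. *)
Let q_bounds : ee = 1 -> 0 <= q <= 1.
Proof.
move=> e1; have oB : ~~ odd B by move: e1; rewrite /ee; case: (odd B) => // /eqP; rewrite eq_sym oner_eq0.
have E := Kmx_ip sw; rewrite swE in E.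
have bq : ip sw (\col_k (b * sg k)) = b * q.
  by rewrite /q mulr_sumr; apply: eq_bigr => k _; rewrite [X in _ * X]mxE; ring.
rewrite bq in E; set ps := (PhiMat R n B)^T *m sw in E.
have q0 : 0 <= q.
  by rewrite -(pmulr_rge0 _ b0) E ip_lamD; apply: sumr_ge0 => j _; rewrite mulr_ge0 ?(ltW (l0 j)) // -expr2 sqr_ge0.
have psl : ps ord_max 0 = q.
  rewrite PhiT_mulE /q; apply: eq_bigr => k _; rewrite mulrC; congr (_ * _).
  (* For even B the last index B' is odd and carries the sine of frequency B / 2. *)
  have -> : nat_of_ord (@ord_max B') = (B./2).-1.*2.+1.
    by rewrite /B /= in oB *; lia.
  by rewrite fourier_sin /sg /sx prednK //; move: nB; rewrite /B; lia.
have : b * q ^+ 2 <= b * q.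
  rewrite E ip_lamD (bigD1 ord_max) //= psl ler_wpDr //.
    by apply: sumr_ge0 => j _; rewrite mulr_ge0 ?(ltW (l0 j)) // -expr2 sqr_ge0.
  rewrite /lam ifF -/(wb B g) -/b ?expr2 //.
  by apply/negbTE; move: nB; rewrite /B /=; lia.
rewrite ler_pM2l // expr2 => h; rewrite q0 /= leNgt; apply/negP => h1.
have : q * 1 < q * q by rewrite ltr_pM2l //; lra.
lra.
Qed.

Let P X := \sum_(k < n) cw n N a b X k * sg k.
Let w_ X := ee * (sx (pt X) - P X).

(** By [cw_core], P X is a combination of cosines with weights wt / Wc over one residue class; these
    are nonnegative and sum to 1, so |P X| <= 1. The index [j'] encodes the frequency B / 2, and
    [th] the phase that turns the sine into a cosine on the unit grid. *)
Let w_bound X : `|w_ X| <= 2.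
Proof.
rewrite /w_ normrM; apply: (@le_trans _ _ (1 * `|sx (pt X) - P X|)).
  by rewrite ler_wpM2r // /ee; case: (odd B); rewrite /= ?normr0 ?normr1.
rewrite mul1r; apply: le_trans (ler_normB _ _) _.
have h1 : `|sx (pt X)| <= 1 by exact: sin_max.
have h2 : `|P X| <= 1; last by lra.
pose j' := (N + B./2)%N; pose th : R := B./2%:R * pi + pi / 2.
have -> : P X = \sum_(k < n) cw n N a b X k * cos (2 * pi * fr R N j' * tgrid R n k - th).
  apply: eq_bigr => k _; congr (_ * _); rewrite /sg /sx -cosBpihalf xtrain_pt; congr cos.
  by rewrite /pt /fr /j' /th natrD; ring.
rewrite cw_core ?(ltW a0) //.
apply: le_trans (ler_norm_sum _ _ _) _.
apply: (@le_trans _ _ (\sum_(j < N.*2.+1 | j == j' %[mod n]) wt N a b j / Wc n N a b j')).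
  apply: ler_sum => j hj; rewrite (@Wc_mod R n N a b j j') // normrM -[leRHS]mulr1.
  rewrite ger0_norm; last by rewrite divr_ge0 ?(wt_ge0 N (ltW a0) b0) // ltW // Wc_gt0.
  by rewrite ler_wpM2l ?cos_max // divr_ge0 ?(wt_ge0 N (ltW a0) b0) // ltW // Wc_gt0.
by rewrite -mulr_suml -/(Wc n N a b j') mulfV.
Qed.

(* For even B the last feature is a sine without its cosine partner, which
   perturbs the kernel by a rank-one term; w_ X * sw corrects the weights cw. *)
Definition cfull X : 'cV[R]_n := \col_k (cw n N a b X k + w_ X * sw k 0).

Lemma cfull_solves X (i : 'I_n) :
  \sum_k cfull X k 0 * kern B g (xtrain R k) (xtrain R i) = kern B g (pt X) (xtrain R i).
Proof.
under eq_bigr do rewrite mxE mulrDl -mulrA.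
rewrite big_split /= -mulr_sumr -Kmx_mul swE mxE.
under eq_bigr do rewrite !xtrain_pt kernE mulrDr.
rewrite big_split /= cw_solves ?(ltW a0) // xtrain_pt kernE -addrA; congr (_ + _).
rewrite (eq_bigr (fun k : 'I_n => cw n N a b X k * sg k * (ee * (b * sg i)))); last first.
  by move=> k _; rewrite /sg !xtrain_pt; ring.
by rewrite -mulr_suml -/(P X) /w_ /sg xtrain_pt; ring.
Qed.

(** For even [B] the unmatched sine changes the residual covariance exactly by b * w_ X * w_ Y * (1
    - q); the bounds 2 on [w_] and 0 <= q <= 1 keep this below 4 b. *)
Lemma cfull_gram X Y :
  kern B g (pt X) (pt Y) - \sum_k cfull X k 0 * kern B g (xtrain R k) (pt Y) <=
  ker N a b X Y - cross n N a b X Y + 4 * b.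
Proof.
have swY : \sum_k sw k 0 * kern B g (xtrain R k) (pt Y) = b * (P Y + w_ Y * q).
  transitivity (\sum_k sw k 0 * \sum_l cfull Y l 0 * kern B g (xtrain R l) (xtrain R k)).
    by apply: eq_bigr => k _; rewrite cfull_solves kernC.
  under eq_bigr do rewrite mulr_sumr.
  rewrite exchange_big /=.
  transitivity (\sum_l cfull Y l 0 * (b * sg l)).
    apply: eq_bigr => l _; have := Kmx_mul sw l; rewrite swE mxE => ->.
    by rewrite mulr_sumr; apply: eq_bigr => k _; rewrite [kern _ _ (xtrain R l) _]kernC; ring.
  rewrite mulrDr /P /q !mulr_sumr -big_split; apply: eq_bigr => l _ /=.
  by rewrite mxE; ring.
have -> : \sum_k cfull X k 0 * kern B g (xtrain R k) (pt Y) =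
   cross n N a b X Y + ee * b * sx (pt Y) * P X + w_ X * (b * (P Y + w_ Y * q)).
  under eq_bigr do rewrite mxE mulrDl -mulrA.
  rewrite big_split /= -mulr_sumr swY; congr (_ + _).
  under eq_bigr do rewrite xtrain_pt kernE mulrDr.
  rewrite big_split /= cw_ker ?(ltW a0) //; congr (_ + _).
  by rewrite /P mulr_sumr; apply: eq_bigr => k _; rewrite /sg xtrain_pt; ring.
rewrite kernE.
have h : ee * (b * (sx (pt X) * sx (pt Y))) - ee * b * sx (pt Y) * P X - w_ X * (b * (P Y + w_ Y * q)) <= 4 * b.
  have [e1|e0] : ee = 1 \/ ee = 0 by rewrite /ee; case: (odd B); [right|left].
    have -> : ee * (b * (sx (pt X) * sx (pt Y))) - ee * b * sx (pt Y) * P X - w_ X * (b * (P Y + w_ Y * q))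
      = b * ((w_ X * w_ Y) * (1 - q)) by rewrite /w_ e1; ring.
    rewrite mulrC ler_pM2r //; have /andP[q0 q1] := q_bounds e1.
    have h1 : `|w_ X * w_ Y * (1 - q)| <= 2 * 2 * 1.
      have h0 : `|1 - q| <= 1 by rewrite ler_norml; apply/andP; split; lra.
      rewrite normrM; apply: ler_pM => //; rewrite normrM.
      by apply: ler_pM => //; apply: w_bound.
    by apply: le_trans (ler_norm _) _; lra.
  have -> : w_ X = 0 by rewrite /w_ e0 mul0r.
  by rewrite e0 !mul0r subr0 subr0 mulr_ge0 // ltW.
lra.
Qed.

(** Duality: [fhat] at a point is the kriging weights of that point applied to the labels, and all
    labels are 1. *)
Lemma sum_cfull X : 0 < a + b * (Mof n B)%:R -> \sum_k cfull X k 0 = fhat n B g (pt X).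
Proof.
move=> k0; have n0R : n%:R != 0 :> R by rewrite pnatr_eq0 -lt0n.
set ka := a + _ in k0.
have hw0 (i : 'I_n) : \sum_(k < n) (const_mx (n%:R * ka)^-1 : 'cV[R]_n) k 0 * kern B g (xtrain R k) (xtrain R i) = 1.
  under eq_bigr do rewrite mxE.
  rewrite -mulr_sumr sum_kern_train // ybar_train // dirich_int -/a -/b -/ka.
  by rewrite mulVf // mulf_neq0 // gt_eqF.
rewrite (fhat_kern l0 hw0); under eq_bigr => k _.
  rewrite -[cfull _ _ _]mulr1 -(hw0 k) mulr_sumr; over.
rewrite exchange_big /=; apply: eq_bigr => i _.
rewrite kernC -cfull_solves mulr_sumr; apply: eq_bigr => k _.
by rewrite [kern _ _ (xtrain R i) _]kernC; ring.
Qed.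

End FullKriging.

(** * Probability that [ghat] is positive throughout one gap *)

Section GapProb.
Variable R : realType.

Definition whiten B g : 'M[R]_B := diag_mx (\row_j Num.sqrt (lam B g j)).
Definition unwhiten d B g (G : 'M[R]_(d, B)) : 'M[R]_(d, B) := G *m whiten B g.

Lemma whiten_sqr B g : (forall j : 'I_B, 0 < lam B g j) -> whiten B g *m whiten B g = lamD B g.
Proof.
move=> l0; rewrite /whiten /lamD mulmx_diag; congr diag_mx; apply/rowP => j.
by rewrite !mxE -expr2 sqr_sqrtr // ltW.
Qed.

Lemma tr_whiten B g : (whiten B g)^T = whiten B g.
Proof. exact: tr_diag_mx. Qed.

Lemma dirichDn M (y : R) i : dirich M (i%:R + y) = dirich M y.
Proof.
apply: eq_bigr => t _; rewrite -[RHS](cosDn _ (t.+1 * i)); congr (cos _).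
by rewrite natrM; ring.
Qed.

(** The Dirichlet sum in [fhat] comes from the residue class that contains the frequency 0. *)
Lemma AS_dirich n N (y : R) : (0 < n)%N -> (n <= N)%N -> sin (pi * y) != 0 ->
  2 * dirich (N %/ n) y + 1 = AS (Sc n N (N %% n)) y.
Proof.
move=> n0 nN s0; have nJ : (n <= N.*2.+1)%N by lia.
rewrite /AS (Sc_r0 n0 nJ ltr01 ltr01); apply: (mulfI s0); rewrite dirich_sin [RHS]mulrCA mulfV // mulr1.
by congr (sin (_ * (_ * _))); rewrite -[_.*2.+1%:R]natr1 -muln2 natrM mulrC.
Qed.

Section Gap.
Variables (n B' : nat) (g : R) (L i : nat).
Let B := B'.+1.
Let N := (B.-1)./2.
Let S0 := (N.*2.+1 %/ n)%N.
Let a := wa B g.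
Let b := wb B g.
Hypotheses (n0 : (0 < n)%N) (nB : (n.*2.+1 <= B)%N) (g0 : 0 < g)
  (l0 : forall j : 'I_B, 0 < lam B g j) (L0 : (0 < L)%N) (LS : (8 * L <= S0)%N)
  (aL : a <= b / 2 * Lam R L S0).
Let h := hstep R L S0.

Definition gappt (l : nat) : R := (i%:R + l%:R * h) / n%:R.

Let a0 : 0 < a.
Proof. by rewrite /a /wa divr_gt0 // mulr_gt0 // ltr0n. Qed.

Let b0 : 0 < b.
Proof.
have B1 : (1 < B)%N by apply: leq_trans nB; lia.
by have := l0 (Ordinal B1); rewrite /lam.
Qed.

Let nN : (n <= N)%N.
Proof. by rewrite /N -[n]doubleK half_leq // -ltnS prednK. Qed.
Let nJ : (n <= N.*2.+1)%N. Proof. lia. Qed.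
Let k0 : 0 < a + b * (Mof n B)%:R. Proof. by rewrite ltr_wpDr // mulr_ge0 // ltW. Qed.
Let La0 : 0 <= Lam R L S0. Proof. by rewrite divr_ge0 // mulr_ge0. Qed.

Let good l : (0 < l <= L)%N -> sin (pi * (l%:R * h)) != 0 /\
  forall r, (r < n)%N -> AS (Sc n N r) (l%:R * h) <= - Lam R L S0.
Proof.
move=> lL; have G := AS_good R L0 LS lL.
split; first by have [s _] := G S0 (or_introl erefl); rewrite gt_eqF.
by move=> r rn; have [_ H] := G _ (Sc_S0 N n0 rn).
Qed.

(** At such a point 2 D + 1 <= - Lam, so the numerator a + b D is at most a - b / 2 * (1 + Lam),
    which is negative by the bound on a. *)
Lemma fhat_gappt_le0 l : (0 < l <= L)%N -> fhat n B g (pt (gappt l)) <= 0.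
Proof.
move=> lL; have [s0 hA] := good lL.
have n0R : n%:R != 0 :> R by rewrite pnatr_eq0 -lt0n.
rewrite fhatE // pmulr_lle0 ?invr_gt0 //.
have -> : ybar n (pt (gappt l)) = i%:R + l%:R * h by rewrite /ybar /pt /gappt; field.
rewrite dirichDn; have := hA (N %% n)%N (ltn_pmod _ n0); rewrite -AS_dirich // => hD.
have := ler_wpM2l (ltW b0) hD; rewrite -/a -/b -/(Mof n B) -/(Mof n B) => h2.
have : 0 < b := b0; have := aL; rewrite /Mof -/N; lra.
Qed.

Hypothesis nL : 16 <= n.-1%:R * Lam R L S0.

Let A : 'M[R]_(n, B) := PhiMat R n B *m whiten B g.
Let v x : 'cV[R]_B := whiten B g *m phi B x.
Let c l := cfull n B' g (gappt l).
Let u l := v (pt (gappt l)) - A^T *m c l.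

Let ip_v x y : ip (v x) (v y) = kern B g x y.
Proof. by rewrite ip_mulmx tr_whiten mulmxA whiten_sqr // kern_phi. Qed.

Let A_v x (k : 'I_n) : (A *m v x) k 0 = kern B g (xtrain R k) x.
Proof.
rewrite -ip_v /ip mxE; apply: eq_bigr => j _; congr (_ * _); rewrite /A /v !mxE.
by apply: eq_bigr => m _; rewrite !mxE mulrC; case: eqP => [->|/eqP]; rewrite ?eqxx // eq_sym => /negPf ->; rewrite !mulr0n.
Qed.

Let ip_v_AT x (w : 'cV[R]_n) : ip (v x) (A^T *m w) = \sum_k w k 0 * kern B g (xtrain R k) x.
Proof. by rewrite ip_mulmxr trmxK /ip; apply: eq_bigr => k _; rewrite A_v mulrC. Qed.

Let Au l : A *m u l = 0.
Proof.
apply/colP => k; rewrite mulmxBr mxE A_v mxE [X in _ = X]mxE; apply/eqP; rewrite subr_eq0; apply/eqP.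
rewrite kernC -(cfull_solves n0 nB g0 l0) -[RHS]mulr1.
have -> : (A *m (A^T *m c l)) k 0 = ip (v (xtrain R k)) (A^T *m c l).
  rewrite /ip mxE; apply: eq_bigr => j _; congr (_ * _); rewrite /A /v !mxE.
  by apply: eq_bigr => m _; rewrite !mxE mulrC; case: eqP => [->|/eqP]; rewrite ?eqxx // eq_sym => /negPf ->; rewrite !mulr0n.
by rewrite ip_v_AT mulr1.
Qed.

Let ip_u l m : (0 < l <= L)%N -> (0 < m <= L)%N -> l != m -> ip (u l) (u m) <= 0.
Proof.
move=> lL mL lm; have [sl Al] := good lL; have [sm Am] := good mL.
rewrite {1}/u ipBl ip_mulmx trmxK Au ip0r subr0 /u ipBr ip_v ip_v_AT kernC.
apply: le_trans (cfull_gram n0 nB g0 l0 _ _) _.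
have [h0 hL] := hstep_bounds R L0 LS.
(* Equal spacing pays off here: up to sign, the difference of two of the points is again a multiple
   k h with 0 < k <= L, so all three ratios in [gram_le] are negative. *)
pose k := (maxn l m - minn l m)%N.
have kL : (0 < k <= L)%N by rewrite /k; move: lL mL lm; clear; lia.
have [sk Ak] := good kL.
have hk : m%:R * h - l%:R * h = k%:R * h \/ m%:R * h - l%:R * h = - (k%:R * h).
  have [ml|ml] := leqP l m.
    by left; rewrite /k (maxn_idPr ml) (minn_idPl ml) natrB // mulrBl.
  by right; rewrite /k (maxn_idPl (ltnW ml)) (minn_idPr (ltnW ml)) natrB ?(ltnW ml) // mulrBl opprB.
have skm : sin (pi * (m%:R * h - l%:R * h)) != 0.
  by case: hk => ->; rewrite ?mulrN ?sinN ?oppr_eq0.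
have Akm r : (r < n)%N -> AS (Sc n N r) (m%:R * h - l%:R * h) <= - Lam R L S0.
  by move=> rn; case: hk => ->; rewrite ?ASN; apply: Ak.
have akm : `|m%:R * h - l%:R * h| <= 4^-1.
  have -> : `|m%:R * h - l%:R * h| = k%:R * h.
    by case: hk => ->; rewrite ?normrN ger0_norm // mulr_ge0 // ltW.
  by apply: le_trans hL; rewrite ler_wpM2r ?(ltW h0) // ler_nat; case/andP: kL.
have := gram_le n0 nJ a0 b0 i La0 sm sl skm Am Al Akm akm aL.
rewrite -/N -/a -/b => G; have := ler_wpM2l (ltW b0) nL.
rewrite -!/(gappt _) in G; rewrite -/(gappt l) -/(gappt m) in G; lra.
Qed.

Variables (d : nat) (nu : probability (MT R d B) R).
Hypothesis stdnu : stdmx nu.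

Lemma gap_prob : exists E : set (MT R d B), [/\ measurable E, (nu E <= ((2 ^+ L)^-1)%:E)%E &
  forall G : MT R d B, (forall l, (0 < l <= L)%N -> 0 < ghat n (unwhiten g G) (pt (gappt l))) -> E G].
Proof.
have Au' l : (l < L)%N -> A *m u l.+1 = 0 by move=> _; exact: Au.
have iu l m : (l < L)%N -> (m < L)%N -> l != m -> ip (u l.+1) (u m.+1) <= 0.
  by move=> lL mL lm; apply: ip_u.
have [E [mE nE hE]] := gap_event stdnu Au' iu; exists E; split => // G pos.
set Z := unwhiten g G; have PsiE : PsiMat n Z = A *m (G : 'M[R]_(d, B))^T.
  by rewrite PsiMatE /Z /unwhiten trmx_mul tr_whiten mulmxA.
have gE x : ghat n Z x = ip (beta_hat n Z) ((G : 'M[R]_(d, B)) *m v x).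
  by rewrite ghatE /Z /unwhiten mulmxA.
(* Without a feasible vector [beta_hat] is 0 and [ghat] vanishes, contradicting positivity at l =
   1. *)
have [v0 hv0] : exists v : 'cV[R]_d, PsiMat n Z *m v = const_mx 1.
  apply: contrapT => nex; have := pos 1%N; rewrite gE /beta_hat min_norm_infeasible // ip0l ltxx.
  by rewrite L0 => /(_ isT).
have [w hw] := gram_solve hv0; have bE := min_enormE hw.
rewrite -/(beta_hat n Z) in bE; rewrite PsiE in hw bE.
apply: (hE G w hw) => l lL; rewrite -bE.
have := pos l.+1 lL; rewrite gE => p1.
have -> : ip (beta_hat n Z) ((G : 'M[R]_(d, B)) *m u l.+1) =
  ip (beta_hat n Z) ((G : 'M[R]_(d, B)) *m v (pt (gappt l.+1))) - fhat n B g (pt (gappt l.+1)).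
  rewrite mulmxBr ipBr; congr (_ - _).
  have -> : (G : 'M[R]_(d, B)) *m (A^T *m c l.+1) = (A *m (G : 'M[R]_(d, B))^T)^T *m c l.+1.
    by rewrite [(A *m _)^T]trmx_mul trmxK mulmxA.
  rewrite bE ip_mulmxr trmxK mulmxA hw -(sum_cfull n0 nB g0 l0) //.
  by apply: eq_bigr => k _; rewrite mxE mul1r.
by have := @fhat_gappt_le0 l.+1 lL; lra.
Qed.

End Gap.
End GapProb.

(** * Lower bound on the adversarial risk from bad points near grid points *)

Section AdvRisk.
Variable R : realType.
Let mu := @lebesgue_measure R.
Implicit Types (f : R -> R) (S : set R).

(* Defs evaluates lebesgue_measure on sets that need not be measurable; it is
   an outer measure there, hence still monotone. *)
Lemma le_leb S S' : S `<=` S' -> (mu S <= mu S')%E.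
Proof. by move=> SS; exact: (le_outer_measure (mu_ext (wlength (idfun : R -> R)))). Qed.

Let mu11 : mu [set x | -1 <= x <= 1] = 2%:E.
Proof.
have -> : [set x : R | -1 <= x <= 1] = `[-1, 1]%classic by apply/seteqP; split => x; rewrite /= in_itv.
by rewrite /mu lebesgue_measure_itv /= lte_fin ifT ?EFinN -?EFinD; [congr EFin; ring|lra].
Qed.

Let mu_fin S : S `<=` [set x | -1 <= x <= 1] -> mu S \is a fin_num.
Proof.
move=> h; rewrite ge0_fin_numE //; apply: le_lt_trans (le_leb h) _.
by rewrite mu11 ltry.
Qed.

Let sub11 (P : R -> Prop) : [set x : R | -1 <= x <= 1 /\ P x] `<=` [set x | -1 <= x <= 1].
Proof. by move=> x []. Qed.

Lemma adv_risk_le1 f eps : adv_risk f eps <= 1.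
Proof.
rewrite /adv_risk ler_pdivrMr // mul1r -lee_fin fineK; last by apply: mu_fin; exact: sub11.
by rewrite -mu11; apply: le_leb; exact: sub11.
Qed.

Lemma sg_neq1 (x : R) : (Num.sg x != 1) = (x <= 0).
Proof. by rewrite sgr_cp0 leNgt. Qed.

(** A bad point just to the right of a grid point makes a whole window around that grid point
    vulnerable. The windows of two consecutive such grid points leave only a share t of the cell
    between them uncovered. *)
Lemma adv_risk_ge f n (t : R) (good : nat -> bool) : (0 < n)%N -> 0 <= t <= 2^-1 ->
  (forall i, (i < n)%N -> ~~ good i ->
     exists y : R, 0 <= y <= t /\ f (pt ((i%:R + y) / n%:R)) <= 0) ->
  1 - (\sum_(i < n) (good i)%:R) / n%:R - (2 * n%:R)^-1 - t <= adv_risk f n%:R^-1.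
Proof.
move=> n0 /andP[t0 t1] bad; have n0R : 0 < n%:R :> R by rewrite ltr0n.
pose ctr (i : nat) : R := -1 + 2 * i%:R / n%:R.
(* The points within 1 / n of ctr i + 2 y / n for every y in [0, t], so the window does not depend
   on the unknown y. *)
pose W (i : nat) := `[ctr i - n%:R^-1 + 2 * t / n%:R, ctr i + n%:R^-1]%classic : set R.
pose U := \bigcup_(i in [set i : nat | (i < n)%N && ~~ good i]) W i.
have mU : measurable U by apply: bigcup_measurable => i _; exact: measurable_itv.
pose I11 := [set x : R | -1 <= x <= 1].
have mI : measurable I11.
  have -> : I11 = `[-1, 1]%classic by apply/seteqP; split => x; rewrite /= in_itv.
  exact: measurable_itv.
pose S := [set x : R | -1 <= x <= 1 /\ exists xt : R, `|xt - x| <= n%:R^-1 /\ Num.sg (f xt) != 1].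
have US : I11 `&` U `<=` S.
  move=> x [x1 [i /andP[ilt ib]]]; rewrite /W /= in_itv /= => /andP[h1 h2]; split => //.
  have [y [/andP[y0 yt] fy]] := bad i ilt ib.
  exists (pt ((i%:R + y) / n%:R)); rewrite sg_neq1; split => //.
  have yn : 0 <= y / n%:R <= t / n%:R by rewrite divr_ge0 ?(ltW n0R) // ler_pM2r ?invr_gt0.
  have e1 : pt ((i%:R + y) / n%:R) = ctr i + 2 * (y / n%:R) by rewrite /pt /ctr; ring.
  have tn : t / n%:R <= 2^-1 * n%:R^-1 by rewrite ler_pM2r ?invr_gt0.
  by rewrite ler_norml e1; apply/andP; split; lra.
(* No bad point is assumed at index n, so the last half cell counts as uncovered; this is the term 1
   / (2 n). *)
pose g' c : R := if (c < n)%N then (good c)%:R else 1.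
have g'01 c : 0 <= g' c <= 1 by rewrite /g'; case: ifP => _; [case: (good c)|]; rewrite ?lexx ?ler01.
have main : fine (mu (I11 `\` U)) <= 2 / n%:R * \sum_(c < n) (g' c / 2 + g' c.+1 / 2 + t).
  apply: (@measure_cells _ _ n (fun c => g' c / 2 + g' c.+1 / 2 + t)) => //; first exact: measurableD.
    by move=> x [].
  move=> c cn; exists ((1 - g' c) / 2), (1 - (1 - g' c.+1) * (2^-1 - t)), 0, 0.
  have := g'01 c; have := g'01 c.+1 => /andP[gb1 gb2] /andP[ga1 ga2].
  have ht : 0 <= (1 - g' c.+1) * (2^-1 - t) <= 2^-1 - t.
    by rewrite mulr_ge0 ?subr_ge0 //= -[leRHS]mul1r ler_wpM2r //; lra.
  split => //; [lra| |].
    have : g' c.+1 * t <= t by rewrite -[leRHS]mul1r ler_wpM2r.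
    have : 0 <= g' c.+1 * t by rewrite mulr_ge0.
    lra.
  move=> v /andP[v0 v1] [_ nU]; left; apply/andP; split.
    rewrite /g' cn; case gc: (good c); rewrite ?subrr ?mul0r //= subr0 mul1r leNgt; apply/negP => hv.
    apply: nU; exists c; first by rewrite /= cn gc.
    rewrite /W /= in_itv /= /ctr.
    have e1 : -1 + 2 * (c%:R + v) / n%:R = -1 + 2 * c%:R / n%:R + 2 * v / n%:R by ring.
    have vn : 0 <= v / n%:R <= 2^-1 / n%:R by rewrite divr_ge0 ?(ltW n0R) // ler_pM2r ?invr_gt0 // ltW.
    have tn : t / n%:R <= 2^-1 / n%:R by rewrite ler_pM2r ?invr_gt0.
    by rewrite e1; apply/andP; split; lra.
  rewrite /g'; case: ifP => cn1; last by lra.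
  case gc: (good c.+1); rewrite /= ?subrr ?mul0r ?subr0 // mul1r leNgt; apply/negP => hv.
  apply: nU; exists c.+1; first by rewrite /= cn1 gc.
  rewrite /W /= in_itv /= /ctr -[c.+1%:R]natr1.
  have e1 : -1 + 2 * (c%:R + v) / n%:R = -1 + 2 * (c%:R + 1) / n%:R - 2 * ((1 - v) / n%:R) by ring.
  have vn : 0 <= (1 - v) / n%:R <= (2^-1 - t) / n%:R.
    rewrite divr_ge0 ?(ltW n0R) ?subr_ge0 // ler_pM2r ?invr_gt0 //; lra.
  have : 0 < n%:R^-1 :> R by rewrite invr_gt0.
  by rewrite e1 => ?; apply/andP; split; lra.
have sumE : \sum_(c < n) (g' c / 2 + g' c.+1 / 2 + t) <= \sum_(i < n) (good i)%:R + 2^-1 + n%:R * t.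
  rewrite !big_split /= sumr_const card_ord -[t *+ n]mulr_natl lerD2r // -!mulr_suml.
  have -> : \sum_(i < n) g' i = \sum_(i < n) (good i)%:R :> R.
    by apply: eq_bigr => i _; rewrite /g' ltn_ord.
  have h : \sum_(i < n) g' i.+1 <= \sum_(i < n) (good i)%:R + 1.
    have : g' 0%N + \sum_(i < n) g' i.+1 = \sum_(i < n) g' i + g' n.
      have := @big_ord_recl R 0 +%R n (fun i => g' i); rewrite /bump /= => <-.
      by rewrite big_ord_recr.
    have -> : \sum_(i < n) g' i = \sum_(i < n) (good i)%:R :> R.
      by apply: eq_bigr => i _; rewrite /g' ltn_ord.
    have /andP[? ?] := g'01 0%N; have /andP[? ?] := g'01 n; lra.
  lra.
have fI : fine (mu I11) = 2 by rewrite mu11.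
have fU : fine (mu I11) = fine (mu (I11 `\` U)) + fine (mu (I11 `&` U)).
  rewrite -fineD; [|apply: mu_fin; exact: subDsetl|apply: mu_fin; exact: subIsetl].
  by rewrite -measureDI.
have UleS : fine (mu (I11 `&` U)) <= fine (mu S).
  by rewrite fine_le ?mu_fin ?le_leb // => x [].
rewrite /adv_risk -/S ler_pdivlMr //.
have : 2 / n%:R * \sum_(c < n) (g' c / 2 + g' c.+1 / 2 + t) <=
       2 / n%:R * (\sum_(i < n) (good i)%:R + 2^-1 + n%:R * t) by rewrite ler_wpM2l // divr_ge0 // ltW.
have -> : 2 / n%:R * (\sum_(i < n) (good i)%:R + 2^-1 + n%:R * t) =
  2 * ((\sum_(i < n) (good i)%:R) / n%:R + (2 * n%:R)^-1 + t) :> R.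
  by field; rewrite gt_eqF.
lra.
Qed.

End AdvRisk.

(** * Markov's inequality, outer convergence in probability, and whitening *)

Section ProbTools.
Variable R : realType.
Local Notation T := (measurableTypeR R).

Lemma markov_ge0 dd (X : measurableType dd) (m : {measure set X -> \bar R}) (f : X -> \bar R) (c : R) :
  measurable_fun setT f -> (forall x, (0 <= f x)%E) -> 0 < c ->
  (c%:E * m [set x | (c%:E <= f x)%E] <= \int[m]_x f x)%E.
Proof.
move=> mf f0 c0.
have := @le_integral_comp_abse _ _ _ m _ measurableT f c idfun (@measurable_id _ _ setT)
  (fun r h => h) (fun x y _ _ h => h) mf c0.
rewrite setTI => /le_trans; have -> : [set x | (`|f x| >= c%:E)%E] = [set x | (c%:E <= f x)%E].
  by apply/seteqP; split => x /=; rewrite gee0_abs.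
by apply; rewrite le_eqVlt; apply/orP; left; apply/eqP; apply: eq_integral => x _; rewrite gee0_abs.
Qed.

(** [good] is an arbitrary predicate chosen for each outcome; only the measurable events E i are
    integrated, and their count dominates that of [good]. *)
Lemma markov_count dd (X : measurableType dd) (P : probability X R) (E : nat -> set X) n (e c : R) :
  (forall i, measurable (E i)) -> (forall i, (P (E i) <= e%:E)%E) -> 0 < c ->
  exists F : set X, [/\ measurable F, (P F <= (n%:R * e / c)%:E)%E &
    forall (w : X) (good : nat -> bool), (forall i, good i -> E i w) ->
      c <= \sum_(i < n) (good i)%:R -> F w].
Proof.
move=> mE PE c0; pose f (w : X) : R := \sum_(i < n) \1_(E i) w.
have mf : measurable_fun setT (f : X -> T).
  by apply: measurable_sum => i; exact: measurable_indic.
have mf' : measurable_fun setT (fun w => (f w)%:E) by exact/measurable_EFinP.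
have f0 w : 0 <= f w by apply: sumr_ge0 => i _; rewrite indicE.
set A := [set w | (c%:E <= (f w)%:E)%E].
have mA : measurable A by rewrite -[A]setTI; apply: emeasurable_fun_c_infty.
exists A; split=> //.
- have := markov_ge0 P mf' (fun w => ltac:(by rewrite lee_fin)) c0.
  have -> : (\int[P]_x (f x)%:E = \sum_(i < n) P (E i))%E.
    under eq_integral do rewrite -sumEFin.
    rewrite ge0_integral_sum //.
    + by apply: eq_bigr => i _; rewrite integral_indic // setIT.
    + by move=> i; apply/measurable_EFinP; exact: measurable_indic.
  rewrite -/A; have fA : P A \is a fin_num by exact: fin_num_measure.
  have h : (\sum_(i < n) P (E i) <= (n%:R * e)%:E)%E.
    have -> : (n%:R * e)%:E = (\sum_(i < n) e%:E)%E.
      by rewrite sumEFin sumr_const card_ord mulr_natl.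
    by apply: lee_sum.
  move=> h1; have : (c%:E * (fine (P A))%:E <= (n%:R * e)%:E)%E.
    by rewrite fineK //; exact: le_trans h1 h.
  rewrite -EFinM lee_fin => h'; rewrite -[leLHS]fineK // lee_fin.
  by rewrite ler_pdivlMr // mulrC.
- move=> w good hg hc; rewrite /A /= lee_fin; apply: le_trans hc _.
  apply: ler_sum => i _; rewrite indicE; case gi: (good i); last by [].
  by rewrite mem_set //; exact: hg.
Qed.

(** The definition asks for a single sequence of covering events, while the hypothesis supplies an
    event for each tolerance. Taking E n with probability within 1 / (n + 1) of the infimum over all
    measurable covers serves every tolerance at once. *)
Lemma cvg_in_prob_near dd (X : measurableType dd) (P : probability X R) (Y : nat -> X -> R) (L : R) :
  (forall eps del : R, 0 < eps -> 0 < del -> \forall n \near \oo,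
     exists E : set X, [/\ measurable E, [set w | eps < `|Y n w - L|] `<=` E & (P E <= del%:E)%E]) ->
  cvg_in_prob P Y L.
Proof.
move=> h eps eps0.
pose S n := [set fine (P E) | E in [set E | measurable E /\ [set w | eps < `|Y n w - L|] `<=` E]].
have Sinf n : has_inf (S n).
  split; first by exists (fine (P setT)), setT.
  by exists 0 => _ [E _ <-]; rewrite fine_ge0.
have ex n : exists E : set X, (measurable E /\ [set w | eps < `|Y n w - L|] `<=` E) /\
    fine (P E) < inf (S n) + n.+1%:R^-1.
  have [|_ [E hE <-] lt] := @inf_adherent R (S n) n.+1%:R^-1 _ (Sinf n).
    by rewrite invr_gt0 ltr0n.
  by exists E.
pose E n := projT1 (cid (ex n)).
have hE n := projT2 (cid (ex n)).
exists E; split; first by move=> n; have [[]] := hE n.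
split; first by move=> n; have [[]] := hE n.
apply/cvgrPdist_le => e e0; have e2 : 0 < e / 2 by rewrite divr_gt0.
near=> n.
rewrite sub0r normrN ger0_norm ?fine_ge0 //.
have [_ lt] := hE n; apply: ltW; apply: lt_le_trans lt _.
have -> : e = e / 2 + e / 2 by field.
apply: lerD; last first.
  by apply: ltW; near: n; exact: near_infty_natSinv_lt (PosNum e2).
have [F [mF sF PF]] : exists F : set X, [/\ measurable F, [set w | eps < `|Y n w - L|] `<=` F & (P F <= (e/2)%:E)%E].
  by near: n; apply: h.
apply: (@le_trans _ _ (fine (P F))).
  by apply: ge_inf; [have [] := Sinf n|exists F].
by rewrite -lee_fin fineK // fin_num_measure.
Unshelve. all: by end_near. Qed.

Section Whitening.
Variables (dd : measure_display) (Om : measurableType dd) (P : probability Om R) (d B : nat)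
  (Z : Om -> 'M[R]_(d, B)) (s : 'I_B -> R).
Hypotheses (s0 : forall j, 0 < s j)
  (Zmeas : forall i j, measurable_fun setT (fun w => Z w i j))
  (Zlaw : forall i j (A : set R), measurable A ->
     P ((fun w => Z w i j) @^-1` A) = normal_prob 0 (s j) A)
  (Zindep : forall A : 'I_d -> 'I_B -> set R, (forall i j, measurable (A i j)) ->
     fine (P [set w | forall i j, A i j (Z w i j)])
     = \prod_(i < d) \prod_(j < B) fine (P ((fun w => Z w i j) @^-1` A i j))).

Definition scalecol (w : Om) : MT R d B := \matrix_(i, j) (Z w i j / s j).

Lemma measurable_scalecol : measurable_fun setT scalecol.
Proof.
apply: measurable_toMT => i j.
rewrite (_ : (fun x => _) = (fun w : Om => Z w i j * (s j)^-1 : T)); last by apply/funext => w; rewrite mxE.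
by apply: measurable_funM => //; exact: Zmeas.
Qed.

Definition scalecol_mfun : {mfun Om >-> MT R d B} := mfun_Sub (mem_set measurable_scalecol).

Lemma stdmx_scalecol : stdmx (distribution P scalecol_mfun).
Proof.
move=> A mA; rewrite /distribution /pushforward.
pose A' i j := (fun x : T => x / s j : T) @^-1` A (i, j).
have mdiv j : measurable_fun setT (fun x : T => x / s j : T).
  rewrite (_ : (fun x => _) = (fun x : T => (s j)^-1 * x + 0 : T)); first exact: measurable_affine.
  by apply/funext => x; rewrite addr0 mulrC.
have mA' i j : measurable (A' i j) by apply: (mpre (mdiv j)); exact: mA.
have E : scalecol_mfun @^-1` rect A = [set w | forall i j, A' i j (Z w i j)].
  apply/seteqP; split => w /= h.
    by move=> i j; have := h (i, j); rewrite mxE.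
  by move=> [i j]; rewrite mxE; exact: h.
have mr : measurable (scalecol_mfun @^-1` rect A).
  by apply: (mpre measurable_scalecol); exact: measurable_rect.
rewrite -[LHS]fineK ?fin_num_measure // E Zindep // pair_bigA /=; congr EFin.
apply: eq_bigr => -[i j] _ /=; rewrite Zlaw; last exact: mA'.
by congr fine; exact: (normal_scale (s0 j) (mA (i, j))).
Qed.

End Whitening.
End ProbTools.

(** * Growth of B, gamma and the aliasing ratio *)

Section Asymptotics.
Variable R : realType.

Lemma powR_near_ge (s C : R) : 0 < s -> \forall n \near \oo, C <= (n%:R : R) `^ s.
Proof.
move=> s0; pose m := (Num.truncn (Num.max C 0 `^ s^-1)).+1.
have C0 : 0 <= Num.max C 0 by rewrite le_max lexx orbT.
near=> n; have mn : (m <= n)%N by near: n; exact: nbhs_infty_ge.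
have h : Num.max C 0 `^ s^-1 <= n%:R.
  have /andP[_ h] := truncn_itv (powR_ge0 (Num.max C 0) s^-1).
  by apply: le_trans (ltW h) _; rewrite ler_nat.
apply: (@le_trans _ _ (Num.max C 0)); first by rewrite le_max lexx.
have -> : Num.max C 0 = (Num.max C 0 `^ s^-1) `^ s.
  by rewrite -powRrM mulVf ?gt_eqF // powRr1.
by apply: ge0_ler_powR; [exact: ltW|rewrite nnegrE powR_ge0|rewrite nnegrE|exact: h].
Unshelve. all: by end_near. Qed.

Definition S0of (n B : nat) : nat := (((B.-1)./2).*2.+1 %/ n)%N.

Lemma S0of_ge n B : (0 < n)%N -> (B <= (S0of n B).+1 * n)%N.
Proof.
move=> n0; apply: leq_trans (ltn_ceil _ n0).
by have := odd_double_half B.-1; case: (odd _) => /=; lia.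
Qed.

Definition regime (B n : nat) (g : R) : Prop :=
  [/\ (1 < n)%N, (n.*2.+1 <= B)%N, 0 < g <= 2^-1, 2^-1 <= wb B g & forall j : 'I_B, 0 < lam B g j].

(** S0 grows like n^(p - 1) and [wa] is of order n^(p - q); their quotient n^(q - 1) exceeds any
    constant because q > 1. *)
Lemma regime_near (p q C : R) : 1 < p -> 1 < q -> \forall n \near \oo,
  [/\ regime (sizeB p n) n (gam q n), C <= (S0of n (sizeB p n))%:R &
      C * wa (sizeB p n) (gam q n) <= (S0of n (sizeB p n))%:R].
Proof.
move=> p1 q1; have p0 : 0 < p - 1 by rewrite subr_gt0.
have q0 : 0 < q - 1 by rewrite subr_gt0.
near=> n.
have n2 : (1 < n)%N by near: n; exact: nbhs_infty_gt.
have x4 : 4 <= (n%:R : R) `^ (p - 1) by near: n; exact: powR_near_ge.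
have xC : 2 * C <= (n%:R : R) `^ (p - 1) by near: n; exact: powR_near_ge.
have y2 : 2 <= (n%:R : R) `^ (q - 1) by near: n; exact: powR_near_ge.
have yC : C <= (n%:R : R) `^ (q - 1) by near: n; exact: powR_near_ge.
have n0 : (0 < n)%N by lia.
have n0R : 0 < n%:R :> R by rewrite ltr0n.
have n2R : 2 <= n%:R :> R by rewrite ler_nat.
set x := (n%:R : R) `^ (p - 1) in x4 xC *; set y := (n%:R : R) `^ (q - 1) in y2 yC *.
have px : (n%:R : R) `^ p = n%:R * x by rewrite mulr_powRB1 //; lra.
have gy : gam q n = (n%:R * y)^-1 by rewrite /gam powRN mulr_powRB1 //; lra.
have /andP[B1 B2] := truncn_itv (powR_ge0 (n%:R : R) p).
rewrite -/(sizeB p n) px in B1 B2; set B := sizeB p n in B1 B2 *; set g := gam q n in gy *.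
have nx : n%:R * 4 <= n%:R * x by rewrite ler_pM2l.
have nB : (n.*2.+1 <= B)%N.
  by rewrite -ltnS -(ltr_nat R); apply: le_lt_trans B2; rewrite -[n.*2.+1]addn1 natrD -muln2 natrM; lra.
have B3 : 3 <= B%:R :> R by rewrite ler_nat (leq_trans _ nB) // ltnS (leq_trans n2) // -addnn leq_addr.
have ny0 : 0 < n%:R * y by rewrite mulr_gt0 //; lra.
have g0 : 0 < g by rewrite gy invr_gt0.
have g2 : g <= 2^-1.
  rewrite gy lef_pV2 ?posrE //.
  have : n%:R * 2 <= n%:R * y by rewrite ler_pM2l.
  lra.
have wbg : 2^-1 <= wb B g.
  rewrite /wb ler_pdivlMr; last by lra.
  have : 2^-1 * B%:R <= (1 - g) * B%:R by rewrite ler_wpM2r //; lra.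
  lra.
have lamg (j : 'I_B) : 0 < lam B g j.
  by rewrite /lam; case: ifP => _; [rewrite mulr_gt0 //; lra|rewrite -/(wb B g); lra].
have S0x : x / 2 <= (S0of n B)%:R.
  have h := S0of_ge B n0.
  rewrite -(ler_nat R) natrM -[_.+1%:R]natr1 in h.
  rewrite -[B.+1%:R]natr1 in B2.
  have h3 : n%:R * x < n%:R * ((S0of n B)%:R + 1 + 1).
    apply: lt_le_trans B2 _; rewrite [_ * (_ + 1 + 1)]mulrDr mulr1; lra.
  rewrite ltr_pM2l // in h3; lra.
split; first by split=> //; rewrite g0 g2.
  by apply: le_trans S0x; lra.
apply: le_trans S0x; rewrite /wa gy.
have y0 : 0 < y by lra.
have h : B%:R / (n%:R * y) <= x / y.
  by rewrite invfM mulrA ler_pM2r ?invr_gt0 // ler_pdivrMr // mulrC.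
have [C0|C0] := leP C 0.
  apply: (@le_trans _ _ 0); last by lra.
  by rewrite pmulr_lle0 // divr_gt0 // mulr_gt0 ?invr_gt0 //; lra.
have : C * (B%:R / (n%:R * y)) <= y * (x / y).
  by apply: ler_pM => //; rewrite ?ltW // divr_gt0 //; clear -x4 y0 B3; lra.
rewrite [y * _]mulrC divfK ?gt_eqF //; lra.
Unshelve. all: by end_near. Qed.

End Asymptotics.

(** * Adversarial risks of [fhat] and [ghat] for large n *)

Section AdvRiskLimits.
Variable R : realType.

Definition gap_regime (B n : nat) (g : R) (L : nat) (eps : R) : Prop :=
  [/\ (0 < L)%N, (8 * L <= S0of n B)%N, wa B g <= wb B g / 2 * Lam R L (S0of n B),
     16 <= n.-1%:R * Lam R L (S0of n B) &
     (2 * n%:R)^-1 + L%:R * hstep R L (S0of n B) <= eps].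

Lemma gap_regime_near (p q : R) (L : nat) (eps : R) : 1 < p -> 1 < q -> (0 < L)%N -> 0 < eps ->
  \forall n \near \oo, regime (sizeB p n) n (gam q n) /\ gap_regime (sizeB p n) n (gam q n) L eps.
Proof.
move=> p1 q1 L0 e0; have L1 : 1 <= L%:R :> R by rewrite ler1n.
(* 1024 = 16 * 64 makes Lam = S0 / (64 L) at least 16, and 4 L / eps makes L * hstep <= 2 L / S0 at
   most eps / 2. *)
pose C := 1024 * L%:R + 4 * L%:R / eps.
have C1 : 0 <= 4 * L%:R / eps by rewrite divr_ge0 ?ltW // mulr_gt0 //; lra.
near=> n.
have [[n2 nB gb wbg lamg] CS Ca] : [/\ regime (sizeB p n) n (gam q n), C <= (S0of n (sizeB p n))%:R &
      C * wa (sizeB p n) (gam q n) <= (S0of n (sizeB p n))%:R].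
  by near: n; exact: regime_near.
have en : (n%:R : R)^-1 <= eps.
  rewrite invf_ple ?posrE ?ltr0n //; last exact: ltnW.
  have /andP[_ h] := truncn_itv (ltW (ltac:(by rewrite invr_gt0) : 0 < eps^-1)).
  apply: le_trans (ltW h) _; rewrite ler_nat; near: n; exact: nbhs_infty_ge.
set B := sizeB p n in nB wbg lamg CS Ca *; set g := gam q n in gb wbg lamg Ca *.
set S0 := S0of n B in CS Ca *.
have a0 : 0 <= wa B g by rewrite /wa divr_ge0 // mulr_ge0 //; case/andP: gb => /ltW.
split => //; split => //.
- by rewrite -(ler_nat R) natrM; rewrite /C in CS; clear -CS C1 L1; lra.
- have : 1024 * L%:R * wa B g <= S0%:R.
    by apply: le_trans Ca; rewrite ler_wpM2r // /C; lra.
  move=> h; apply: (@le_trans _ _ (4^-1 * Lam R L S0)); last first.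
    by rewrite ler_wpM2r ?divr_ge0 ?mulr_ge0 //; lra.
  rewrite /Lam mulrA ler_pdivlMr; last by lra.
  by have : 0 <= S0%:R :> R by []; clear -h; lra.
- apply: (@le_trans _ _ (1 * Lam R L S0)); last first.
    by rewrite ler_wpM2r ?divr_ge0 ?mulr_ge0 // ler1n -subn1 subn_gt0.
  by rewrite mul1r /Lam ler_pdivlMr; rewrite /C in CS; clear -CS C1 L1; lra.
- have S0p : 0 < S0%:R :> R by rewrite /C in CS; clear -CS C1 L1; lra.
  have h1 : L%:R * hstep R L S0 <= 2 * L%:R / S0%:R.
    rewrite /hstep mulrA ler_pM2r ?invr_gt0 //.
    have : 0 <= L%:R * (2 * L%:R)^-1 :> R by rewrite mulr_ge0 // invr_ge0 mulr_ge0.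
    lra.
  have h2 : 2 * L%:R / S0%:R <= eps / 2.
    rewrite ler_pdivrMr //.
    have : eps * (4 * L%:R / eps) <= eps * S0%:R.
      by rewrite ler_wpM2l ?ltW //; rewrite /C in CS; clear -CS L1; lra.
    rewrite mulrC divfK ?gt_eqF //; lra.
  have h3 : (2 * n%:R)^-1 = n%:R^-1 / 2 :> R by rewrite invfM mulrC.
  lra.
Unshelve. all: by end_near. Qed.

Lemma adv_fhat_ge (B n : nat) (g : R) (L : nat) (eps : R) : regime B n g -> gap_regime B n g L eps ->
  1 - eps <= adv_risk (fhat n B g) n%:R^-1.
Proof.
case: B => [|B']; first by case=> _; rewrite ltn0.
move=> [n2 nB /andP[g0 g2] wbg lamg] [L0 LS aL nL he].
have n0 : (0 < n)%N by lia.
have [h0 hL] := hstep_bounds R L0 LS; set h := hstep _ _ _ in he h0 hL.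
have t01 : 0 <= L%:R * h <= 2^-1 by apply/andP; split; [rewrite mulr_ge0 // ltW|lra].
have := @adv_risk_ge R (fhat n B'.+1 g) n (L%:R * h) xpred0 n0 t01.
rewrite big1 // mul0r => H; apply: le_trans (H _); first by lra.
move=> i _ _; exists (L%:R * h); rewrite lexx; split; first by case/andP: t01 => ->.
by apply: fhat_gappt_le0 => //; rewrite L0 leqnn.
Qed.

Lemma unwhiten_scalecol (dd : measure_display) (Om : measurableType dd) d B (g : R)
  (Z : Om -> 'M[R]_(d, B)) w : (forall j : 'I_B, 0 < lam B g j) ->
  unwhiten g (scalecol Z (fun j => Num.sqrt (lam B g j)) w) = Z w.
Proof.
move=> l0; apply/matrixP => i j; rewrite /unwhiten /whiten mul_mx_diag !mxE divfK //.
by rewrite gt_eqF // sqrtr_gt0.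
Qed.

(** The L points of a given gap are all positive with probability at most 2^-L. A risk below 1 - eps
    forces a fraction at least eps / 2 of such gaps, the other eps / 2 being the discretisation loss
    allowed by [gap_regime]; Markov's inequality then gives the factor 2 / eps. *)
Lemma adv_ghat_event (dd : measure_display) (Om : measurableType dd) (P : probability Om R)
  (d B n : nat) (g : R) (L : nat) (eps : R) (Z : Om -> 'M[R]_(d, B))
  (Zmeas : forall i j, measurable_fun setT (fun w => Z w i j))
  (Zlaw : forall i j (A : set R), measurable A ->
     P ((fun w => Z w i j) @^-1` A) = normal_prob 0 (Num.sqrt (lam B g j)) A)
  (Zindep : forall A : 'I_d -> 'I_B -> set R, (forall i j, measurable (A i j)) ->
     fine (P [set w | forall i j, A i j (Z w i j)])
     = \prod_(i < d) \prod_(j < B) fine (P ((fun w => Z w i j) @^-1` A i j))) :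
  regime B n g -> gap_regime B n g L (eps / 2) -> 0 < eps ->
  exists E : set Om, [/\ measurable E,
    [set w | eps < `|adv_risk (ghat n (Z w)) n%:R^-1 - 1|] `<=` E &
    (P E <= (2 / eps * (2 ^+ L)^-1)%:E)%E].
Proof.
case: B Z Zmeas Zlaw Zindep => [|B'] Z Zmeas Zlaw Zindep; first by case=> _; rewrite ltn0.
move=> [n2 nB /andP[g0 g2] wbg lamg] [L0 LS aL nL he] e0.
have n0 : (0 < n)%N by lia.
have n0R : 0 < n%:R :> R by rewrite ltr0n.
have s0 (j : 'I_B'.+1) : 0 < Num.sqrt (lam B'.+1 g j) by rewrite sqrtr_gt0.
have [h0 hL] := hstep_bounds R L0 LS; set h := hstep _ _ _ in he h0 hL.
have t01 : 0 <= L%:R * h <= 2^-1 by apply/andP; split; [rewrite mulr_ge0 // ltW|lra].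
pose z i l := pt (gappt R n B' L i l).
pose nZ := scalecol_mfun (fun j => Num.sqrt (lam B'.+1 g j)) Zmeas.
have nuZ : stdmx (distribution P nZ) by exact: stdmx_scalecol.
have gap i := gap_prob i n0 nB g0 lamg L0 LS aL nL nuZ.
pose E0 i := projT1 (cid (gap i)).
have hE0 i := projT2 (cid (gap i)).
pose E i := nZ @^-1` (E0 i).
have mE i : measurable (E i).
  by have [m _ _] := hE0 i; rewrite -[E i]setTI; exact: (measurable_scalecol _ Zmeas).
have PE i : (P (E i) <= ((2 ^+ L)^-1)%:E)%E by have [_ h1 _] := hE0 i.
have cp : 0 < n%:R * (eps / 2) by rewrite mulr_gt0 // divr_gt0.
have [F [mF PF hF]] := markov_count n mE PE cp.
exists F; split => //; last first.
  apply: le_trans PF _; rewrite lee_fin le_eqVlt; apply/orP; left; apply/eqP.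
  by field; rewrite !gt_eqF // exprn_gt0.
move=> w /= hw; pose good i := `[< forall l, (0 < l <= L)%N -> 0 < ghat n (Z w) (z i l) >].
apply: (hF w good).
  move=> i /asboolP gi; have [_ _] := hE0 i; apply => l lL.
  have -> : unwhiten g (nZ w) = Z w by exact: unwhiten_scalecol.
  exact: gi.
have := @adv_risk_ge R (ghat n (Z w)) n (L%:R * h) good n0 t01.
have adv1 := adv_risk_le1 (ghat n (Z w)) n%:R^-1.
rewrite ler0_norm ?subr_le0 // opprB in hw.
move=> /(_ _); apply: contraPP => /negP; rewrite -ltNge => hc H.
have : eps / 2 <= (\sum_(i < n) (good i)%:R) / n%:R.
  suff : 1 - (\sum_(i < n) (good i)%:R) / n%:R - (2 * n%:R)^-1 - L%:R * h <=
    adv_risk (ghat n (Z w)) n%:R^-1 by lra.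
  apply: H => i _ /asboolPn/existsNP[l /not_implyP[lL /negP]]; rewrite -leNgt => hz.
  exists (l%:R * h); split; last exact: hz.
  rewrite mulr_ge0 ?(ltW h0) //= ler_wpM2r ?(ltW h0) // ler_nat; by case/andP: lL.
by rewrite ler_pdivlMr // mulrC leNgt hc.
Qed.

End AdvRiskLimits.

(** * Finiteness and positivity of Gaussian moments *)

Section GaussMoments.
Variable R : realType.
Local Notation leb := (@lebesgue_measure R).
Local Notation T := (measurableTypeR R).
Local Open Scope ereal_scope.

Lemma ge0_integral_law d1 d2 (X : measurableType d1) (Y : measurableType d2)
    (m : {measure set X -> \bar R}) (m' : {measure set Y -> \bar R}) (h : X -> Y) (f : Y -> \bar R) :
  measurable_fun setT h -> (forall A, measurable A -> m (h @^-1` A) = m' A) ->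
  measurable_fun setT f -> (forall y, 0 <= f y) ->
  \int[m]_x f (h x) = \int[m']_y f y.
Proof.
move=> mh hl mf f0.
have <- : \int[push m mh]_y f y = \int[m']_y f y.
  by apply: eq_measure_integral => A mA _; exact: hl.
by rewrite (ge0_integral_pushforward mh m measurableT mf) //= preimage_setT.
Qed.

(** The Radon-Nikodym derivative is determined almost everywhere only; it agrees with [g1] because
    both have the same integral over every measurable set. *)
Lemma N1_density (f : T -> \bar R) : measurable_fun setT f -> (forall x, 0 <= f x) ->
  \int[N1 R]_x f x = \int[leb]_x (f x * (g1 x)%:E).
Proof.
move=> mf f0; have dom : N1 R `<< leb by exact: normal_prob_dominates.
have mg : measurable_fun setT (fun x : T => (g1 x)%:E) by apply/measurable_EFinP; exact: measurable_g1.
have RNi := Radon_Nikodym_SigmaFinite.f_integrable dom.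
have RN0 := Radon_Nikodym_SigmaFinite.f_ge0 dom.
rewrite -(Radon_Nikodym_SigmaFinite.change_of_variables dom f0 measurableT mf).
apply: ge0_ae_eq_integral => //.
- by apply: emeasurable_funM => //; case/integrableP: RNi.
- by apply: emeasurable_funM.
- by move=> x _; rewrite mule_ge0.
- by move=> x _; rewrite mule_ge0 // lee_fin g1_ge0.
- apply: ae_eqe_mul2l; apply: integral_ae_eq => // E _ mE.
  by rewrite -Radon_Nikodym_SigmaFinite.f_integral.
Qed.

Definition m2 : R := fine (\int[N1 R]_x (x ^+ 2)%:E).
Definition m4 : R := fine (\int[N1 R]_x (x ^+ 4)%:E).

Let mX n : measurable_fun setT (fun x : T => (x ^+ n)%:E).
Proof. by apply/measurable_EFinP; exact: measurable_funX. Qed.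

Let x4_lt : \int[N1 R]_x (x ^+ 4)%:E < +oo.
Proof.
have x40 (x : R) : (0 <= x ^+ 4)%R by rewrite (exprM x 2 2) sqr_ge0.
rewrite N1_density //.
(* Domination by a Gaussian of standard deviation 2: with y = 3 x^2 / 8, exp y >= y^2 / 2 = 9 x^4 /
   128, and 15 * 9 / 128 >= 1. *)
pose C : R := (15 * normal_peak 1 / normal_peak 2)%R.
have p1 : (0 < normal_peak 1 :> R)%R by rewrite normal_peak_gt0 // oner_neq0.
have p2 : (0 < normal_peak 2 :> R)%R by rewrite normal_peak_gt0 // pnatr_eq0.
have C0 : (0 <= C)%R by rewrite divr_ge0 ?mulr_ge0 // ltW.
apply: (@le_lt_trans _ _ (\int[leb]_x (C%:E * (normal_pdf 0 2 x)%:E))).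
  apply: ge0_le_integral => //.
  - by move=> x _; rewrite mule_ge0 // lee_fin ?g1_ge0.
  - by apply: emeasurable_funM => //; apply/measurable_EFinP; exact: measurable_g1.
  - by apply: emeasurable_funM => //; apply/measurable_EFinP; exact: measurable_normal_pdf.
  move=> x _; rewrite -!EFinM lee_fin g1E normal_pdfE ?pnatr_eq0 //= /normal_fun subr0.
  have -> : (C * (normal_peak 2 * expR (- x ^+ 2 / (2 ^+ 2 *+ 2))) =
    normal_peak 1 * (15 * expR (- x ^+ 2 / (2 ^+ 2 *+ 2))))%R.
    by rewrite /C; field; rewrite gt_eqF.
  rewrite mulrCA ler_pM2l //.
  have -> : (- x ^+ 2 / (2 ^+ 2 *+ 2) = 3 * x ^+ 2 / 8 + (- x ^+ 2 / 2))%R by field.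
  rewrite expRD mulrA ler_wpM2r ?expR_ge0 //.
  have y0 : (0 <= 3 * x ^+ 2 / 8)%R by rewrite divr_ge0 // mulr_ge0 // sqr_ge0.
  have := expR_ge1Dxn 1 y0; rewrite (_ : 2`!%:R = 2%R :> R) //.
  have -> : ((3 * x ^+ 2 / 8) ^+ 2 = 9 / 64 * x ^+ 4)%R by field.
  by have := x40 x; lra.
have mp : measurable_fun setT (fun x : T => (normal_pdf 0 2 x)%:E).
  by apply/measurable_EFinP; exact: measurable_normal_pdf.
rewrite ge0_integralZl //; last by move=> x _; rewrite lee_fin normal_pdf_ge0.
by rewrite integral_normal_pdf mule1 ltry.
Qed.

Let x2_lt : \int[N1 R]_x (x ^+ 2)%:E < +oo.
Proof.
have x40 (x : R) : (0 <= x ^+ 4)%R by rewrite (exprM x 2 2) sqr_ge0.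
apply: (@le_lt_trans _ _ (\int[N1 R]_x (1 + (x ^+ 4)%:E))).
  apply: ge0_le_integral => //.
  - by move=> x _; rewrite lee_fin sqr_ge0.
  - by apply: emeasurable_funD.
  - move=> x _; rewrite -EFinD lee_fin (exprM x 2 2).
    by have := sqr_ge0 (x ^+ 2 - 1)%R; have := sqr_ge0 x; rewrite sqrrB; lra.
rewrite ge0_integralD //; last by move=> x _; rewrite lee_fin.
rewrite integral_cst // mul1e [X in X + _](_ : _ = 1); last exact: probability_setT.
by rewrite lte_add_pinfty // ltry.
Qed.

Lemma int_x2 : \int[N1 R]_x (x ^+ 2)%:E = m2%:E.
Proof.
rewrite fineK // ge0_fin_numE //.
by apply: integral_ge0 => x _; rewrite lee_fin sqr_ge0.
Qed.

Lemma int_x4 : \int[N1 R]_x (x ^+ 4)%:E = m4%:E.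
Proof.
rewrite fineK // ge0_fin_numE //.
by apply: integral_ge0 => x _; rewrite lee_fin (exprM x 2 2) sqr_ge0.
Qed.

Lemma m4_ge0 : (0 <= m4)%R.
Proof.
by rewrite -lee_fin -int_x4; apply: integral_ge0 => x _; rewrite lee_fin (exprM x 2 2) sqr_ge0.
Qed.

(** A vanishing second moment would concentrate the law at 0, yet a point is a null set by absolute
    continuity. *)
Lemma m2_gt0 : (0 < m2)%R.
Proof.
have m0 : (0 <= m2)%R.
  by rewrite -lee_fin -int_x2; apply: integral_ge0 => x _; rewrite lee_fin sqr_ge0.
rewrite lt_neqAle m0 andbT; apply/eqP => E.
have : \int[N1 R]_x `| (x ^+ 2)%:E | = 0.
  rewrite -[RHS]/(0%R)%:E E -int_x2; apply: eq_integral => x _.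
  by rewrite gee0_abs // lee_fin sqr_ge0.
move/(ae_eq_integral_abs _ measurableT (mX 2)) => [N [mN N0 sN]].
have n0 : [set~ 0%R] `<=` N.
  move=> x /eqP x0; apply: sN => /= /(_ I) /eqP; rewrite eqe sqrf_eq0.
  by rewrite (negPf x0).
have m1 : measurable [set 0%R : T] by exact: measurable_set1.
have h1 : N1 R [set 0%R : T] = 0.
  have dom : N1 R `<< leb by exact: normal_prob_dominates.
  have /null_content_dominatesP h := dom.
  by apply: (h [set 0%R] m1); exact: (lebesgue_measure_set1 (0%R : R)).
have h2 : N1 R (~` [set 0%R : T]) = 0.
  apply/eqP; rewrite eq_le measure_ge0 andbT -N0; apply: le_measure; rewrite ?inE //.
  exact: measurableC.
have h3 : N1 R ([set 0%R : T] `|` ~` [set 0%R : T]) = N1 R [set 0%R : T] + N1 R (~` [set 0%R : T]).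
  by apply: measureU => //; [exact: measurableC|rewrite setICr].
have h4 : N1 R ([set 0%R : T] `|` ~` [set 0%R : T]) = 1 by rewrite setUCr probability_setT.
have : 1 = 0 + 0 :> \bar R by exact: (etrans (esym h4) (etrans h3 (congr2 _ h1 h2))).
by rewrite adde0 => /eqP; rewrite eqe oner_eq0.
Qed.

End GaussMoments.

(** * Second moment of the empirical covariance deviation *)

Section SecondMoment.
Variable R : realType.
Local Notation T := (measurableTypeR R).
Lemma sum_lam B (g : R) : (1 < B)%N -> (\sum_(j < B) lam B g j = B%:R)%R.
Proof.
case: B => // B' B1; rewrite big_ord_recl /lam /=.
rewrite sumr_const card_ord -mulr_natr -[B'.+1%:R]natr1.
have b0 : (B'%:R != 0 :> R)%R by rewrite pnatr_eq0 -lt0n.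
by field; rewrite addrK.
Qed.

Local Notation m2 := (m2 R).
Local Notation m4 := (m4 R).
Variables (d B : nat) (nu : probability (MT R d B) R).
Hypothesis stdnu : stdmx nu.
Local Open Scope ereal_scope.

Let mE i j n : measurable_fun setT (fun M : MT R d B => (M i j ^+ n)%R : T).
Proof. by apply: measurable_funX; exact: measurable_entry. Qed.

Let sq0 (x : R) : 0 <= (x ^+ 2)%:E. Proof. by rewrite lee_fin sqr_ge0. Qed.

Lemma int_entry e (f : T -> \bar R) : measurable_fun setT f -> (forall x, 0 <= f x) ->
  \int[nu]_M f (M e.1 e.2) = \int[N1 R]_x f x.
Proof.
move=> mf f0.
apply: (@ge0_integral_law R _ _ _ _ nu (N1 R) (fun M : MT R d B => M e.1 e.2 : T) f) => //.
  exact: measurable_entry.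
by move=> A mA; exact: (entry_law stdnu e).
Qed.

Lemma int_pair e e' : e != e' ->
  \int[nu]_M (M e.1 e.2 ^+ 2 * M e'.1 e'.2 ^+ 2)%:E = (m2 ^+ 2)%:E.
Proof.
move=> ee; pose f (z : T * T) : \bar R := (z.1 ^+ 2 * z.2 ^+ 2)%:E.
have mf : measurable_fun setT f.
  by apply/measurable_EFinP; apply: measurable_funM; apply: measurable_funX; [exact: measurable_fst|exact: measurable_snd].
have f0 z : 0 <= f z by rewrite lee_fin mulr_ge0 // sqr_ge0.
pose h (M : MT R d B) : T * T := (M e.1 e.2, M e'.1 e'.2).
have mh : measurable_fun setT h by apply/measurable_fun_pairP; split; exact: measurable_entry.
have -> : \int[nu]_M (M e.1 e.2 ^+ 2 * M e'.1 e'.2 ^+ 2)%:E = \int[N1 R \x N1 R]_z f z.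
  apply: (@ge0_integral_law R _ _ _ _ nu (N1 R \x N1 R) h f) => //.
  by move=> A mA; exact: (pair_law stdnu ee).
rewrite fubini_tonelli1 // /fubini_F.
have mx2 : measurable_fun setT (fun x : T => (x ^+ 2)%:E) by apply/measurable_EFinP; exact: measurable_funX.
under eq_integral => x _.
  under eq_integral do rewrite /f /= EFinM.
  rewrite ge0_integralZl // int_x2; over.
by rewrite ge0_integralZr // ?int_x2 ?EFinM // lee_fin ltW // m2_gt0.
Qed.

Let flip_int e (f : MT R d B -> \bar R) : measurable_fun setT f -> (forall M, 0 <= f M) ->
  \int[nu]_M f (flipm e M) = \int[nu]_M f M.
Proof.
move=> mf f0; have [mh hl] := flipm_preserves stdnu e.
exact: (@ge0_integral_law R _ _ _ _ nu nu (flipm e) f).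
Qed.

(** Orthogonality of the rows by symmetry: flipping the sign of entry (m, j) negates the new term Y
    and keeps the partial sum S, so E (S + Y)^2 = E (S - Y)^2, and the parallelogram law gives E S^2
    + E Y^2. Only integrals of nonnegative functions occur. *)
Lemma int_offdiag j k m : j != k ->
  \int[nu]_M ((\sum_(i < d | (i < m)%N) M i j * M i k) ^+ 2)%:E <= (m%:R * m2 ^+ 2)%:E.
Proof.
move=> jk; pose S m' (M : MT R d B) : T := (\sum_(i < d | (i < m')%N) M i j * M i k)%R.
have mS m' : measurable_fun setT (S m').
  by apply: measurable_bigsum => i _; apply: measurable_funM; exact: measurable_entry.
have mS2 m' : measurable_fun setT (fun M => (S m' M ^+ 2)%:E).
  by apply/measurable_EFinP; apply: measurable_funX; exact: mS.
rewrite -[leLHS]/(\int[nu]_M (S m M ^+ 2)%:E).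
elim: m => [|m IH].
  rewrite (eq_integral (cst 0)) ?integral0 ?mul0r // => M _.
  by rewrite /S big_pred0 // expr0n.
have [dm|md] := leqP d m.
  have -> : S m.+1 = S m.
    apply/funext => M; rewrite /S; apply: eq_bigl => i.
    by rewrite !(leq_trans (ltn_ord i)) // (leq_trans dm).
  apply: le_trans IH _; rewrite lee_fin ler_wpM2r ?sqr_ge0 // ler_nat //.
pose i0 := Ordinal md.
pose Y (M : MT R d B) : T := (M i0 j * M i0 k)%R.
have mY : measurable_fun setT Y by apply: measurable_funM; exact: measurable_entry.
have SE M : S m.+1 M = (S m M + Y M)%R.
  rewrite /S (bigD1 i0) ?ltnSn //= addrC; congr (_ + _)%R; apply: eq_bigl => i.
  by rewrite ltnS leq_eqVlt andb_orl -val_eqE /=; case: ltngtP => //=; rewrite ?andbF ?andbT ?orbF.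
have Sf M : S m.+1 (flipm (i0, j) M) = (S m M - Y M)%R.
  rewrite SE; congr (_ + _)%R.
    apply: eq_bigr => i im; rewrite !mxE !xpair_eqE -val_eqE /=.
    by rewrite (ltn_eqF im).
  by rewrite /Y !mxE !xpair_eqE !eqxx /= eq_sym (negPf jk) mulNr.
have m0 (f : MT R d B -> T) : measurable_fun setT f -> measurable_fun setT (fun M : MT R d B => (f M ^+ 2)%:E : \bar R).
  by move=> mf; apply/measurable_EFinP; exact: measurable_funX.
have key : \int[nu]_M (S m.+1 M ^+ 2)%:E + \int[nu]_M (S m.+1 M ^+ 2)%:E =
  \int[nu]_M (S m M ^+ 2)%:E + \int[nu]_M (S m M ^+ 2)%:E +
  (\int[nu]_M (Y M ^+ 2)%:E + \int[nu]_M (Y M ^+ 2)%:E).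
  have mF : measurable_fun setT (fun M => (S m.+1 (flipm (i0, j) M) ^+ 2)%:E).
    have -> : (fun M => (S m.+1 (flipm (i0, j) M) ^+ 2)%:E) = (fun M => ((S m M - Y M) ^+ 2)%:E).
      by apply/funext => M; rewrite Sf.
    by apply: (m0 (fun M => S m M - Y M)%R); apply: measurable_funB => //; exact: mS.
  have mY2 := m0 _ mY; have mSm := mS2 m; have mSm1 := mS2 m.+1.
  rewrite -{1}(@flip_int (i0, j)) // -!ge0_integralD //;
    try by [apply: emeasurable_funD|move=> M _; rewrite adde_ge0].
  apply: eq_integral => M _; rewrite Sf SE -!EFinD; congr EFin; ring.
have Yint : \int[nu]_M (Y M ^+ 2)%:E = (m2 ^+ 2)%:E.
  have ne : (i0, j) != (i0, k) by rewrite xpair_eqE eqxx.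
  by rewrite -(int_pair ne); apply: eq_integral => M _; rewrite exprMn.
move: key IH; rewrite Yint.
have: 0 <= \int[nu]_M (S m.+1 M ^+ 2)%:E by apply: integral_ge0.
have: 0 <= \int[nu]_M (S m M ^+ 2)%:E by apply: integral_ge0.
move: (\int[nu]_M (S m.+1 M ^+ 2)%:E) (\int[nu]_M (S m M ^+ 2)%:E) => [x| |] [y| |] //=.
rewrite -!EFinD !lee_fin => _ _ [] E h.
rewrite -natr1; lra.
Qed.

(** The variance of a sum of independent squares, with c = d m2 its mean. The identity E (S - c)^2 =
    E S^2 - c^2 is written additively in [key] to stay with nonnegative integrands. *)
Lemma int_diag j :
  \int[nu]_M ((\sum_i M i j ^+ 2 - d%:R * m2) ^+ 2)%:E <= (d%:R * m4)%:E.
Proof.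
pose S (M : MT R d B) : T := (\sum_i M i j ^+ 2)%R.
pose c : R := (d%:R * m2)%R.
have mS : measurable_fun setT S by apply: measurable_bigsum => i _; exact: mE.
have c0 : (0 <= c)%R by rewrite mulr_ge0 // ltW // m2_gt0.
have S0 M : (0 <= S M)%R by apply: sumr_ge0 => i _; exact: sqr_ge0.
have mx n : measurable_fun setT (fun x : T => (x ^+ n)%:E) by apply/measurable_EFinP; exact: measurable_funX.
have intS : \int[nu]_M (S M)%:E = c%:E.
  under eq_integral do rewrite /S -sumEFin.
  rewrite ge0_integral_sum //; last by move=> i; apply/measurable_EFinP; exact: mE.
  rewrite (eq_bigr (fun=> m2%:E)).
    by rewrite sumEFin sumr_const card_ord /c mulr_natl.
  by move=> i _; rewrite (@int_entry (i, j) (fun x => (x ^+ 2)%:E)) // int_x2.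
have intS2 : \int[nu]_M (S M ^+ 2)%:E <= (d%:R * m4 + c ^+ 2)%:E.
  have -> : \int[nu]_M (S M ^+ 2)%:E = \sum_i \sum_k \int[nu]_M (M i j ^+ 2 * M k j ^+ 2)%:E.
    have mm i k : measurable_fun setT (fun M : MT R d B => (M i j ^+ 2 * M k j ^+ 2)%:E).
      by apply/measurable_EFinP; apply: measurable_funM; exact: mE.
    have mm0 i k M : 0 <= (M i j ^+ 2 * M k j ^+ 2)%:E :> \bar R by rewrite lee_fin mulr_ge0 ?sqr_ge0.
    transitivity (\int[nu]_M \sum_i \sum_k (M i j ^+ 2 * M k j ^+ 2)%:E).
      apply: eq_integral => M _; rewrite /S expr2 mulr_suml -sumEFin; apply: eq_bigr => i _.
      by rewrite mulr_sumr -sumEFin.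
    rewrite ge0_integral_sum //.
    - by apply: eq_bigr => i _; rewrite ge0_integral_sum.
    - by move=> i; apply: emeasurable_sum.
    - by move=> i M _; apply: sume_ge0.
  apply: (@le_trans _ _ (\sum_(i < d) \sum_(k < d) ((if i == k then m4 else 0) + m2 ^+ 2)%:E)).
    apply: lee_sum => i _; apply: lee_sum => k _.
    case: eqP => [<-|/eqP ik].
      under eq_integral do rewrite -exprD.
      rewrite (@int_entry (i, j) (fun x => (x ^+ 4)%:E)) //; last first.
        by move=> x; rewrite lee_fin (exprM x 2 2) sqr_ge0.
      by rewrite int_x4 lee_fin lerDl sqr_ge0.
    have ne : (i, j) != (k, j) by rewrite xpair_eqE negb_and ik.
    by rewrite (int_pair ne) add0r.
  have diag (i : 'I_d) : (\sum_(k < d) (if i == k then m4 else 0) = m4)%R.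
    by rewrite -big_mkcond (big_pred1 i) // => k; rewrite eq_sym.
  under eq_bigr do rewrite sumEFin big_split /= diag sumr_const card_ord.
  rewrite sumEFin sumr_const card_ord lee_fin /c.
  have -> : ((m4 + m2 ^+ 2 *+ d) *+ d = d%:R * (m4 + d%:R * m2 ^+ 2))%R by rewrite !mulr_natl.
  by rewrite le_eqVlt; apply/orP; left; apply/eqP; ring.
have mD : measurable_fun setT (fun M => ((S M - c) ^+ 2)%:E).
  by apply/measurable_EFinP; apply: measurable_funX; exact: measurable_funB.
have mS1 : measurable_fun setT (fun M => (S M)%:E) by exact/measurable_EFinP.
have mS2 : measurable_fun setT (fun M => (S M ^+ 2)%:E) by apply/measurable_EFinP; exact: measurable_funX.
have key : \int[nu]_M ((S M - c) ^+ 2)%:E + (2 * c ^+ 2)%:E = \int[nu]_M (S M ^+ 2)%:E + (c ^+ 2)%:E.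
  have -> : (2 * c ^+ 2)%:E = \int[nu]_M ((2 * c)%:E * (S M)%:E).
    rewrite ge0_integralZl //; try by [move=> M _; rewrite lee_fin|rewrite lee_fin mulr_ge0].
    by rewrite intS -EFinM; congr EFin; ring.
  have -> : (c ^+ 2)%:E = \int[nu]_M (cst (c ^+ 2)%:E M).
    by rewrite integral_cst //= probability_setT mule1.
  rewrite -!ge0_integralD //;
    try by [apply: emeasurable_funM|move=> M _; rewrite /= lee_fin sqr_ge0
           |move=> M _; rewrite mule_ge0 // lee_fin; [exact: mulr_ge0|exact: S0]].
  by apply: eq_integral => M _; rewrite /= -!EFinD; congr EFin => /=; ring.
rewrite -[leLHS]/(\int[nu]_M ((S M - c) ^+ 2)%:E).
move: key intS2.
have: 0 <= \int[nu]_M ((S M - c) ^+ 2)%:E by apply: integral_ge0.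
have: 0 <= \int[nu]_M (S M ^+ 2)%:E by apply: integral_ge0.
move: (\int[nu]_M ((S M - c) ^+ 2)%:E) (\int[nu]_M (S M ^+ 2)%:E) => [x| |] [y| |] //=.
rewrite -!EFinD !lee_fin => _ _ [] E h; lra.
Qed.

Lemma int_cross j k :
  \int[nu]_M ((\sum_i M i j * M i k - (j == k)%:R * (d%:R * m2)) ^+ 2)%:E <= (d%:R * (m4 + m2 ^+ 2))%:E.
Proof.
have [<-|jk] := eqVneq j k.
  under eq_integral do rewrite mul1r.
  by apply: le_trans (int_diag j) _; rewrite lee_fin ler_wpM2l // lerDl sqr_ge0.
under eq_integral do rewrite mul0r subr0.
apply: le_trans (_ : (d%:R * m2 ^+ 2)%:E <= _); last first.
  by rewrite lee_fin ler_wpM2l // lerDr m4_ge0.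
apply: le_trans (int_offdiag d jk); rewrite le_eqVlt; apply/orP; left; apply/eqP.
apply: eq_integral => M _; congr (_ ^+ 2)%:E.
by apply: eq_bigl => i; rewrite ltn_ord.
Qed.

Definition devconst : R := ((m4 + m2 ^+ 2) / m2 ^+ 2)%R.

(** Each entry of the deviation has second moment at most a constant times lam j * lam k / d, and
    the eigenvalues sum to B; this produces B^2 / d, and Markov's inequality the event. *)
Lemma dev_event g (th : R) : (0 < d)%N -> (1 < B)%N -> (forall j : 'I_B, 0 < lam B g j)%R -> (0 < th)%R ->
  exists E : set (MT R d B), [/\ measurable E,
    nu E <= (devconst * B%:R ^+ 2 / (d%:R * th ^+ 2))%:E &
    forall M : MT R d B, ~ E M -> (frob2 (devmx (d%:R * m2)^-1 g (unwhiten g M)) <= th ^+ 2)%R].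
Proof.
move=> d0 B1 l0 th0; set s : R := ((d%:R * m2)^-1)%R.
have d0R : (0 < d%:R :> R)%R by rewrite ltr0n.
have dm0 : (0 < d%:R * m2)%R by rewrite mulr_gt0 // m2_gt0.
pose Q (j k : 'I_B) (M : MT R d B) : T := ((\sum_i M i j * M i k - (j == k)%:R * (d%:R * m2)) ^+ 2)%R.
have mQ j k : measurable_fun setT (Q j k).
  apply: measurable_funX; apply: measurable_funB => //.
  by apply: measurable_bigsum => i _; apply: measurable_funM; exact: measurable_entry.
have mQ' j k : measurable_fun setT (fun M => (Q j k M)%:E) by apply/measurable_EFinP; exact: mQ.
have Q0 j k M : 0 <= (Q j k M)%:E by exact: sq0.
pose a (j k : 'I_B) : R := (lam B g j * lam B g k * s ^+ 2)%R.
have a0 j k : (0 <= a j k)%R by apply: mulr_ge0; [apply: mulr_ge0; apply: ltW|exact: sqr_ge0].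
have FE (M : MT R d B) : (frob2 (devmx s g (unwhiten g M)) = \sum_j \sum_k a j k * Q j k M)%R.
  apply: eq_bigr => j _; apply: eq_bigr => k _.
  rewrite /devmx /unwhiten /whiten /lamD mul_mx_diag !mxE.
  under eq_bigr do rewrite !mxE.
  set lj := lam B g j; set lk := lam B g k.
  have -> : (\sum_i M i j * Num.sqrt lj * (M i k * Num.sqrt lk) =
     Num.sqrt lj * Num.sqrt lk * \sum_i M i j * M i k)%R.
    by rewrite mulr_sumr; apply: eq_bigr => i _; ring.
  have -> : (lj *+ (j == k) = Num.sqrt lj * Num.sqrt lk * (j == k)%:R)%R.
    rewrite /lj /lk; case: eqP => [->|_]; last by rewrite mulr0.
    by rewrite mulr1 -expr2 sqr_sqrtr // ltW.
  have hj : (lj = Num.sqrt lj ^+ 2)%R by rewrite sqr_sqrtr //; exact: ltW (l0 j).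
  have hk : (lk = Num.sqrt lk ^+ 2)%R by rewrite sqr_sqrtr //; exact: ltW (l0 k).
  rewrite /a /Q -/lj -/lk [in RHS]hj [in RHS]hk.
  move: (Num.sqrt lj) (Num.sqrt lk) (\sum_i M i j * M i k)%R (j == k)%:R => qj qk S e /=.
  by rewrite /s; field; rewrite ?gt_eqF // m2_gt0.
pose F (M : MT R d B) : \bar R := (frob2 (devmx s g (unwhiten g M)))%:E.
have FE' M : F M = \sum_j \sum_k (a j k)%:E * (Q j k M)%:E.
  by rewrite /F FE -sumEFin; apply: eq_bigr => j _; rewrite -sumEFin.
have mF : measurable_fun setT F.
  rewrite (_ : F = fun M => \sum_j \sum_k (a j k)%:E * (Q j k M)%:E); last by apply/funext => M; rewrite FE'.
  by apply: emeasurable_sum => j; apply: emeasurable_sum => k; apply: emeasurable_funM.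
have F0 M : 0 <= F M by rewrite lee_fin frob2_ge0.
have aQ0 j k M : 0 <= (a j k)%:E * (Q j k M)%:E.
  by apply: mule_ge0; [rewrite lee_fin; exact: a0|exact: Q0].
have intF : \int[nu]_M F M <= (B%:R ^+ 2 * (s ^+ 2 * (d%:R * (m4 + m2 ^+ 2))))%:E.
  under eq_integral do rewrite FE'.
  rewrite ge0_integral_sum //; first last.
  - by move=> j M _; apply: sume_ge0 => k _; exact: aQ0.
  - by move=> j; apply: emeasurable_sum => k; apply: emeasurable_funM.
  apply: (@le_trans _ _ (\sum_j \sum_k (a j k * (d%:R * (m4 + m2 ^+ 2)))%:E)).
    apply: lee_sum => j _; rewrite ge0_integral_sum //; last by move=> k; apply: emeasurable_funM.
    apply: lee_sum => k _; rewrite ge0_integralZl ?lee_fin //; try exact: a0.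
    have -> : (a j k * (d%:R * (m4 + m2 ^+ 2)))%:E = (a j k)%:E * (d%:R * (m4 + m2 ^+ 2))%:E by [].
    by apply: lee_wpmul2l; [rewrite lee_fin; exact: a0|exact: int_cross].
  rewrite le_eqVlt; apply/orP; left; apply/eqP.
  have -> : (B%:R ^+ 2 = \sum_(j < B) \sum_(k < B) lam B g j * lam B g k :> R)%R.
    rewrite -(sum_lam g B1) [LHS]expr2 mulr_suml; apply: eq_bigr => j _.
    by rewrite mulr_sumr.
  rewrite mulr_suml -sumEFin; apply: eq_bigr => j _.
  rewrite mulr_suml -sumEFin; apply: eq_bigr => k _; congr EFin.
  by rewrite /a -!mulrA.
have t20 : (0 < th ^+ 2)%R by rewrite exprn_gt0.
set A := [set M | (th ^+ 2)%:E <= F M].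
have mA : measurable A by rewrite -[A]setTI; apply: emeasurable_fun_c_infty.
exists A; split => //; last first.
  by move=> M /negP; rewrite -ltNge => h; apply: ltW; rewrite -lte_fin.
have fA : nu A \is a fin_num by exact: fin_num_measure.
have h := le_trans (markov_ge0 nu mF F0 t20) intF.
have : (th ^+ 2)%:E * (fine (nu A))%:E <= (B%:R ^+ 2 * (s ^+ 2 * (d%:R * (m4 + m2 ^+ 2))))%:E.
  by rewrite fineK.
rewrite -EFinM lee_fin => h'; rewrite -[leLHS]fineK // lee_fin.
rewrite -(ler_pM2l t20); apply: le_trans h' _; rewrite le_eqVlt; apply/orP; left; apply/eqP.
by rewrite /devconst /s; field; rewrite !gt_eqF ?m2_gt0.
Qed.

End SecondMoment.

(** * From the Dirichlet threshold to the classification risk *)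

Section ClassRisk.
Variable R : realType.
Let mu := @lebesgue_measure R.
Local Notation T := (measurableTypeR R).

Lemma measurable_fourier j : measurable_fun setT (fourier j : T -> T).
Proof.
have ms c : measurable_fun setT (fun x : T => sin (c * x) : T).
  apply: (@measurableT_comp _ _ _ T T T sin); last exact: measurable_funM.
  by apply: continuous_measurable_fun; exact: continuous_sin.
have mc c : measurable_fun setT (fun x : T => cos (c * x) : T).
  apply: (@measurableT_comp _ _ _ T T T cos); last exact: measurable_funM.
  by apply: continuous_measurable_fun; exact: continuous_cos.
rewrite /fourier; case: (j == 0)%N; first exact: measurable_cst.
by case: (odd j).
Qed.

Lemma measurable_trigpoly B (c : 'I_B -> R) :
  measurable_fun setT (fun x : T => \sum_(j < B) c j * fourier j x : T).
Proof.
by apply: measurable_bigsum => j _; apply: measurable_funM => //; exact: measurable_fourier.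
Qed.

Lemma measurable_fhat n B (g : R) : measurable_fun setT (fhat n B g : T -> T).
Proof. exact: measurable_trigpoly. Qed.

Lemma measurable_ghat n d B (Z : 'M[R]_(d, B)) : measurable_fun setT (ghat n Z : T -> T).
Proof.
by apply: measurable_bigsum => i _; apply: measurable_funM => //; exact: measurable_trigpoly.
Qed.

Let I11 := [set x : R | -1 <= x <= 1].

Let mI : measurable I11.
Proof.
have -> : I11 = `[-1, 1]%classic by apply/seteqP; split => x; rewrite /= in_itv.
exact: measurable_itv.
Qed.

Section OneFunction.
Variable f : T -> T.
Hypothesis mf : measurable_fun setT f.
Let S := [set x : R | -1 <= x <= 1 /\ Num.sg (f x) != 1].

Let SE : S = I11 `&` f @^-1` [set y | y <= 0].
Proof. by apply/seteqP; split => x [x1 h]; split => //; move: h; rewrite /= sg_neq1. Qed.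

Lemma measurable_errset : measurable S.
Proof.
rewrite SE; apply: measurableI => //; apply: mpre => //.
have -> : [set y : R | y <= 0] = `]-oo, 0]%classic by apply/seteqP; split => x; rewrite /= in_itv.
exact: measurable_itv.
Qed.

(** All cell estimates are upper bounds; lower bounds on the risk come from covering the correctly
    classified points. *)
Lemma class_riskC : 1 - class_risk f = fine (mu (I11 `\` S)) / 2.
Proof.
have muI : mu I11 = 2%:E.
  have -> : I11 = `[-1, 1]%classic by apply/seteqP; split => x; rewrite /= in_itv.
  by rewrite /mu lebesgue_measure_itv /= lte_fin ifT ?EFinN -?EFinD; [congr EFin; ring|lra].
have fin A : A `<=` I11 -> mu A \is a fin_num.
  move=> h; rewrite ge0_fin_numE //; apply: le_lt_trans (le_leb h) _.
  by rewrite -/mu muI ltry.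
have SI : I11 `&` S = S by apply/seteqP; split => x; [case|case].
have : fine (mu I11) = fine (mu (I11 `\` S)) + fine (mu (I11 `&` S)).
  rewrite -fineD; [|apply: fin; exact: subDsetl|apply: fin; exact: subIsetl].
  by rewrite -measureDI //; exact: measurable_errset.
rewrite muI SI /= /class_risk -/mu -/S; lra.
Qed.

Variables (n B : nat) (g e : R).
Let a := wa B g.
Let b := wb B g.
Let M := Mof n B.
Let Q := M.*2.+1.
Hypotheses (hreg : regime B n g) (e0 : 0 <= e)
  (fclose : forall x, `|f x - fhat n B g x| * (a + b * M%:R) <= e).
Let tau := 1 - 2 * (a / b).

Let b2 : 2^-1 <= b. Proof. by case: hreg. Qed.
Let n0 : (0 < n)%N. Proof. by case: hreg; lia. Qed.
Let a0 : 0 <= a.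
Proof. by case: hreg => _ _ /andP[g0 _] _ _; rewrite /a /wa divr_ge0 // mulr_ge0 // ltW. Qed.
Let B0 : (0 < B)%N. Proof. by case: hreg => _ nB _ _ _; apply: leq_trans nB. Qed.

Let k0 : 0 < a + b * M%:R.
Proof.
have a1 : 0 < a.
  by case: hreg => _ _ /andP[g0 _] _ _; rewrite /a /wa divr_gt0 // mulr_gt0 // ltr0n.
by rewrite ltr_wpDr // mulr_ge0 //; apply: le_trans b2.
Qed.

Let fhat_DE x : fhat n B g x * (a + b * M%:R) = a + b * dirich M (ybar n x).
Proof. by case: hreg => _ _ _ _ l0; rewrite fhatE // divfK // gt_eqF. Qed.

Let bDE x : b * (2 * dirich M (ybar n x) + 1 - tau) = 2 * (a + b * dirich M (ybar n x)).
Proof. by rewrite /tau; field; rewrite gt_eqF //; apply: lt_le_trans b2. Qed.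

(** An error e in the numerator a + b D, doubled and divided by b >= 1/2, shifts the threshold by at
    most 4 e. *)
Let err_le x : S x -> 2 * dirich M (ybar n x) + 1 <= tau + 4 * e.
Proof.
move=> [_]; rewrite sg_neq1 => fx; have := fclose x.
rewrite -[X in _ * X]ger0_norm ?(ltW k0) // -normrM mulrBl fhat_DE => /ler_normlP[h1 h2].
have : f x * (a + b * M%:R) <= 0 by rewrite pmulr_lle0.
have := bDE x; set D := 2 * _ + 1; move=> E h3.
rewrite leNgt; apply/negP => h4.
have : 2^-1 * (D - tau) <= b * (D - tau) by rewrite ler_wpM2r //; lra.
lra.
Qed.

Let cor_ge x : (I11 `\` S) x -> tau - 4 * e <= 2 * dirich M (ybar n x) + 1.
Proof.
move=> [x1 nS]; have fx : 0 <= f x.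
  by rewrite leNgt; apply/negP => h; apply: nS; split=> //; rewrite sg_neq1 ltW.
have := fclose x.
rewrite -[X in _ * X]ger0_norm ?(ltW k0) // -normrM mulrBl fhat_DE => /ler_normlP[h1 h2].
have : 0 <= f x * (a + b * M%:R) by rewrite mulr_ge0 // ltW.
have := bDE x; set D := 2 * _ + 1; move=> E h3.
rewrite leNgt; apply/negP => h4.
have : 2^-1 * (tau - D) <= b * (tau - D) by rewrite ler_wpM2r //; lra.
lra.
Qed.

Let mS := measurable_errset.
Let mC : measurable (I11 `\` S). Proof. exact: measurableD. Qed.
Let S1 x : S x -> -1 <= x <= 1. Proof. by case. Qed.
Let C1 x : (I11 `\` S) x -> -1 <= x <= 1. Proof. by case. Qed.
Let crE : class_risk f = fine (mu S) / 2. Proof. by []. Qed.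

Lemma class_neg (t : R) : 0 < t -> tau + 4 * e <= - t -> `|class_risk f - 0| <= 4 / t.
Proof.
move=> t0 h; rewrite subr0 crE ger0_norm; last by rewrite divr_ge0 // fine_ge0.
rewrite ler_pdivrMr // mulrC; apply: (neg_upper (n := n) (M := M)) => // x Sx.
by apply: le_trans h; exact: err_le.
Qed.

Lemma class_half (h : R) : 0 <= h -> tau + 4 * e <= h -> - h <= tau - 4 * e ->
  `|class_risk f - 2^-1| <= Q%:R^-1 + 4 * h.
Proof.
move=> h0 h1 h2.
have u : fine (mu S) <= 2 * (2^-1 + 4 * h).
  by apply: (half_upper (n := n) (M := M)) => // x Sx; apply: le_trans h1; exact: err_le.
have l : fine (mu (I11 `\` S)) <= 2 * (2^-1 + Q%:R^-1 + 4 * h).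
  by apply: (half_lower (n := n) (M := M)) => // x Sx; apply: le_trans h2 _; exact: cor_ge.
have Q0 : 0 <= Q%:R^-1 :> R by rewrite invr_ge0.
have := class_riskC; rewrite ler_norml crE => hC; apply/andP; split; lra.
Qed.

Lemma class_zero (eta h : R) : 0 < eta -> h < eta ^+ 2 / 8 -> 0 <= h < 1 ->
  tau + 4 * e <= 1 + h -> 1 - h <= tau - 4 * e ->
  `|class_risk f - 3 / 4| <= 3 * (eta + Q%:R^-1).
Proof.
move=> eta0 heta h01 h1 h2.
have u : fine (mu S) <= 2 * (3 / 4 + 2 * (eta + Q%:R^-1)).
  apply: (zero_upper n0 mS S1 eta0 heta) => [x Sx|]; last by case/andP: h01.
  by apply: le_trans h1; exact: err_le.
have l : fine (mu (I11 `\` S)) <= 2 * (4^-1 + Q%:R^-1 + 2 * (eta + Q%:R^-1)).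
  apply: (zero_lower n0 mC C1 eta0 heta) => // x Sx.
  by apply: le_trans h2 _; exact: cor_ge.
have Q0 : 0 <= Q%:R^-1 :> R by rewrite invr_ge0.
have := class_riskC; rewrite ler_norml crE => hC; apply/andP; split; lra.
Qed.

End OneFunction.
End ClassRisk.

(** * Limits of the classification risk and the choice of the deviation scale *)

Section ClassLimit.
Variable R : realType.
Local Notation T := (measurableTypeR R).

Lemma truncn_bounds (s : R) n : let B := Num.truncn ((n%:R : R) `^ s) in
  B%:R <= (n%:R : R) `^ s < B%:R + 1.
Proof. by rewrite /= natr1; apply: truncn_itv; exact: powR_ge0. Qed.

Lemma S0of_le n B : (0 < n)%N -> (S0of n B <= (Mof n B).*2.+1)%N.
Proof.
move=> n0; rewrite /S0of /Mof; set N := (B.-1)./2.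
rewrite -ltnS ltn_divLR //; have := ltn_ceil N n0; lia.
Qed.

Lemma Mof_le n B : (Mof n B * n.*2 <= B)%N.
Proof.
have := leq_divM (B.-1./2) n; rewrite /Mof -doubleMr.
have := odd_double_half B.-1; case: (odd _) => /=; lia.
Qed.

Lemma gam_pow (p q : R) n : (0 < n)%N -> gam q n * (n%:R : R) `^ p = (n%:R : R) `^ (p - q).
Proof.
move=> n0; have n1 : n%:R != 0 :> R by rewrite pnatr_eq0 -lt0n.
by rewrite /gam addrC powRD // n1 implybT.
Qed.

Lemma near_inv_le (c e : R) : 0 < e -> \forall n \near \oo, c * (n%:R)^-1 <= e.
Proof.
move=> e0; near=> n; have n0 : (0 < n)%N by near: n; exact: nbhs_infty_gt.
have h : c / e <= (n%:R : R) `^ 1 by near: n; exact: powR_near_ge.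
rewrite powRr1 // ler_pdivrMr // in h.
by rewrite ler_pdivrMr ?ltr0n // mulrC.
Unshelve. all: by end_near. Qed.

(** The error is measured after multiplication by the positive denominator of [fhat], which leaves
    signs unchanged. The constant 24 dominates the 8 sqrt 6 that arises in [ghat_close_near]. *)
Definition close_to_fhat (p q : R) n (f : R -> R) : Prop :=
  let B := sizeB p n in let g := gam q n in
  forall x, `|f x - fhat n B g x| * (wa B g + wb B g * (Mof n B)%:R) <= 24 / n%:R.

Let thr B (g : R) := 1 - 2 * (wa B g / wb B g).

Let thrE B (g : R) : (1 < B)%N -> g < 1 -> thr B g = 1 - g * (B%:R - 1) / (1 - g).
Proof.
move=> B1 g1; have B1' : 1 < B%:R :> R by rewrite ltr1n.
rewrite /thr /wa /wb; field.
by apply/and3P; split; apply/eqP; lra.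
Qed.

(** Uniformity in f lets one limit L serve both [fhat] itself and [ghat] outside the exceptional
    event. *)
Lemma class_limit (p q : R) : 1 < p -> 1 < q ->
  exists L : R, forall eps : R, 0 < eps -> \forall n \near \oo, forall f : T -> T,
    measurable_fun setT f -> close_to_fhat p q n f -> `|class_risk f - L| <= eps.
Proof.
move=> p1 q1; have half1 : 2^-1 < 1 :> R by lra.
have [pq|qp|pq] := ltgtP p q.
- exists (3 / 4) => eps eps0.
  pose eta : R := Num.min (eps / 6) 1.
  have eta0 : 0 < eta by rewrite lt_min ltr01 andbT divr_gt0.
  have eta1 : eta <= 1 by rewrite ge_min lexx orbT.
  have etae : eta <= eps / 6 by rewrite ge_min lexx.
  (* This is below the eta^2 / 8 required by [class_zero] and, as eta <= 1, below 1. *)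
  pose h : R := eta ^+ 2 / 16.
  have h0 : 0 < h by rewrite divr_gt0 // exprn_gt0.
  have h1 : eta ^+ 2 <= 1 by rewrite expr_le1 // ltW.
  have h20 : 0 < h / 2 by rewrite divr_gt0.
  have h40 : 0 < h / 4 by rewrite divr_gt0.
  have qp0 : 0 < q - p by rewrite subr_gt0.
  near=> n.
  have [reg CS _] : [/\ regime (sizeB p n) n (gam q n), 6 / eps <= (S0of n (sizeB p n))%:R &
      (6 / eps) * wa (sizeB p n) (gam q n) <= (S0of n (sizeB p n))%:R] by near: n; exact: regime_near.
  have e1 : 96 * (n%:R)^-1 <= h / 2 by near: n; exact: near_inv_le.
  have y1 : 4 / h <= (n%:R : R) `^ (q - p) by near: n; exact: powR_near_ge.
  move=> f mf cf; have [n2 nB /andP[g0 g2] wb2 lam0] := reg.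
  have n0 : (0 < n)%N by apply: ltnW.
  have B1 : (1 < sizeB p n)%N by apply: leq_trans nB; rewrite ltnS double_gt0.
  have [BL BU] := andP (truncn_bounds p n).
  have hgB : gam q n * ((sizeB p n)%:R - 1) <= h / 4.
    have lep : (sizeB p n)%:R - 1 <= (n%:R : R) `^ p by rewrite /sizeB; lra.
    apply: (le_trans (ler_wpM2l (ltW g0) lep)).
    rewrite gam_pow // -opprB powRN invf_ple ?posrE ?powR_gt0 ?ltr0n //.
    by rewrite invf_div.
  have gge0 : 0 <= gam q n * ((sizeB p n)%:R - 1).
    by rewrite mulr_ge0 ?(ltW g0) // subr_ge0 ler1n ltnW.
  have tb : 0 <= gam q n * ((sizeB p n)%:R - 1) / (1 - gam q n) <= h / 2.
    have hg : h * gam q n <= h * 2^-1 by rewrite ler_wpM2l // ltW.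
    apply/andP; split; first by rewrite divr_ge0 //; lra.
    by rewrite ler_pdivrMr; clear -hg hgB g2 h0; lra.
  have := thrE B1 (le_lt_trans g2 half1); set tt := _ / (1 - _) in tb *; move=> tE.
  have e24 : 24 / n%:R = 24 * n%:R^-1 by [].
  have hQ : ((Mof n (sizeB p n)).*2.+1%:R)^-1 <= eps / 6.
    rewrite -[leRHS]invrK lef_pV2 ?posrE ?ltr0n ?invr_gt0 ?divr_gt0 // invf_div.
    by apply: le_trans CS _; rewrite ler_nat S0of_le.
  have ef : 0 <= 24 / n%:R :> R by rewrite divr_ge0.
  apply: le_trans (class_zero mf reg ef cf eta0 (h := h) _ _ _ _) _.
  + rewrite /h; suff : 0 < eta ^+ 2 by clear; lra. by rewrite exprn_gt0.
  + by apply/andP; split; [exact: ltW|rewrite /h; clear -h1; lra].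
  + rewrite -/(thr _ _) tE; clear -tb e1 h0; lra.
  + rewrite -/(thr _ _) tE; clear -tb e1 h0; lra.
  + by apply: le_trans (ler_wpM2l _ (lerD etae hQ)) _ => //; clear; lra.
- exists 0 => eps eps0.
  have pq0 : 0 < p - q by rewrite subr_gt0.
  have t0 : 0 < 4 / eps by rewrite divr_gt0.
  near=> n.
  have [reg CS _] : [/\ regime (sizeB p n) n (gam q n), 6 / eps <= (S0of n (sizeB p n))%:R &
      (6 / eps) * wa (sizeB p n) (gam q n) <= (S0of n (sizeB p n))%:R] by near: n; exact: regime_near.
  have e1 : 96 * (n%:R)^-1 <= 1 :> R by near: n; exact: near_inv_le.
  have y1 : 4 / eps + 4 <= (n%:R : R) `^ (p - q) by near: n; exact: powR_near_ge.
  move=> f mf cf; have [n2 nB /andP[g0 g2] wb2 lam0] := reg.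
  have n0 : (0 < n)%N by apply: ltnW.
  have B1 : (1 < sizeB p n)%N by apply: leq_trans nB; rewrite ltnS double_gt0.
  have [BL BU] := andP (truncn_bounds p n).
  have hgB : (n%:R : R) `^ (p - q) - 1 <= gam q n * ((sizeB p n)%:R - 1).
    rewrite -gam_pow //.
    have : gam q n * (n%:R : R) `^ p <= gam q n * ((sizeB p n)%:R + 1).
      by rewrite ler_wpM2l ?ltW.
    lra.
  have tb : gam q n * ((sizeB p n)%:R - 1) <= gam q n * ((sizeB p n)%:R - 1) / (1 - gam q n).
    rewrite ler_pdivlMr; last by lra.
    have : 0 <= gam q n * ((sizeB p n)%:R - 1) by lra.
    move=> /(mulr_ge0 (ltW g0)); lra.
  have := thrE B1 (le_lt_trans g2 half1); set tt := _ / (1 - _) in tb *; move=> tE.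
  have e24 : 24 / n%:R = 24 * n%:R^-1 by [].
  have ef : 0 <= 24 / n%:R :> R by rewrite divr_ge0.
  apply: le_trans (class_neg mf reg ef cf t0 _) _.
  + rewrite -/(thr _ _) tE; clear -tb e1 hgB y1; lra.
  + by rewrite invf_div mulrCA divff // mulr1.
- subst q; exists (2^-1) => eps eps0.
  pose h : R := eps / 8; have h0 : 0 < h by rewrite divr_gt0.
  have h20 : 0 < h / 2 by rewrite divr_gt0.
  have h40 : 0 < h / 4 by rewrite divr_gt0.
  have p0 : 0 < p by lra.
  near=> n.
  have [reg CS _] : [/\ regime (sizeB p n) n (gam p n), 2 / eps <= (S0of n (sizeB p n))%:R &
      (2 / eps) * wa (sizeB p n) (gam p n) <= (S0of n (sizeB p n))%:R] by near: n; exact: regime_near.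
  have e1 : 96 * (n%:R)^-1 <= h / 2 by near: n; exact: near_inv_le.
  have y1 : 4 / h <= (n%:R : R) `^ p by near: n; exact: powR_near_ge.
  move=> f mf cf; have [n2 nB /andP[g0 g2] wb2 lam0] := reg.
  have n0 : (0 < n)%N by apply: ltnW.
  have B1 : (1 < sizeB p n)%N by apply: leq_trans nB; rewrite ltnS double_gt0.
  have [BL BU] := andP (truncn_bounds p n).
  have gp : gam p n * (n%:R : R) `^ p = 1 by rewrite gam_pow // subrr powRr0.
  have gh : gam p n <= h / 4.
    rewrite /gam powRN invf_ple ?posrE ?powR_gt0 ?ltr0n //.
    by rewrite invf_div.
  have ge1 : gam p n * (sizeB p n)%:R <= 1 by have := ler_wpM2l (ltW g0) BL; rewrite gp.
  have ge2 : 1 <= gam p n * (sizeB p n)%:R + gam p n.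
    have := ler_wpM2l (ltW g0) (ltW BU); rewrite gp -/(sizeB p n); lra.
  have tb : 1 - h / 2 <= gam p n * ((sizeB p n)%:R - 1) / (1 - gam p n) <= 1.
    have g1 : 0 < 1 - gam p n by clear -g2; lra.
    rewrite ler_pdivlMr // ler_pdivrMr //.
    have : h / 2 * gam p n <= h / 2 * 2^-1 by rewrite ler_wpM2l // ltW.
    by move=> hg; apply/andP; split; clear -hg ge1 ge2 gh h0; lra.
  have := thrE B1 (le_lt_trans g2 half1); set tt := _ / (1 - _) in tb *; move=> tE.
  have e24 : 24 / n%:R = 24 * n%:R^-1 by [].
  have hQ : ((Mof n (sizeB p n)).*2.+1%:R)^-1 <= eps / 2.
    rewrite -[leRHS]invrK lef_pV2 ?posrE ?ltr0n ?invr_gt0 ?divr_gt0 // invf_div.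
    by apply: le_trans CS _; rewrite ler_nat S0of_le.
  have ef : 0 <= 24 / n%:R :> R by rewrite divr_ge0.
  apply: le_trans (class_half mf reg ef cf (ltW h0) _ _) _.
  + rewrite -/(thr _ _) tE; clear -tb e1 h0; lra.
  + rewrite -/(thr _ _) tE; clear -tb e1 h0; lra.
  + by rewrite -lerBrDr; apply: le_trans hQ _; rewrite /h; clear; lra.
Unshelve. all: by end_near. Qed.

(* P(sqrt frob2 > theta) = O(n ^ (6 p - 1 - T)), while a deviation theta moves the
   decision threshold by O(1/n) only. *)
Definition theta (p : R) n : R := Num.sqrt n%:R / ((n%:R : R) `^ p) ^+ 2.

(** With x = n^(p - 1), the eigenvalues are at most x + 2, B at most n x and the denominator of
    [fhat] at most 2 x. The perturbation bound becomes theta * 8 x * sqrt (6 n) * x, and theta =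
    sqrt n / (n x)^2 makes this 8 sqrt 6 / n. *)
Lemma ghat_close_near (p q : R) : 1 < p -> 1 < q ->
  \forall n \near \oo, forall d (Z : 'M[R]_(d, sizeB p n)) s, 0 < s ->
    Num.sqrt (frob2 (devmx s (gam q n) Z)) <= theta p n -> close_to_fhat p q n (ghat n Z).
Proof.
move=> p1 q1; have p0 : 0 < p - 1 by rewrite subr_gt0.
have q0 : 0 < q - 1 by rewrite subr_gt0.
near=> n.
have [reg _ _] : [/\ regime (sizeB p n) n (gam q n), 1 <= (S0of n (sizeB p n))%:R :> R &
    1 * wa (sizeB p n) (gam q n) <= (S0of n (sizeB p n))%:R] by near: n; exact: regime_near.
have x4 : 4 <= (n%:R : R) `^ (p - 1) by near: n; exact: powR_near_ge.
have y1 : 1 <= (n%:R : R) `^ (q - 1) by near: n; exact: powR_near_ge.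
move=> d Z s s0 hth; rewrite /close_to_fhat /= => x0; have [n2 nB /andP[g0 g2] wb2 lam0] := reg.
have n0 : (0 < n)%N by apply: ltnW.
have n0R : 0 < n%:R :> R by rewrite ltr0n.
have n2R : 2 <= n%:R :> R by rewrite ler_nat.
have B3 : 3 <= (sizeB p n)%:R :> R.
  by rewrite ler_nat (leq_trans _ nB) // ltnS (leq_trans n2) // -addnn leq_addr.
have /andP[BL _] := truncn_bounds p n; rewrite -/(sizeB p n) in BL.
set x := (n%:R : R) `^ (p - 1) in x4.
have px : (n%:R : R) `^ p = n%:R * x by rewrite mulr_powRB1 //; lra.
have ng : gam q n * n%:R <= 1.
  rewrite /gam powRN -[X in _^-1 * X]powRr1 ?ler0n // ler_pdivrMl ?powR_gt0 // mulr1.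
  by apply: ler_powR; [rewrite ler1n|exact: ltW].
set B := sizeB p n in Z hth reg nB wb2 lam0 B3 BL *; set g := gam q n in hth reg g0 g2 wb2 lam0 ng *.
rewrite px in BL.
have a1 : wa B g <= x / 2.
  rewrite /wa ler_pM2r ?invr_gt0 //; apply: le_trans (ler_wpM2l (ltW g0) BL) _.
  rewrite mulrA -[leRHS]mul1r ler_wpM2r //; lra.
have b32 : wb B g <= 3 / 2.
  rewrite /wb ler_pdivrMr; last by lra.
  have : (1 - g) * B%:R <= 1 * B%:R by rewrite ler_wpM2r //; lra.
  lra.
have Mx : (Mof n B)%:R <= x / 2.
  have := Mof_le n B.
  rewrite -(ler_nat R) natrM -muln2 natrM => h.
  have : n%:R * ((Mof n B)%:R * 2) <= n%:R * x by lra.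
  by rewrite ler_pM2l // ler_pdivlMr.
have kx : wa B g + wb B g * (Mof n B)%:R <= 2 * x.
  have : wb B g * (Mof n B)%:R <= 3 / 2 * (x / 2) by rewrite ler_pM //; lra.
  lra.
have La (j : 'I_B) : lam B g j <= x + 2.
  rewrite /lam; case: ifP => _; first by rewrite /wa in a1; lra.
  by rewrite -/(wb B g); clear -b32 x4; lra.
set k := wa B g + _ in kx *.
have sn : 0 < Num.sqrt n%:R :> R by rewrite sqrtr_gt0.
have nx0 : 0 < n%:R * x by rewrite mulr_gt0 //; clear -x4; lra.
have th0 : 0 <= theta p n by rewrite divr_ge0 // sqr_ge0.
have sqn : Num.sqrt n%:R ^+ 2 = n%:R :> R by rewrite sqr_sqrtr.
have sn1 : 1 <= Num.sqrt n%:R :> R by have /ler_wsqrtr : 1 <= n%:R :> R; rewrite ?ler1n ?sqrtr1.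
have snn : Num.sqrt n%:R <= n%:R :> R by rewrite -{2}sqn expr2 ler_peMr // ltW.
have th8 : theta p n <= 8^-1.
  rewrite /theta px ler_pdivrMr ?exprn_gt0 //.
  have : n%:R * (2 * (4 * 4)) <= (n%:R * x) ^+ 2.
    rewrite exprMn expr2 -mulrA ler_pM2l //; apply: ler_pM => //.
    by rewrite expr2; apply: ler_pM.
  by clear -snn n0R; lra.
have := ghat_fhat_close x0 n0 nB (ltW g0) lam0 wb2 La s0 th0 th8 hth.
rewrite -/k => H.
have k0 : 0 <= k.
  rewrite /k addr_ge0 //; first by rewrite /wa divr_ge0 // mulr_ge0 // ltW.
  by rewrite mulr_ge0 //; clear -wb2; lra.
rewrite -[X in _ * X](sqr_sqrtr k0) expr2 mulrA.
have sk : Num.sqrt k <= Num.sqrt (2 * x) by rewrite ler_wsqrtr.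
have s3 : Num.sqrt (3 * B%:R) <= Num.sqrt (3 * (n%:R * x)) by rewrite ler_wsqrtr // ler_pM2l.
apply: (@le_trans _ _ (theta p n * Num.sqrt (3 * (n%:R * x)) * (8 * x) * Num.sqrt (2 * x))).
  apply: ler_pM => //.
  apply: le_trans H _; apply: ler_pM; rewrite ?mulr_ge0 //; first by lra.
    by rewrite ler_wpM2l.
  by clear -x4; lra.
have -> : theta p n * Num.sqrt (3 * (n%:R * x)) * (8 * x) * Num.sqrt (2 * x) =
   theta p n * (8 * x) * (Num.sqrt (3 * (n%:R * x)) * Num.sqrt (2 * x)) by ring.
have x0' : 0 <= x by clear -x4; lra.
rewrite -sqrtrM; last by rewrite !mulr_ge0.
have -> : 3 * (n%:R * x) * (2 * x) = 6 * n%:R * x ^+ 2 by ring.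
rewrite sqrtrM ?mulr_ge0 // sqrtr_sqr ger0_norm // sqrtrM //.
have s6 : Num.sqrt 6 <= 3 :> R.
  have -> : 3 = Num.sqrt (3 ^+ 2) :> R by rewrite sqrtr_sqr ger0_norm.
  by rewrite ler_wsqrtr //; lra.
rewrite /theta px.
have -> : Num.sqrt n%:R / (n%:R * x) ^+ 2 * (8 * x) * (Num.sqrt 6 * Num.sqrt n%:R * x) =
   8 * Num.sqrt 6 * (Num.sqrt n%:R ^+ 2 / n%:R ^+ 2).
  by field; rewrite !gt_eqF //; lra.
rewrite sqn (_ : n%:R / n%:R ^+ 2 = n%:R^-1); last by field; rewrite gt_eqF.
by rewrite ler_pM2r ?invr_gt0 //; clear -s6; lra.
Unshelve. all: by end_near. Qed.

Lemma dev_prob_near (p Tt K del : R) : 0 < Tt -> 6 * p - 1 < Tt -> 0 <= K -> 0 < del ->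
  \forall n \near \oo, (0 < sizeD Tt n)%N /\
    K * (sizeB p n)%:R ^+ 2 / ((sizeD Tt n)%:R * theta p n ^+ 2) <= del.
Proof.
move=> T0 pT K0 del0; have u0 : 0 < Tt + 1 - 6 * p by lra.
near=> n.
have n0 : (0 < n)%N by near: n; exact: nbhs_infty_gt.
have t2 : 2 <= (n%:R : R) `^ Tt by near: n; exact: powR_near_ge.
have uK : 2 * K / del <= (n%:R : R) `^ (Tt + 1 - 6 * p) by near: n; exact: powR_near_ge.
have /andP[BL _] := truncn_bounds p n; rewrite -/(sizeB p n) in BL.
have /andP[_ DU] := truncn_bounds Tt n; rewrite -/(sizeD Tt n) in DU.
have n0R : 0 < n%:R :> R by rewrite ltr0n.
have x0 : 0 < (n%:R : R) `^ p by rewrite powR_gt0.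
have dR : (n%:R : R) `^ Tt / 2 <= (sizeD Tt n)%:R by lra.
have d0R : 0 < (sizeD Tt n)%:R :> R by lra.
split; first by rewrite -(ltr_nat R).
(* The exponent budget: B^2 / (d theta^2) is at most of order X^6 / (n^T n) with X = n^p. *)
have npE : (n%:R : R) `^ Tt * n%:R = (n%:R : R) `^ (Tt + 1 - 6 * p) * ((n%:R : R) `^ p) ^+ 6.
  have e6 : ((n%:R : R) `^ p) ^+ 6 = (n%:R : R) `^ (p * 6%:R).
    by rewrite powRrM powR_mulrn ?powR_ge0.
  have e1 : (n%:R : R) = (n%:R : R) `^ 1 by rewrite powRr1.
  have nz : (n%:R : R) != 0 by rewrite gt_eqF.
  rewrite {2}e1 e6 -!powRD ?nz ?implybT //; congr (_ `^ _); ring.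
set X := (n%:R : R) `^ p in BL x0 npE; set U := (n%:R : R) `^ (Tt + 1 - _) in uK npE.
have thE : theta p n ^+ 2 = n%:R / X ^+ 4.
  by rewrite /theta -/X expr_div_n sqr_sqrtr // -exprM.
rewrite thE ler_pdivrMr; last by rewrite mulr_gt0 // divr_gt0 // exprn_gt0.
have BX : (sizeB p n)%:R ^+ 2 <= X ^+ 2 by rewrite ler_pXn2r // nnegrE // ltW.
apply: le_trans (ler_wpM2l K0 BX) _.
rewrite ler_pdivrMr // in uK.
have h : n%:R * ((n%:R : R) `^ Tt / 2) <= n%:R * (sizeD Tt n)%:R by rewrite ler_pM2l.
have -> : del * ((sizeD Tt n)%:R * (n%:R / X ^+ 4)) = del * (n%:R * (sizeD Tt n)%:R) / X ^+ 4 by ring.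
rewrite ler_pdivlMr ?exprn_gt0 //.
have -> : K * X ^+ 2 * X ^+ 4 = K * X ^+ 6 by rewrite -mulrA -exprD.
have X6 : 0 < X ^+ 6 by rewrite exprn_gt0.
have h2 : 2 * K * X ^+ 6 <= U * del * X ^+ 6 by rewrite ler_pM2r.
have h3 : del * (n%:R * ((n%:R : R) `^ Tt / 2)) <= del * (n%:R * (sizeD Tt n)%:R) by rewrite ler_pM2l.
have h4 : del * (n%:R * ((n%:R : R) `^ Tt / 2)) = U * del * X ^+ 6 / 2.
  by transitivity (del * ((n%:R : R) `^ Tt * n%:R) / 2); [ring|rewrite npE; ring].
lra.
Unshelve. all: by end_near. Qed.

End ClassLimit.

Theorem theorem2 (R : realType) (p q T : R) (hp : 1 < p) (hq : 1 < q) (hT : 0 < T)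
  (dd : measure_display) (Om : measurableType dd) (P : probability Om R)
  (Z : forall n : nat, Om -> 'M[R]_(sizeD T n, sizeB p n))
  (Zmeas : forall n i j, measurable_fun setT (fun w => Z n w i j))
  (Zlaw : forall n i (j : 'I_(sizeB p n)) (A : set R), measurable A ->
     P ((fun w => Z n w i j) @^-1` A)
     = normal_prob 0 (Num.sqrt (lam (sizeB p n) (gam q n) j)) A)
  (Zindep : forall n (A : 'I_(sizeD T n) -> 'I_(sizeB p n) -> set R),
     (forall i j, measurable (A i j)) ->
     fine (P [set w | forall i j, A i j (Z n w i j)])
     = \prod_(i < sizeD T n) \prod_(j < sizeB p n)
         fine (P ((fun w => Z n w i j) @^-1` A i j))) :
  (6 * p - 1 < T ->
     exists L : R,
       (fun n => class_risk (fhat n (sizeB p n) (gam q n))) @ \oo --> L /\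
       cvg_in_prob P (fun n w => class_risk (ghat n (Z n w))) L) /\
  (6 * p + 1 - 2 * q < T ->
     exists L : R,
       (fun n => adv_risk (fhat n (sizeB p n) (gam q n)) (n%:R^-1)) @ \oo --> L /\
       cvg_in_prob P (fun n w => adv_risk (ghat n (Z n w)) (n%:R^-1)) L).
Proof.
split=> hTp.
- have [L HL] := class_limit hp hq; exists L; split.
    apply/cvgrPdist_le => e e0; near=> n; rewrite distrC.
    have H : forall f : measurableTypeR R -> measurableTypeR R,
      measurable_fun setT f -> close_to_fhat p q n f -> `|class_risk f - L| <= e.
      by near: n; exact: HL.
    apply: H; first exact: measurable_fhat.
    by move=> x; rewrite subrr normr0 mul0r divr_ge0.
  have K0 : 0 <= devconst R by rewrite divr_ge0 ?sqr_ge0 // addr_ge0 ?m4_ge0 ?sqr_ge0.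
  apply: cvg_in_prob_near => e del e0 del0; near=> n.
  have H : forall f : measurableTypeR R -> measurableTypeR R,
    measurable_fun setT f -> close_to_fhat p q n f -> `|class_risk f - L| <= e.
    by near: n; exact: HL.
  have Hg : forall d (Z : 'M[R]_(d, sizeB p n)) s, 0 < s ->
    Num.sqrt (frob2 (devmx s (gam q n) Z)) <= theta p n -> close_to_fhat p q n (ghat n Z).
    by near: n; exact: ghat_close_near.
  have [d0 Hd] : (0 < sizeD T n)%N /\
    devconst R * (sizeB p n)%:R ^+ 2 / ((sizeD T n)%:R * theta p n ^+ 2) <= del.
    by near: n; exact: dev_prob_near.
  have [[n2 nB _ _ lam0] _ _] : [/\ regime (sizeB p n) n (gam q n), 1 <= (S0of n (sizeB p n))%:R :> R &
      1 * wa (sizeB p n) (gam q n) <= (S0of n (sizeB p n))%:R] by near: n; exact: regime_near.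
  have B1 : (1 < sizeB p n)%N by apply: leq_trans nB; rewrite ltnS double_gt0 ltnW.
  have s0 (j : 'I_(sizeB p n)) : 0 < Num.sqrt (lam (sizeB p n) (gam q n) j) by rewrite sqrtr_gt0.
  have th0 : 0 < theta p n by rewrite divr_gt0 ?sqrtr_gt0 ?exprn_gt0 ?powR_gt0 ?ltr0n // ltnW.
  pose nZ := scalecol_mfun (fun j => Num.sqrt (lam (sizeB p n) (gam q n) j)) (Zmeas n).
  have nuZ : stdmx (distribution P nZ) by exact: stdmx_scalecol (Zlaw n) (Zindep n).
  have [E [mE PE hE]] := dev_event nuZ d0 B1 lam0 th0.
  exists (nZ @^-1` E); split.
  + by rewrite -[_ @^-1` _]setTI; exact: (measurable_scalecol _ (Zmeas n)).
  + move=> w /=; apply: contraPP => nE; apply/negP; rewrite -leNgt.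
    apply: H; first exact: measurable_ghat.
    apply: (Hg _ _ ((sizeD T n)%:R * m2 R)^-1).
      by rewrite invr_gt0 mulr_gt0 ?m2_gt0 // ltr0n.
    have := hE (nZ w) nE; rewrite unwhiten_scalecol //.
    by move=> /ler_wsqrtr; rewrite sqrtr_sqr ger0_norm // ltW.
  + by apply: le_trans PE _; rewrite lee_fin.
- exists 1; split.
    apply/cvgrPdist_le => e e0; near=> n.
    have [reg gr] : regime (sizeB p n) n (gam q n) /\ gap_regime (sizeB p n) n (gam q n) 1 e.
      by near: n; exact: gap_regime_near.
    have h1 := adv_fhat_ge reg gr; have h2 := adv_risk_le1 (fhat n (sizeB p n) (gam q n)) n%:R^-1.
    rewrite ger0_norm ?subr_ge0 //; lra.
  apply: cvg_in_prob_near => e del e0 del0.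
  (* The number of points per gap is fixed before n: 2^-L only has to beat the Markov factor 2 /
     e. *)
  have [L0 [L0' hL]] : exists L, (0 < L)%N /\ 2 / e * (2 ^+ L)^-1 <= del.
    exists (Num.truncn (2 / e / del)).+1; split => //.
    have /andP[_ h] := truncn_itv (ltW (ltac:(by rewrite !divr_gt0) : 0 < 2 / e / del)).
    set k := Num.truncn _ in h *.
    have h2 : k.+1%:R <= 2 ^+ k.+1 :> R by rewrite -natrX ler_nat ltnW // ltn_expl.
    rewrite ler_pdivrMr ?exprn_gt0 // -ler_pdivrMl // mulrC.
    by apply: le_trans h2; exact: ltW.
  near=> n.
  have [reg gr] : regime (sizeB p n) n (gam q n) /\ gap_regime (sizeB p n) n (gam q n) L0 (e / 2).
    by near: n; apply: gap_regime_near => //; rewrite divr_gt0.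
  have [E [mE hE PE]] := adv_ghat_event (Zmeas n) (Zlaw n) (Zindep n) reg gr e0.
  exists E; split => //; apply: le_trans PE _; by rewrite lee_fin.
Unshelve. all: by end_near. Qed.
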